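(* Let $r\in\{1,\ldots,7\}$ and $k\in\{0,1,2,3,4\}$. There exists a cubic surface of rank $r$ with exactly $k$ singular points if and only if one of the following holds: (i) $r=3$ and $k=1$; (ii) $r=4$ and $k\in\{0,1\}$; (iii) $r=5$ and $k\in\{0,1,2,3,4\}$; (iv) $r=6$ and $k\in\{0,1,2,3\}$. In particular, no cubic surface of rank $1$, $2$ or $7$ has exactly $k$ singular points for any $k\in\{0,1,2,3,4\}$.
   Context: A cubic surface is a nonzero homogeneous polynomial $f$ of degree $3$ in four variables $x_1,\ldots,x_4$ with complex coefficients, identified with its vanishing locus in $\mathbb{P}^3=\mathbb{P}^3_{\mathbb{C}}$. A point $p\in\mathbb{P}^3$ is a singular point of $f$ if all partial derivatives of $f$ vanish at $p$. The rank of $f$ is the smallest $r$ such that $f=l_1^3+\cdots+l_r^3$ with $l_i$ complex linear forms. *)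

(* Defs.v *)
From HB Require Import structures.
From mathcomp Require Import all_boot all_order all_algebra.
From mathcomp Require Import complex.
From mathcomp Require Import reals.
From mathcomp.multinomials Require Import mpoly.
Set Implicit Arguments.
Unset Strict Implicit.
Unset Printing Implicit Defensive.
Import GRing.Theory.
Local Open Scope ring_scope.

Section CubicSurfaces.
Variable C : fieldType.
Implicit Type f : {mpoly C[4]}.

Definition cubic_surface f : bool := (f != 0) && (f \is 3.-homog).

(* Points of P^3 are the lines through the origin of C^4. *)
Definition P3 : eqType := {L : {vspace 'rV[C]_4} | \dim L == 1%N}.

(* Homogeneous coordinates of [p] are the nonzero vectors of the line [val p]. *)
Definition singular_point f (p : P3) : Prop :=
  forall v : 'rV[C]_4, v \in val p -> v != 0 ->
  forall i : 'I_4, (f^`M(i)).@[v 0] = 0.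

(* In particular, false for every [k] if there are infinitely many singular
   points. *)
Definition exactly_k_singular_points f (k : nat) : Prop :=
  exists s : seq P3,
    [/\ uniq s, size s = k & forall p : P3, p \in s <-> singular_point f p].

(* Linear forms may be zero: [1.-homog] holds of the zero polynomial. *)
Definition sum_of_cubes f (r : nat) : Prop :=
  exists l : 'I_r -> {mpoly C[4]},
    (forall i, l i \is 1.-homog) /\ f = \sum_(i < r) l i ^+ 3.

Definition has_rank f (r : nat) : Prop :=
  sum_of_cubes f r /\ forall s : nat, sum_of_cubes f s -> (r <= s)%N.

End CubicSurfaces.

(* Main.v *)
From HB Require Import structures.
Require Import Defs.
From mathcomp Require Import all_boot all_order all_algebra all_field.
From mathcomp Require Import complex.
From mathcomp Require Import reals.
From mathcomp.multinomials Require Import mpoly.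
From mathcomp Require Import ring zify.
Set Implicit Arguments.
Unset Strict Implicit.
Unset Printing Implicit Defensive.
Import Order.TTheory GRing.Theory Num.Theory.
Local Open Scope ring_scope.

(** A cubic form in four variables is studied through its symmetric trilinear form
[F] on the coordinate space. A vector [v] represents a singular point when the
functional [F v v] vanishes, and rank is about writing [F v v v] as a sum of cubes of
linear functionals. The polar quadric of [v] is the symmetric bilinear form [F v].

Few cubes force singularities. Three linear forms on a space of dimension four have a
common zero, and a common zero of all summands is singular; two of them have a whole
line of common zeros. For four summands, either the forms are coordinates, and the
surface is smooth, or the surface is a cone, and the line joining the vertex to any
other singular point is singular ([cubes4_one_singular]). In the other direction, four
isolated singular points are linearly independent and in coordinates at them only the
products of three distinct coordinates survive: this is the Cayley cubic, which is a
sum of five cubes ([four_singular_cubes5]).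

The main step is that a cubic with finitely many singular points is a sum of six cubes
([finite_sing_cubes6]). A binary cubic of nonzero discriminant is a sum of two cubes,
and adding a multiple of the cube of one variable makes the discriminant nonzero for
all but finitely many multiples; so cubics are split into binary ones that share
variables, and multiples of cubes of the shared variables are moved around.

- If some polar quadric has rank at most two ([corank2_cubes6]), there are explicit
  normal forms. At a singular point they are those of a binode, a unode or a cone
  ([sing_corank2_cubes6]); otherwise [F] is a binary cubic plus a plane cubic sharing
  one variable, and a plane cubic is a sum of four cubes unless it is a conic with a
  tangent line ([ternary_cubes4], [smooth_corank2_cubes6]).

- If all polar quadrics have rank at least three, some line spanned by [v] and [v']
  has four distinct singular polar quadrics, with kernels [k i], and [F v v (k i)] is
  not zero ([good_line]). The pencil of polar quadrics is then diagonal in the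
  coordinates [x i] dual to the [k i], so that [F] minus a combination of the four
  cubes of the [x i] is a binary cubic in the two functionals vanishing on the line
  ([diagonal_decomposition]). If that binary cubic has a nonzero discriminant, it is a
  sum of two cubes. If it is [p ^ 2 * r], then [p] and [r] are combinations of the
  [x i], and Lagrange interpolation at the roots of two polynomials, whose residues
  add up to zero, rewrites the four cubes and [p ^ 2 * r] with five new cubes and a
  multiple of [p ^ 3] ([interpolated_cubes], [diagonal_tangent_cubes6]).

The good line exists because the Hessian determinant has a nonzero differential
wherever it vanishes at a vector that is not singular, so that moving a line separates
the roots of the determinant on it
([generic_line], [generic_separable]); that [F v v (k i)] is not zero for all four [i]
means that the covector [F v v] is cyclic for the pencil, an open condition, which
holds near suitable points of the Hessian surface ([krylov_near]).

The examples of rank three and four are a Fermat cubic, or cones over plane cubics.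
For rank five they are [sum x_i^3 / b_i^2 - (sum x_i)^3], whose singular points are
the choices of signs with [sum +- b_i = 1]. If this were a sum of four cubes, a common
zero of three of the forms would have a polar quadric of rank at most one, and there
is none ([plus_cube_double_polar]). For rank six they are
[x^3 + y^3 + z^3 - 3 w^2 (a^2 x + b^2 y + c^2 z) + d w^3], whose singular points are
the choices of signs with [+- a^3 +- b^3 +- c^3 = d / 2]. Here a sum of five cubes is
excluded by the position of the points whose polar quadric has rank at most two
([not_five_cubes]). *)

(** * Linear functionals, sums of cubes and binary cubics *)

(** [etrans] with the middle term given. *)
Ltac via t := refine (@etrans _ _ t _ _ _).

Section Cubes.
Variable C : numClosedFieldType.

(** Linearity as a property of plain functions, so that functionals given by formulas
need no bundling. *)
Definition linf n (l : 'rV[C]_n -> C) :=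
  forall a u v, l (a *: u + v) = a * l u + l v.

Definition cubes n k (f : 'rV[C]_n -> C) :=
  exists l : 'I_k -> 'rV[C]_n -> C,
    (forall i, linf (l i)) /\ forall v, f v = \sum_(i < k) l i v ^+ 3.

(** The discriminant of [a X^3 + b X^2 Y + c X Y^2 + d Y^3]. *)
Definition bindisc (a b c d : C) :=
  b ^+ 2 * c ^+ 2 - 4 * a * c ^+ 3 - 4 * b ^+ 3 * d - 27 * a ^+ 2 * d ^+ 2
  + 18 * a * b * c * d.

Lemma cube_root (c : C) : exists r, r ^+ 3 = c.
Proof. by exists (3.-root c); rewrite rootCK. Qed.

Lemma sq_root (c : C) : exists r, r ^+ 2 = c.
Proof. by exists (2.-root c); rewrite rootCK. Qed.

Lemma omega_ex : exists w : C, w ^+ 2 + w + 1 = 0.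
Proof.
have [r hr] := sq_root (-3); exists ((-1 + r) / 2).
have -> : ((-1 + r) / 2) ^+ 2 + (-1 + r) / 2 + 1 = (r ^+ 2 + 3) / 4 :> C by field.
by rewrite hr; field.
Qed.

Lemma quad_root (a b c : C) : a != 0 ->
  exists r s, forall x, a * x ^+ 2 + b * x + c = a * (x - r) * (x - s).
Proof.
move=> a0; have [d hd] := sq_root (b ^+ 2 - 4 * a * c).
exists ((- b + d) / (2 * a)), ((- b - d) / (2 * a)) => x.
have -> : c = (b ^+ 2 - d ^+ 2) / (4 * a) by rewrite hd; field.
by field.
Qed.

Lemma quad_factor (a b c : C) :
  exists r s t u, [/\ a = r * t, b = r * u + s * t & c = s * u].
Proof.
have [a0|a0] := eqVneq a 0.
  by exists 0, 1, b, c; split; rewrite ?a0; ring.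
have [r [s h]] := quad_root b c a0.
exists a, (- a * r), 1, (- s); have h0 := h 0; have h1 := h 1.
have hc : c = a * r * s.
  by via (a * 0 ^+ 2 + b * 0 + c); [ring | rewrite h0; ring].
have hb : b = - a * r - a * s.
  have -> : b = (a * 1 ^+ 2 + b * 1 + c) - a - c by ring.
  by rewrite h1 hc; ring.
by split; rewrite ?hb ?hc; ring.
Qed.

(** In the coordinates that split the Hessian covariant, only the two pure
cubes survive: if a mixed coefficient were nonzero, the vanishing of the outer
Hessian coefficients would force the middle one to vanish as well. *)
Lemma binary_normal (a b c d : C) : bindisc a b c d != 0 ->
  exists r s t u A D, [/\ r * u - s * t != 0, A != 0, D != 0 & forall X Y,
    a * X ^+ 3 + b * X ^+ 2 * Y + c * X * Y ^+ 2 + d * Y ^+ 3 =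
    A * (r * X + s * Y) ^+ 3 + D * (t * X + u * Y) ^+ 3].
Proof.
move=> hD.
have [r [s [t [u [ha hb hc]]]]] :=
  quad_factor (b ^+ 2 - 3 * a * c) (b * c - 9 * a * d) (c ^+ 2 - 3 * b * d).
pose dl := r * u - s * t.
have hdl : dl ^+ 2 = - 3 * bindisc a b c d.
  have -> : dl ^+ 2 = (r * u + s * t) ^+ 2 - 4 * (r * t) * (s * u) by rewrite /dl; ring.
  by rewrite -ha -hb -hc /bindisc; ring.
have dl0 : dl != 0.
  apply: contraNneq hD => e; move/eqP: hdl.
  by rewrite e expr0n /= eq_sym mulf_eq0 oppr_eq0 pnatr_eq0.
pose A := a * u ^+ 3 - b * u ^+ 2 * t + c * u * t ^+ 2 - d * t ^+ 3.
pose B := - 3 * a * u ^+ 2 * s + b * (u ^+ 2 * r + 2 * u * s * t)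
          - c * (2 * u * t * r + s * t ^+ 2) + 3 * d * t ^+ 2 * r.
pose K := 3 * a * u * s ^+ 2 - b * (2 * u * s * r + s ^+ 2 * t)
          + c * (u * r ^+ 2 + 2 * s * t * r) - 3 * d * t * r ^+ 2.
pose D := - a * s ^+ 3 + b * s ^+ 2 * r - c * s * r ^+ 2 + d * r ^+ 3.
have e1 : B ^+ 2 = 3 * A * K.
  apply/eqP; rewrite -subr_eq0; apply/eqP.
  via (dl ^+ 2 * ((b ^+ 2 - 3 * a * c) * u ^+ 2 - (b * c - 9 * a * d) * u * t
     + (c ^+ 2 - 3 * b * d) * t ^+ 2)); first by rewrite /A /B /K /dl; ring.
  by rewrite ha hb hc; ring.
have e2 : K ^+ 2 = 3 * B * D.
  apply/eqP; rewrite -subr_eq0; apply/eqP.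
  via (dl ^+ 2 * ((b ^+ 2 - 3 * a * c) * s ^+ 2 - (b * c - 9 * a * d) * s * r
     + (c ^+ 2 - 3 * b * d) * r ^+ 2)); first by rewrite /D /B /K /dl; ring.
  by rewrite ha hb hc; ring.
have e3 : B * K - 9 * A * D = dl ^+ 4.
  via (dl ^+ 2 * (- 2 * (b ^+ 2 - 3 * a * c) * u * s
     + (b * c - 9 * a * d) * (u * r + s * t) - 2 * (c ^+ 2 - 3 * b * d) * t * r)).
    by rewrite /A /B /K /D /dl; ring.
  by rewrite ha hb hc /dl; ring.
have B0 : B = 0.
  apply/eqP; apply: contraT => nB.
  have nK : K != 0.
    by apply: contraNneq nB => K0; move/eqP: e1; rewrite K0 mulr0 expf_eq0.
  have : 3 * B * K * dl ^+ 4 = 0.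
    via (3 * (B * K) ^+ 2 - 9 * (3 * A * K) * B * D).
      by rewrite -e3; ring.
    by rewrite -e1 (_ : 9 * B ^+ 2 * B * D = 3 * B ^+ 2 * (3 * B * D)); [rewrite -e2; ring | ring].
  by move/eqP; rewrite !mulf_eq0 (negPf nB) (negPf nK) (negPf dl0) pnatr_eq0.
have K0 : K = 0.
  have h0 : K ^+ 2 = 0 by rewrite e2 B0 mulr0 mul0r.
  by move/eqP: h0; rewrite expf_eq0 => /eqP.
have AD : A * D != 0.
  apply: contraNneq dl0 => e; move: e3; rewrite B0 mul0r sub0r -mulrA e mulr0 oppr0.
  by move/esym/eqP; rewrite expf_eq0.
have A0 : A != 0 by apply: contraNneq AD => ->; rewrite mul0r.
have D0 : D != 0 by apply: contraNneq AD => ->; rewrite mulr0.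
exists r, s, t, u, (A / dl ^+ 3), (D / dl ^+ 3).
split; rewrite ?mulf_neq0 ?invr_eq0 ?expf_neq0 // => X Y.
have -> : A / dl ^+ 3 * (r * X + s * Y) ^+ 3 + D / dl ^+ 3 * (t * X + u * Y) ^+ 3 =
  (A * (r * X + s * Y) ^+ 3 + B * (r * X + s * Y) ^+ 2 * (t * X + u * Y)
  + K * (r * X + s * Y) * (t * X + u * Y) ^+ 2 + D * (t * X + u * Y) ^+ 3) / dl ^+ 3.
  by rewrite B0 K0; field.
apply/eqP; rewrite eq_sym -(inj_eq (mulIf (expf_neq0 3 dl0))) mulfVK ?expf_neq0 //; apply/eqP.
by rewrite /A /B /K /D /dl; ring.
Qed.

Section Fixn.
Variable n : nat.
Implicit Types (f g l x y z w : 'rV[C]_n -> C).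

Lemma linf0 l : linf l -> l 0 = 0.
Proof. by move=> h; have := h (-1) 0 0; rewrite scaler0 addr0 mulN1r addNr. Qed.
Lemma linfD l u v : linf l -> l (u + v) = l u + l v.
Proof. by move=> h; have := h 1 u v; rewrite scale1r mul1r. Qed.
Lemma linfZ l a u : linf l -> l (a *: u) = a * l u.
Proof. by move=> h; have := h a u 0; rewrite linf0 // !addr0. Qed.
Lemma linfN l u : linf l -> l (- u) = - l u.
Proof. by move=> h; rewrite -scaleN1r linfZ // mulN1r. Qed.
Lemma linfB l u v : linf l -> l (u - v) = l u - l v.
Proof. by move=> h; rewrite linfD // linfN. Qed.
Lemma linf_cst0 : linf (fun _ : 'rV[C]_n => 0).
Proof. by move=> a u v; rewrite mulr0 addr0. Qed.
Lemma linf_sc (a : C) l : linf l -> linf (fun v => a * l v).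
Proof. by move=> h b u v; rewrite h; ring. Qed.
Lemma linf_add l1 l2 : linf l1 -> linf l2 -> linf (fun v => l1 v + l2 v).
Proof. by move=> h h' b u v; rewrite h h'; ring. Qed.
Lemma linf_sub l1 l2 : linf l1 -> linf l2 -> linf (fun v => l1 v - l2 v).
Proof. by move=> h h' b u v; rewrite h h'; ring. Qed.
Lemma linf_sum (I : Type) (r : seq I) (P : pred I) (F : I -> 'rV[C]_n -> C) :
  (forall i, linf (F i)) -> linf (fun v => \sum_(i <- r | P i) F i v).
Proof.
move=> h a u v; rewrite mulr_sumr -big_split /=.
by apply: eq_bigr => i _; rewrite h.
Qed.
Lemma linf_ext l1 l2 : linf l1 -> (forall v, l2 v = l1 v) -> linf l2.
Proof. by move=> h e a u v; rewrite !e h. Qed.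

Arguments linf_sc a {l} _ _ _ _.
Arguments linf_add {l1 l2} _ _ _ _ _.
Arguments linf_sub {l1 l2} _ _ _ _ _.

Lemma cubes_ext k f g : cubes k f -> (forall v, g v = f v) -> cubes k g.
Proof. by move=> [l [hl e]] h; exists l; split=> // v; rewrite h e. Qed.

Lemma cubes0 : cubes 0 (fun _ : 'rV[C]_n => 0).
Proof.
exists (fun _ _ => 0); split=> [i|v]; first exact: linf_cst0.
by rewrite big_ord0.
Qed.

Lemma cubesD k m f g : cubes k f -> cubes m g -> cubes (k + m) (fun v => f v + g v).
Proof.
move=> [l1 [h1 e1]] [l2 [h2 e2]].
exists (fun i => match split i with inl j => l1 j | inr j => l2 j end); split.
  by move=> i; case: (split i).
move=> v; rewrite e1 e2 big_split_ord /=; congr (_ + _); apply: eq_bigr => i _.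
  by rewrite (unsplitK (inl i)).
by rewrite (unsplitK (inr i)).
Qed.

Lemma cubes_weak k m f : (k <= m)%N -> cubes k f -> cubes m f.
Proof.
move=> km; have z : cubes (m - k) (fun _ : 'rV[C]_n => 0).
  exists (fun _ _ => 0); split=> [i|v]; first exact: linf_cst0.
  by rewrite big1 // => i _; rewrite expr0n.
move=> h; have := cubesD h z; rewrite subnKC // => h'.
by apply: (cubes_ext h') => v; rewrite addr0.
Qed.

Lemma cubes1 c l : linf l -> cubes 1 (fun v => c * l v ^+ 3).
Proof.
move=> h; have [r <-] := cube_root c.
exists (fun _ v => r * l v); split=> [_|v]; first exact: linf_sc.
by rewrite big_ord1 exprMn.
Qed.

Lemma cubes_scale k a f : cubes k f -> cubes k (fun v => a * f v).
Proof.
have [r hr] := cube_root a.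
case=> l [hl fl]; exists (fun i v => r * l i v); split=> [i|v]; first exact: linf_sc.
by rewrite fl mulr_sumr; apply: eq_bigr => i _; rewrite -hr; ring.
Qed.

Lemma cubes_sum m (c : 'I_m -> C) (x : 'I_m -> 'rV[C]_n -> C) : (forall i, linf (x i)) ->
  cubes m (fun v => \sum_i c i * x i v ^+ 3).
Proof.
move=> hx; have rt i : exists r, r ^+ 3 = c i by exact: cube_root.
have [r hr] := boolp.choice rt.
exists (fun i v => r i * x i v); split=> [i|v]; first exact: linf_sc.
by apply: eq_bigr => i _; rewrite -hr; ring.
Qed.

Lemma binary_cubes2 a b c d x y : linf x -> linf y -> bindisc a b c d != 0 ->
  cubes 2 (fun v => a * x v ^+ 3 + b * x v ^+ 2 * y v + c * x v * y v ^+ 2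
                    + d * y v ^+ 3).
Proof.
move=> hx hy /binary_normal [r [s [t [u [A [D [_ _ _ e]]]]]]].
have h1 := cubes1 A (linf_add (linf_sc r hx) (linf_sc s hy)).
have h2 := cubes1 D (linf_add (linf_sc t hx) (linf_sc u hy)).
by apply: (cubes_ext (cubesD h1 h2)) => v /=; rewrite e.
Qed.

End Fixn.
End Cubes.

(** * Properties of almost all scalars *)
Section Cofinite.
Variable C : numClosedFieldType.

(** The excluded scalars are roots of a polynomial, which makes conjunctions and
witnesses immediate. *)
Definition cofin (Q : C -> Prop) :=
  exists2 P : {poly C}, P != 0 & forall k, P.[k] != 0 -> Q k.

Lemma cofin_and Q Q' : cofin Q -> cofin Q' -> cofin (fun k => Q k /\ Q' k).
Proof.
move=> [P P0 h] [P' P'0 h']; exists (P * P'); first by rewrite mulf_neq0.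
by move=> k; rewrite hornerM mulf_eq0 negb_or => /andP[/h ? /h' ?].
Qed.

Lemma cofin_impl (Q Q' : C -> Prop) : (forall k, Q k -> Q' k) -> cofin Q -> cofin Q'.
Proof. by move=> h [P P0 e]; exists P => // k /e /h. Qed.

Lemma cofin_ex Q : cofin Q -> exists k, Q k.
Proof.
move=> [P P0 h].
have [/allP ha|/allPn [k _ hk]] :=
  boolP (all (root P) [seq i%:R : C | i <- iota 0 (size P)]); last first.
  by exists k; apply: h.
have /(max_poly_roots P0) : all (root P) [seq i%:R : C | i <- iota 0 (size P)].
  exact/allP.
rewrite map_inj_uniq ?iota_uniq; last by move=> i j /eqP; rewrite eqr_nat => /eqP.
by move=> /(_ isT); rewrite size_map size_iota ltnn.
Qed.

Lemma cofin_poly (P : {poly C}) : P != 0 -> cofin (fun k => P.[k] != 0).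
Proof. by move=> h; exists P. Qed.

Lemma cofin_neg Q : cofin Q -> cofin (fun k => Q (- k)).
Proof.
move=> [P P0 h]; exists (P \Po (- 'X)) => [|k].
  by rewrite -size_poly_eq0 size_comp_poly2 ?size_poly_eq0 // size_polyN size_polyX.
by rewrite horner_comp hornerN hornerX => /h.
Qed.

Lemma cofin_quad (a b c : C) : [|| a != 0, b != 0 | c != 0] ->
  cofin (fun k => a * k ^+ 2 + b * k + c != 0).
Proof.
move=> h; exists (Poly [:: c; b; a]).
  apply: contraTneq h => e; rewrite !negb_or !negbK.
  have e0 i : (Poly [:: c; b; a])`_i = 0 by rewrite e coef0.
  move: (e0 0%N) (e0 1%N) (e0 2%N); rewrite !coef_Poly /= => -> -> ->.
  by rewrite !eqxx.
move=> k; rewrite horner_Poly /= mul0r add0r.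
by rewrite (_ : (a * k + b) * k + c = a * k ^+ 2 + b * k + c) //; ring.
Qed.

Lemma cofin_neq (c : C) : cofin (fun k => k != c).
Proof.
apply: cofin_impl (@cofin_quad 0 1 (- c) _); last by rewrite oner_eq0 orbT.
by move=> k; rewrite mul0r add0r mul1r subr_eq0.
Qed.

(** The discriminant is a polynomial of degree at most two in [d], with leading
coefficient [- 27 a^2], and [- 4 b^3] in front of [d] when [a] vanishes. *)
Lemma bindisc_generic (a b c d : C) : (a != 0) || (b != 0) ->
  cofin (fun k => bindisc a b c (d + k) != 0).
Proof.
move=> h.
pose B := 18 * a * b * c - 4 * b ^+ 3 - 54 * a ^+ 2 * d.
apply: cofin_impl (@cofin_quad (- 27 * a ^+ 2) B (bindisc a b c d) _).
  move=> k; rewrite (_ : _ + _ = bindisc a b c (d + k)) // /bindisc /B; ring.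
case: eqVneq h => /= [a0 b0|a0 _].
  by rewrite /B a0 !(mulr0, mul0r, expr0n, sub0r, subr0) /= oppr_eq0 mulf_neq0 ?expf_neq0 ?pnatr_eq0 ?orbT.
by rewrite mulf_neq0 ?expf_neq0 // oppr_eq0 pnatr_eq0.
Qed.

Section Blocks.
Variable n : nat.
Implicit Types (f g l x y z w : 'rV[C]_n -> C).

Lemma binary_cubes2_generic (a b c d : C) x y : linf x -> linf y ->
  (a != 0) || (b != 0) ->
  cofin (fun k => cubes 2 (fun v => a * x v ^+ 3 + b * x v ^+ 2 * y v
     + c * x v * y v ^+ 2 + (d + k) * y v ^+ 3)).
Proof.
move=> hx hy h; apply: cofin_impl (bindisc_generic c d h) => k.
exact: binary_cubes2.
Qed.

Lemma sqlin_cubes3 x y : linf x -> linf y -> cubes 3 (fun v => x v ^+ 2 * y v).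
Proof.
move=> hx hy.
have h1 := cubes1 (1 / 6) (linf_add hy hx).
have h2 := cubes1 (1 / 6) (linf_sub hy hx).
have h3 := cubes1 (- 1 / 3) hy.
apply: (cubes_ext (cubesD (cubesD h1 h2) h3)) => v /=; by field.
Qed.

(** The third cube is a correction of the [y ^ 3] term that makes the discriminant
nonzero. *)
Lemma binary_cubes3 (a b c d : C) x y : linf x -> linf y ->
  cubes 3 (fun v => a * x v ^+ 3 + b * x v ^+ 2 * y v + c * x v * y v ^+ 2
                    + d * y v ^+ 3).
Proof.
move=> hx hy; have [h|] := boolP ((a != 0) || (b != 0)).
  have [k hk] := cofin_ex (binary_cubes2_generic c d hx hy h).
  by apply: (cubes_ext (cubesD hk (cubes1 (- k) hy))) => v /=; ring.
rewrite negb_or !negbK => /andP[/eqP -> /eqP ->].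
have := sqlin_cubes3 hy (linf_add (linf_sc c hx) (linf_sc d hy)).
by move=> h; apply: (cubes_ext h) => v /=; ring.
Qed.

(** The sum of [(R + w^j S + w^(2j) T)^3] over the three cube roots of unity [w^j] is
[3 (R^3 + S^3 + T^3) + 18 R S T]. *)
Lemma fermat_pencil (q a b : C) x y z : linf x -> linf y -> linf z ->
  a != 0 -> b != 0 -> exists r,
  cubes 3 (fun v => a * y v ^+ 3 + b * z v ^+ 3 + r * x v ^+ 3 + q * x v * y v * z v).
Proof.
move=> hx hy hz a0 b0.
have [r ra] := cube_root (a / 3); have [s sb] := cube_root (b / 3).
have r0 : r != 0.
  by apply: contraNneq a0 => r0; move/esym/eqP: ra; rewrite r0 expr0n mulf_eq0 invr_eq0 pnatr_eq0 orbF.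
have s0 : s != 0.
  by apply: contraNneq b0 => s0; move/esym/eqP: sb; rewrite s0 expr0n mulf_eq0 invr_eq0 pnatr_eq0 orbF.
pose t := q / (18 * r * s); exists (3 * t ^+ 3).
have [w hw] := omega_ex C.
have w3 : w ^+ 3 = 1.
  have -> : w ^+ 3 = (w ^+ 2 + w + 1) * (w - 1) + 1 by ring.
  by rewrite hw mul0r add0r.
have hR := linf_sc r hy; have hS := linf_sc s hz; have hT := linf_sc t hx.
have h1 := cubes1 1 (linf_add (linf_add hR hS) hT).
have h2 := cubes1 1 (linf_add (linf_add hR (linf_sc w hS)) (linf_sc (w ^+ 2) hT)).
have h3 := cubes1 1 (linf_add (linf_add hR (linf_sc (w ^+ 2) hS)) (linf_sc w hT)).
apply: (cubes_ext (cubesD (cubesD h1 h2) h3)) => v /=.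
have -> : a = 3 * r ^+ 3 by rewrite ra; field.
have -> : b = 3 * s ^+ 3 by rewrite sb; field.
have -> : q = 18 * r * s * t by rewrite /t; field; rewrite s0.
move: (x v) (y v) (z v) => X Y Z.
have e2 : w ^+ 2 = - w - 1.
  by apply/eqP; rewrite -subr_eq0; apply/eqP; rewrite -hw; ring.
have e6 : (w ^+ 2) ^+ 3 = 1 by rewrite -exprM mulnC exprM w3 expr1n.
have E P Q S : (P + w * Q + w ^+ 2 * S) ^+ 3 = P ^+ 3 + w ^+ 3 * Q ^+ 3 + (w ^+ 2) ^+ 3 * S ^+ 3
  + 3 * w * P ^+ 2 * Q + 3 * w ^+ 2 * P ^+ 2 * S + 3 * w ^+ 2 * P * Q ^+ 2
  + 3 * w * w ^+ 3 * P * S ^+ 2 + 3 * w * w ^+ 3 * Q ^+ 2 * S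
  + 3 * w ^+ 2 * w ^+ 3 * Q * S ^+ 2 + 6 * w ^+ 3 * P * Q * S :> C by ring.
have E' P Q S : (P + w ^+ 2 * Q + w * S) ^+ 3 = P ^+ 3 + (w ^+ 2) ^+ 3 * Q ^+ 3 + w ^+ 3 * S ^+ 3
  + 3 * w ^+ 2 * P ^+ 2 * Q + 3 * w * P ^+ 2 * S + 3 * w * w ^+ 3 * P * Q ^+ 2
  + 3 * w ^+ 2 * P * S ^+ 2 + 3 * w ^+ 2 * w ^+ 3 * Q ^+ 2 * S
  + 3 * w * w ^+ 3 * Q * S ^+ 2 + 6 * w ^+ 3 * P * Q * S :> C by ring.
by rewrite E E' e6 w3 e2; ring.
Qed.

(** [c y w] is a difference of two squares, and [x A^2] plus any nonzero multiple of
[x ^ 3] is a sum of two cubes; this settles the case where only one pure cube is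
present. With both, the Fermat pencil applies. *)
Lemma node_cubes4 (c a b : C) x y w : linf x -> linf y -> linf w ->
  cubes 4 (fun v => c * x v * y v * w v + a * x v ^+ 3 + b * y v ^+ 3).
Proof.
move=> hx hy hw.
have one a' x' y' : linf x' -> linf y' ->
    cubes 4 (fun v => c * x' v * y' v * w v + a' * x' v ^+ 3).
  move=> hx' hy'.
  have [u [u0 ua]] : exists u, u != 0 /\ u + 3 * a' != 0.
    apply/cofin_ex/cofin_and; first exact: cofin_neq.
    by apply: cofin_impl (cofin_neq (- (3 * a'))) => k; rewrite -subr_eq0 opprK.
  have [k hk] := sq_root (u + 3 * a'); have [k' hk'] := sq_root u.
  have k0 : k != 0 by apply: contraNneq ua; rewrite -hk => ->; rewrite expr0n.
  have k'0 : k' != 0 by apply: contraNneq u0; rewrite -hk' => ->; rewrite expr0n.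
  have hA := linf_sc (1 / 2) (linf_add hy' (linf_sc c hw)).
  have hB := linf_sc (1 / 2) (linf_sub hy' (linf_sc c hw)).
  have h1 := cubes1 (1 / (6 * k)) (linf_add (linf_sc k hx') hA).
  have h2 := cubes1 (1 / (6 * k)) (linf_sub (linf_sc k hx') hA).
  have h3 := cubes1 (- 1 / (6 * k')) (linf_add (linf_sc k' hx') hB).
  have h4 := cubes1 (- 1 / (6 * k')) (linf_sub (linf_sc k' hx') hB).
  apply: (cubes_ext (cubesD (cubesD h1 h2) (cubesD h3 h4))) => v /=.
  have -> : a' = (k ^+ 2 - k' ^+ 2) / 3 by rewrite hk hk'; field.
  by field; rewrite k0 k'0.
have [a0|a0] := eqVneq a 0.
  by apply: (cubes_ext (one b y x hy hx)) => v; rewrite a0; ring.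
have [b0|b0] := eqVneq b 0.
  by apply: (cubes_ext (one a x y hx hy)) => v; rewrite b0; ring.
have [r hr] := fermat_pencil c hw hx hy a0 b0.
by apply: (cubes_ext (cubesD hr (cubes1 (- r) hw))) => v /=; ring.
Qed.
End Blocks.
End Cofinite.

(** * Cubics with special singularities *)
Section SingularForms.
Variables (C : numClosedFieldType) (n : nat).
Implicit Types (f g l x y z w : 'rV[C]_n -> C).

(** For a cubic form the displayed difference is six times the polar form, which must
vanish at [v], [v], [u]: all common zeros of [x] and [y] are singular. *)
Definition planar_sing f := exists x y, [/\ linf x, linf y &
  forall v u, x v = 0 -> y v = 0 -> f (v + u) - f (v - u) - 2 * f u = 0].

(** If [s] involves [m], eliminating [m] separates the variables [s], [l] and [p'], [l]
into two binary cubics, which share a multiple of [l ^ 3]. If it involves [p] but not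
[m], the term [l p^2] is absorbed into the cube of [s + e l]. *)
Lemma conic_tangent_perturbed l m p s (a b c k : C) :
  linf l -> linf m -> linf p -> linf s ->
  (forall v, s v = a * l v + b * m v + c * p v) ->
  (b != 0) || (c != 0) -> k != 0 ->
  cubes 4 (fun v => l v ^+ 2 * m v + l v * p v ^+ 2 + k * s v ^+ 3).
Proof.
move=> hl hm hp hs es; have [b0|b0] /= := eqVneq b 0 => [c0|_] k0.
  pose e := 1 / (3 * k * c ^+ 2).
  have h1 := cubes1 k (linf_add hs (linf_sc e hl)).
  have hm' := linf_add (linf_add hm (linf_sc (- 2 * a / c ^+ 2 - 3 * k * e ^+ 2) hs))
     (linf_sc (a ^+ 2 / c ^+ 2 - k * e ^+ 3) hl).
  apply: (cubes_ext (cubesD h1 (sqlin_cubes3 hl hm'))) => v /=.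
  have -> : p v = (s v - a * l v) / c by rewrite es b0; field.
  by rewrite /e; field; rewrite c0.
pose p' v := p v - c / (2 * b) * l v.
have hp' : linf p' by exact: (linf_sub hp (linf_sc (c / (2 * b)) hl)).
pose d := - a / b - c ^+ 2 / (4 * b ^+ 2).
have [r [r0 hr]] : exists r, r != 0 /\
   cubes 2 (fun v => k * s v ^+ 3 + 0 * s v ^+ 2 * l v + 1 / b * s v * l v ^+ 2
     + (d + (- r)) * l v ^+ 3).
  have h : (k != 0) || (0 != 0 :> C) by rewrite k0.
  have := binary_cubes2_generic (1 / b) d hs hl h.
  by move=> /cofin_neg /(cofin_and (cofin_neq 0)) /cofin_ex.
have h2 : cubes 2 (fun v => 0 * p' v ^+ 3 + 1 * p' v ^+ 2 * l v + 0 * p' v * l v ^+ 2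
     + r * l v ^+ 3).
  apply: binary_cubes2 => //; rewrite /bindisc (_ : _ + _ = - 4 * r); last by ring.
  by rewrite mulf_neq0 // oppr_eq0 pnatr_eq0.
apply: (cubes_ext (cubesD hr h2)) => v /=.
have -> : m v = (s v - a * l v - c * p v) / b by rewrite es; field.
by rewrite /p' /d; field.
Qed.

(** The summands are three binary cubics [A_i (q_i A_i^2 + e_i B_i^2)] with [A_i] in the
span of [x], [z] and [B_i = w + t_i y]. Here [t_1 = t], [t_2 = 2 t], and [t_3] is chosen
so that the second symmetric function of the [t_i] is [- 3 d]; the four quantities
kept nonzero are the differences and sums that enter the discriminants. *)
Lemma three_pairs (d : C) x y z w : linf x -> linf y -> linf z -> linf w ->
  cubes 6 (fun v => x v * z v ^+ 2 + z v * y v ^+ 2 + d * x v ^+ 3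
                    + w v * x v * y v).
Proof.
move=> hx hy hz hw.
have Q (a b : C) : a != 0 -> cofin (fun t => a * t ^+ 2 + b != 0).
  move=> a0; apply: cofin_impl (@cofin_quad _ a 0 b _); last by rewrite a0.
  by move=> t; rewrite mul0r addr0.
have [t [t0 [q1 [q2 [q3 q4]]]]] : exists t, t != 0 /\ (5 * t ^+ 2 + 3 * d != 0 /\
  (1 * t ^+ 2 + (- 3 * d) != 0 /\ (8 * t ^+ 2 + 3 * d != 0 /\ 4 * t ^+ 2 + (- 3 * d) != 0))).
  apply: cofin_ex; apply: cofin_and; first exact: cofin_neq.
  by do !apply: cofin_and; apply: Q; rewrite ?oner_eq0 ?pnatr_eq0.
pose t3 := - (3 * d + 2 * t ^+ 2) / (3 * t).
have ed : d = - (2 * t ^+ 2 + 3 * t * t3) / 3 by rewrite /t3; field.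
clearbody t3.
have m1 : t3 - t != 0.
  apply: contraNneq q1 => e.
  by rewrite (_ : _ + _ = - 3 * t * (t3 - t)); [rewrite e mulr0 | rewrite ed; field].
have m2 : t3 + t != 0.
  apply: contraNneq q2 => e.
  by rewrite (_ : _ + _ = 3 * t * (t3 + t)); [rewrite e mulr0 | rewrite ed; field].
have m3 : t3 - 2 * t != 0.
  apply: contraNneq q3 => e.
  by rewrite (_ : _ + _ = - 3 * t * (t3 - 2 * t)); [rewrite e mulr0 | rewrite ed; field].
have m4 : t3 + 2 * t != 0.
  apply: contraNneq q4 => e.
  by rewrite (_ : _ + _ = 3 * t * (t3 + 2 * t)); [rewrite e mulr0 | rewrite ed; field].
pose D := - (-2 * t) * (4 * t - 2 * t3) * (2 * t3 - 2 * t).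
have D0 : D != 0.
  rewrite (_ : D = 8 * t * - (t3 - 2 * t) * (t3 - t)); last by rewrite /D; ring.
  by rewrite !mulf_neq0 ?oppr_eq0 ?pnatr_eq0.
have [K [K0 eK]] : exists K, K != 0 /\ K = 1 / (3 * (t * (t3 - t) * (t3 - 2 * t))).
  by eexists; split; [|by []]; rewrite mulf_neq0 ?invr_eq0 ?mulf_neq0 ?oner_eq0 ?pnatr_eq0.
have pair (q e b t' : C) : q != 0 -> e != 0 ->
    cubes 2 (fun v => q * (z v + t' * x v) ^+ 3
       + e * (z v + t' * x v) * (w v + b * y v) ^+ 2).
  move=> q0 e0; have hA := linf_add hz (linf_sc t' hx).
  have hd : bindisc 0 e 0 q != 0.
    rewrite /bindisc (_ : _ + _ = - 4 * e ^+ 3 * q); last by ring.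
    by rewrite !mulf_neq0 ?expf_neq0 // oppr_eq0 pnatr_eq0.
  apply: (cubes_ext (binary_cubes2 (linf_add hw (linf_sc b hy)) hA hd)) => v /=.
  by ring.
have k1 : K * (4 * t ^+ 2 - t3 ^+ 2) != 0.
  rewrite (_ : _ * _ = - K * (t3 - 2 * t) * (t3 + 2 * t)); last by ring.
  by rewrite !mulf_neq0 ?oppr_eq0 ?pnatr_eq0.
have k2 : K * (t3 ^+ 2 - t ^+ 2) != 0.
  rewrite (_ : _ * _ = K * (t3 - t) * (t3 + t)); last by ring.
  by rewrite !mulf_neq0.
have k3 : - 3 * K * t ^+ 2 != 0 by rewrite !mulf_neq0 ?oppr_eq0 ?pnatr_eq0.
have e1 : (4 * t - 2 * t3) / D != 0.
  rewrite (_ : 4 * t - 2 * t3 = - 2 * (t3 - 2 * t)); last by ring.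
  by rewrite !mulf_neq0 ?invr_eq0 // oppr_eq0 pnatr_eq0.
have e2 : (2 * t3 - 2 * t) / D != 0.
  by rewrite -mulrBr !mulf_neq0 ?invr_eq0 // pnatr_eq0.
have e3 : - 2 * t / D != 0 by rewrite !mulf_neq0 ?invr_eq0 // oppr_eq0 pnatr_eq0.
have h1 := pair _ _ (- t - t3) t k1 e1.
have h2 := pair _ _ (t - t3) (2 * t) k2 e2.
have h3 := pair _ _ (t3 - 3 * t) t3 k3 e3.
apply: (cubes_ext (cubesD (cubesD h1 h2) h3)) => v /=.
move: (x v) (y v) (z v) (w v) => X Y Z W.
have eD : D = - 8 * t * (t3 - 2 * t) * (t3 - t) by rewrite /D; ring.
rewrite ed eK eD; field.
by rewrite m3 m1 t0.
Qed.
End SingularForms.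

Section Binode.
Variables (C : numClosedFieldType) (n : nat).
Implicit Types (f g l x y z w : 'rV[C]_n -> C).

(** With [p1], [p2 = r x +- s y], the terms other than [a z^3] combine into
[p1^2 L1 + p2^2 L2], and [m_i = L_i + e_i p_i] satisfy [m1 + m2 = z]. The cube
[a (m1 + m2)^3] links the binary cubics in [p_i], [m_i] by a third one in [m1], [m2], and the
pure cubes of the [m_i] are distributed generically. *)
Lemma binode_A2 (a b c d e : C) x y z w : linf x -> linf y -> linf z -> linf w ->
  a != 0 -> b != 0 -> c != 0 ->
  cubes 6 (fun v => a * z v ^+ 3 + b * z v * x v ^+ 2 + c * z v * y v ^+ 2
     + d * x v ^+ 3 + e * y v ^+ 3 + w v * x v * y v).
Proof.
move=> hx hy hz hw a0 b0 c0.
have [r hr] := sq_root b; have [s hs] := sq_root c.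
have r0 : r != 0 by apply: contraNneq b0 => r0; rewrite -hr r0 expr0n.
have s0 : s != 0 by apply: contraNneq c0 => s0; rewrite -hs s0 expr0n.
pose p1 v := r * x v + s * y v; pose p2 v := r * x v - s * y v.
have hp1 : linf p1 by exact: linf_add (linf_sc r hx) (linf_sc s hy).
have hp2 : linf p2 by exact: linf_sub (linf_sc r hx) (linf_sc s hy).
pose u := d / (8 * r ^+ 3); pose t := e / (8 * s ^+ 3).
pose h0 := u + t; pose h1 := 3 * u - 3 * t; pose h2 := 3 * u + 3 * t; pose h3 := u - t.
pose L1 v := 1 / 2 * z v + 1 / (4 * r * s) * w v + h0 * p1 v + h1 * p2 v.
pose L2 v := 1 / 2 * z v - 1 / (4 * r * s) * w v + h2 * p1 v + h3 * p2 v.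
have hL1 : linf L1.
  exact: linf_add (linf_add (linf_add (linf_sc (1 / 2) hz) (linf_sc (1 / (4 * r * s)) hw))
    (linf_sc h0 hp1)) (linf_sc h1 hp2).
have hL2 : linf L2.
  exact: linf_add (linf_add (linf_sub (linf_sc (1 / 2) hz) (linf_sc (1 / (4 * r * s)) hw))
    (linf_sc h2 hp1)) (linf_sc h3 hp2).
pose e1 := - (h0 + h2); pose e2 := - (h1 + h3).
have hm1 := linf_add hL1 (linf_sc e1 hp1); have hm2 := linf_add hL2 (linf_sc e2 hp2).
have b1 : (- e1 != 0) || (1 != 0 :> C) by rewrite oner_eq0 orbT.
have b2 : (- e2 != 0) || (1 != 0 :> C) by rewrite oner_eq0 orbT.
have [k1 g1] := cofin_ex (binary_cubes2_generic 0 0 hp1 hm1 b1).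
have b3 : (a - k1 != 0) || (3 * a != 0) by rewrite orbC mulf_neq0 ?pnatr_eq0.
have [k2 [g2 g3]] := cofin_ex (cofin_and (binary_cubes2_generic 0 0 hp2 hm2 b2)
   (cofin_neg (binary_cubes2_generic (3 * a) a hm1 hm2 b3))).
apply: (cubes_ext (cubesD (cubesD g1 g2) g3)) => v /=.
rewrite /L1 /L2 /e1 /e2 /h0 /h1 /h2 /h3 /p1 /p2.
have -> : b = r ^+ 2 by []. have -> : c = s ^+ 2 by [].
have -> : d = u * (8 * r ^+ 3) by rewrite /u; field.
have -> : e = t * (8 * s ^+ 3) by rewrite /t; field.
move: (x v) (y v) (z v) (w v) (u) (t) => X Y Z W U T.
by field; rewrite s0.
Qed.

Lemma binode_A2_degenerate (a b d e : C) x y z w : linf x -> linf y -> linf z -> linf w ->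
  a != 0 ->
  cubes 6 (fun v => a * z v ^+ 3 + b * z v * x v ^+ 2
     + d * x v ^+ 3 + e * y v ^+ 3 + w v * x v * y v).
Proof.
move=> hx hy hz hw a0; have h : (a != 0) || (0 != 0 :> C) by rewrite a0.
have [k g1] := cofin_ex (binary_cubes2_generic b d hz hx h).
by apply: (cubes_ext (cubesD g1 (node_cubes4 1 (- k) e hx hy hw))) => v /=; ring.
Qed.

Lemma binode_A3 (a b d e : C) x y z w : linf x -> linf y -> linf z -> linf w ->
  a != 0 -> b != 0 ->
  cubes 6 (fun v => z v ^+ 2 * (a * x v + b * y v)
     + d * x v ^+ 3 + e * y v ^+ 3 + w v * x v * y v).
Proof.
move=> hx hy hz hw a0 b0.
have hs := linf_add (linf_sc a hx) (linf_sc b hy).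
have hd : bindisc 0 1 0 1 != 0 :> C.
  by rewrite /bindisc (_ : _ + _ = - 4); [rewrite oppr_eq0 pnatr_eq0 | ring].
have g1 := binary_cubes2 hz hs hd.
have hw' := linf_sub (linf_sub hw (linf_sc (3 * a ^+ 2 * b) hx)) (linf_sc (3 * a * b ^+ 2) hy).
have g2 := node_cubes4 1 (d - a ^+ 3) (e - b ^+ 3) hx hy hw'.
by apply: (cubes_ext (cubesD g1 g2)) => v /=; ring.
Qed.

Lemma binode_A4 (a c d e : C) x y z w : linf x -> linf y -> linf z -> linf w ->
  a != 0 ->
  cubes 6 (fun v => a * z v ^+ 2 * x v + c * z v * y v ^+ 2
     + d * x v ^+ 3 + e * y v ^+ 3 + w v * x v * y v).
Proof.
move=> hx hy hz hw a0; have [c0|c0] := eqVneq c 0.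
  have hd : bindisc 0 a 0 a != 0.
    rewrite /bindisc (_ : _ + _ = - 4 * (a * a * a * a)); last by ring.
    by rewrite !mulf_neq0 ?oppr_eq0 ?pnatr_eq0.
  have g1 := binary_cubes2 hz hx hd.
  have g2 := node_cubes4 1 (d - a) e hx hy hw.
  by apply: (cubes_ext (cubesD g1 g2)) => v /=; rewrite c0; ring.
have [r hr] := sq_root c.
have r0 : r != 0 by apply: contraNneq c0 => r0; rewrite -hr r0 expr0n.
pose t := e / c.
have hz' := linf_add hz (linf_sc t hy).
have hw' := linf_sc (1 / (a * r)) (linf_add (linf_sub hw (linf_sc (2 * a * t) hz'))
   (linf_sc (a * t ^+ 2) hy)).
have g := three_pairs (d / a ^+ 3) (linf_sc a hx) (linf_sc r hy) hz' hw'.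
apply: (cubes_ext g) => v /=.
have -> : e = t * c by rewrite /t; field.
have -> : c = r ^+ 2 by [].
move: (t) => T; by field; rewrite r0.
Qed.

(** The tangent cone splits into the planes [x = 0] and [y = 0]. If [z ^ 3] occurs, the
singular point is of type [A_2]. Otherwise the presence of both or of one of the terms
[z ^ 2 * x] and [z ^ 2 * y] separates the type [A_3] from higher ones, and without
these terms the whole locus [x = y = 0] is singular. *)
Lemma binode_cubes6 (a1 a2 a3 a4 a5 a6 a7 : C) f x y z w :
  linf x -> linf y -> linf z -> linf w ->
  (forall v, f v = a1 * z v ^+ 3 + a2 * z v ^+ 2 * x v + a3 * z v ^+ 2 * y v
     + a4 * z v * x v ^+ 2 + a5 * z v * y v ^+ 2 + a6 * x v ^+ 3 + a7 * y v ^+ 3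
     + w v * x v * y v) ->
  cubes 6 f \/ planar_sing f.
Proof.
move=> hx hy hz hw ef.
have [a10|a10] := eqVneq a1 0; last first.
  left; pose p := a2 / (3 * a1); pose q := a3 / (3 * a1).
  have hz' := linf_add (linf_add hz (linf_sc p hx)) (linf_sc q hy).
  have e2 : a2 = 3 * a1 * p by rewrite /p; field.
  have e3 : a3 = 3 * a1 * q by rewrite /q; field.
  pose b := a4 - 3 * a1 * p ^+ 2; pose c := a5 - 3 * a1 * q ^+ 2.
  pose d := a6 - b * p - a1 * p ^+ 3; pose e := a7 - c * q - a1 * q ^+ 3.
  have hw' : linf (fun v => w v - 6 * a1 * p * q * z v
     - (b * q + 3 * a1 * p ^+ 2 * q) * x v - (c * p + 3 * a1 * p * q ^+ 2) * y v).
    exact: linf_sub (linf_sub (linf_sub hw (linf_sc _ hz)) (linf_sc _ hx)) (linf_sc _ hy).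
  have E v : f v = a1 * (z v + p * x v + q * y v) ^+ 3
     + b * (z v + p * x v + q * y v) * x v ^+ 2
     + c * (z v + p * x v + q * y v) * y v ^+ 2 + d * x v ^+ 3 + e * y v ^+ 3
     + (w v - 6 * a1 * p * q * z v
     - (b * q + 3 * a1 * p ^+ 2 * q) * x v - (c * p + 3 * a1 * p * q ^+ 2) * y v) * x v * y v.
    by rewrite ef e2 e3 /d /e /b /c; ring.
  have [b0|b0] := eqVneq b 0.
    apply: (cubes_ext (binode_A2_degenerate c e d hy hx hz' hw' a10)) => v /=.
    by rewrite E b0; ring.
  have [c0|c0] := eqVneq c 0.
    apply: (cubes_ext (binode_A2_degenerate b d e hx hy hz' hw' a10)) => v /=.
    by rewrite E c0; ring.
  by apply: (cubes_ext (binode_A2 d e hx hy hz' hw' a10 b0 c0)) => v /=; rewrite E.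
have [a20|a20] := eqVneq a2 0; have [a30|a30] := eqVneq a3 0.
- right; exists x, y; split=> // v u xv yv.
  by rewrite !ef !linfB ?linfD // xv yv a10 a20 a30; ring.
- left; pose q := a5 / (2 * a3); have hz' := linf_add hz (linf_sc q hy).
  have hw' := linf_sub hw (linf_sc (a4 * q) hx).
  apply: (cubes_ext (binode_A4 a4 (a7 - a3 * q ^+ 2) a6 hy hx hz' hw' a30)) => v /=.
  by rewrite ef (_ : a5 = 2 * a3 * q) ?a10 ?a20; [ring | rewrite /q; field].
- left; pose q := a4 / (2 * a2); have hz' := linf_add hz (linf_sc q hx).
  have hw' := linf_sub hw (linf_sc (a5 * q) hy).
  apply: (cubes_ext (binode_A4 a5 (a6 - a2 * q ^+ 2) a7 hx hy hz' hw' a20)) => v /=.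
  by rewrite ef (_ : a4 = 2 * a2 * q) ?a10 ?a30; [ring | rewrite /q; field].
left; pose p := a4 / (2 * a2); pose q := a5 / (2 * a3).
have hz' := linf_add (linf_add hz (linf_sc p hx)) (linf_sc q hy).
have hw' : linf (fun v => w v - 2 * (a2 * q + a3 * p) * z v
    - (2 * a2 * p * q + a3 * p ^+ 2) * x v - (a2 * q ^+ 2 + 2 * a3 * p * q) * y v).
  exact: linf_sub (linf_sub (linf_sub hw (linf_sc _ hz)) (linf_sc _ hx)) (linf_sc _ hy).
apply: (cubes_ext (binode_A3 (a6 - a2 * p ^+ 2) (a7 - a3 * q ^+ 2) hx hy hz' hw' a20 a30)).
move=> v /=; rewrite ef a10.
have -> : a4 = 2 * a2 * p by rewrite /p; field.
have -> : a5 = 2 * a3 * q by rewrite /q; field.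
by ring.
Qed.

End Binode.

Section Unode.
Variables (C : numClosedFieldType) (n : nat).
Implicit Types (f g l x y z w : 'rV[C]_n -> C).

Lemma cubic_root (a b c d : C) : a != 0 ->
  exists r, a * r ^+ 3 + b * r ^+ 2 + c * r + d = 0.
Proof.
move=> a0; have [r hr] := solve_monicpoly (fun i => [:: - d / a; - c / a; - b / a]`_i) (ltn0Sn 2).
exists r; rewrite hr !big_ord_recr big_ord0 /= add0r expr0 expr1 mulr1.
by field.
Qed.

Lemma binary_factor (a b c d : C) : exists r1 s1 r2 s2 r3 s3,
  forall X Y, a * X ^+ 3 + b * X ^+ 2 * Y + c * X * Y ^+ 2 + d * Y ^+ 3 =
    (r1 * X + s1 * Y) * (r2 * X + s2 * Y) * (r3 * X + s3 * Y).
Proof.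
have [a0|a0] := eqVneq a 0.
  have [r [s [t [u [-> -> ->]]]]] := quad_factor b c d.
  by exists 0, 1, r, s, t, u => X Y; rewrite a0; ring.
have [r hr] := cubic_root b c d a0.
have [r' [s [t [u [e1 e2 e3]]]]] := quad_factor a (b + a * r) (c + b * r + a * r ^+ 2).
exists 1, (- r), r', s, t, u => X Y.
via ((X - r * Y) * (a * X ^+ 2 + (b + a * r) * X * Y + (c + b * r + a * r ^+ 2) * Y ^+ 2)).
  have -> : d = - (a * r ^+ 3 + b * r ^+ 2 + c * r).
    by apply/eqP; rewrite -addr_eq0 addrC; apply/eqP; rewrite -hr; ring.
  by ring.
by rewrite e2 e3 e1; ring.
Qed.

(** The discriminant of a product of three binary linear forms is the squared
product of their pairwise determinants. *)
Lemma binary_double (a b c d : C) : bindisc a b c d = 0 -> exists r s t u,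
  forall X Y, a * X ^+ 3 + b * X ^+ 2 * Y + c * X * Y ^+ 2 + d * Y ^+ 3 =
    (r * X + s * Y) ^+ 2 * (t * X + u * Y).
Proof.
have [r1 [s1 [r2 [s2 [r3 [s3 e]]]]]] := binary_factor a b c d.
have e10 := e 1 0; have e01 := e 0 1; have e11 := e 1 1; have e1N := e 1 (-1).
have ea : a = r1 * r2 * r3 by rewrite (_ : a = a * 1 ^+ 3 + b * 1 ^+ 2 * 0 + c * 1 * 0 ^+ 2 + d * 0 ^+ 3); [rewrite e10; ring | ring].
have ed : d = s1 * s2 * s3 by rewrite (_ : d = a * 0 ^+ 3 + b * 0 ^+ 2 * 1 + c * 0 * 1 ^+ 2 + d * 1 ^+ 3); [rewrite e01; ring | ring].
have ec : c = r1 * s2 * s3 + s1 * r2 * s3 + s1 * s2 * r3.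
  rewrite (_ : c = ((a * 1 ^+ 3 + b * 1 ^+ 2 * 1 + c * 1 * 1 ^+ 2 + d * 1 ^+ 3)
    + (a * 1 ^+ 3 + b * 1 ^+ 2 * -1 + c * 1 * (-1) ^+ 2 + d * (-1) ^+ 3) - 2 * a) / 2); last by field.
  by rewrite e11 e1N ea; field.
have eb : b = r1 * r2 * s3 + r1 * s2 * r3 + s1 * r2 * r3.
  rewrite (_ : b = ((a * 1 ^+ 3 + b * 1 ^+ 2 * 1 + c * 1 * 1 ^+ 2 + d * 1 ^+ 3)
    - (a * 1 ^+ 3 + b * 1 ^+ 2 * -1 + c * 1 * (-1) ^+ 2 + d * (-1) ^+ 3) - 2 * d) / 2); last by field.
  by rewrite e11 e1N ed; field.
have prop (r s t u : C) : r * u - s * t = 0 -> exists p q k : C,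
   forall X Y : C, (r * X + s * Y) * (t * X + u * Y) = k * (p * X + q * Y) ^+ 2.
  move=> h; have [r0|r0] := eqVneq r 0.
    have [s0|s0] := eqVneq s 0; first by exists 0, 0, 0 => X Y; rewrite r0 s0; ring.
    exists 0, 1, (s * u) => X Y.
    have t0 : t = 0.
      by move/eqP: h; rewrite r0 mul0r sub0r oppr_eq0 mulf_eq0 (negPf s0) => /eqP.
    by rewrite r0 t0; ring.
  exists r, s, (t / r) => X Y.
  have -> : u = s * t / r by apply: (mulfI r0); move/eqP: h; rewrite subr_eq0 => /eqP ->; field.
  by field.
have dbl (r s t u r' s' : C) : r * u - s * t = 0 -> exists p q k m : C, forall X Y : C,
   (r * X + s * Y) * (t * X + u * Y) * (r' * X + s' * Y) =
   (p * X + q * Y) ^+ 2 * (k * X + m * Y).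
  move=> h; have [p [q [k E]]] := prop _ _ _ _ h.
  by exists p, q, (k * r'), (k * s') => X Y; rewrite E; ring.
rewrite (_ : bindisc _ _ _ _ = ((r1 * s2 - s1 * r2) * (r1 * s3 - s1 * r3)
  * (r2 * s3 - s2 * r3)) ^+ 2); last by rewrite /bindisc ea eb ec ed; ring.
move/eqP; rewrite expf_eq0 /= !mulf_eq0 -orbA => /or3P[] /eqP h.
- have [p [q [k [m E]]]] := dbl _ _ _ _ r3 s3 h.
  by exists p, q, k, m => X Y; rewrite e -E; ring.
- have [p [q [k [m E]]]] := dbl _ _ _ _ r2 s2 h.
  by exists p, q, k, m => X Y; rewrite e -E; ring.
have [p [q [k [m E]]]] := dbl _ _ _ _ r1 s1 h.
by exists p, q, k, m => X Y; rewrite e -E; ring.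
Qed.

Lemma unode_D4 (a b q : C) x y z w : linf x -> linf y -> linf z -> linf w ->
  a != 0 -> b != 0 ->
  cubes 6 (fun v => a * y v ^+ 3 + b * z v ^+ 3 + q * x v * y v * z v + x v ^+ 2 * w v).
Proof.
move=> hx hy hz hw a0 b0; have [r hr] := fermat_pencil q hx hy hz a0 b0.
have h := sqlin_cubes3 hx (linf_sub hw (linf_sc r hx)).
by apply: (cubes_ext (cubesD hr h)) => v /=; ring.
Qed.

Lemma unode_D5 (q : C) x y z w : linf x -> linf y -> linf z -> linf w ->
  cubes 6 (fun v => y v ^+ 2 * z v + q * x v * z v ^+ 2 + x v ^+ 2 * w v).
Proof.
move=> hx hy hz hw; have [->|q0] := eqVneq q 0.
  apply: (cubes_ext (cubesD (sqlin_cubes3 hy hz) (sqlin_cubes3 hx hw))) => v /=; ring.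
have hd : bindisc 0 1 0 (- q / 3) != 0.
  rewrite /bindisc (_ : _ + _ = 4 * q / 3); last by field.
  by rewrite !mulf_neq0 ?invr_eq0 ?pnatr_eq0.
have h1 := binary_cubes2 hy hz hd.
have h2 := cubes1 (q / 3) (linf_add hz hx).
have h3 := sqlin_cubes3 hx (linf_sub (linf_sub hw (linf_sc q hz)) (linf_sc (q / 3) hx)).
by apply: (cubes_ext (cubesD (cubesD h1 h2) h3)) => v /=; field.
Qed.

Lemma unode_E6 (q a : C) x y z w : linf x -> linf y -> linf z -> linf w -> q != 0 ->
  cubes 6 (fun v => a * y v ^+ 3 + q * x v * z v ^+ 2 + x v ^+ 2 * w v).
Proof.
move=> hx hy hz hw q0.
have hd : bindisc 0 q 0 q != 0.
  rewrite /bindisc (_ : _ + _ = - 4 * (q * q * q * q)); last by ring.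
  by rewrite !mulf_neq0 ?oppr_eq0 ?pnatr_eq0.
have h1 := binary_cubes2 hz hx hd.
have h2 := sqlin_cubes3 hx (linf_sub hw (linf_sc q hx)).
by apply: (cubes_ext (cubesD (cubesD h1 h2) (cubes1 a hy))) => v /=; ring.
Qed.

(** The root multiplicities of the cubic cut out on the double plane [x = 0] of
the tangent cone distinguish the types [D_4], [D_5] and [E_6]. *)
Lemma unode_cubes6 (q1 q2 q3 h0 h1 h2 h3 : C) f x y z w :
  linf x -> linf y -> linf z -> linf w ->
  (forall v, f v = h0 * y v ^+ 3 + h1 * y v ^+ 2 * z v + h2 * y v * z v ^+ 2 + h3 * z v ^+ 3
     + x v * (q1 * y v ^+ 2 + q2 * y v * z v + q3 * z v ^+ 2) + x v ^+ 2 * w v) ->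
  cubes 6 f \/ planar_sing f.
Proof.
move=> hx hy hz hw ef.
have triple a p1 p2 p3 y' z' : linf y' -> linf z' ->
   (forall v, f v = a * y' v ^+ 3
     + x v * (p1 * y' v ^+ 2 + p2 * y' v * z' v + p3 * z' v ^+ 2) + x v ^+ 2 * w v) ->
   a != 0 -> cubes 6 f \/ planar_sing f.
  move=> hy' hz' E a0; have [p30|p30] := eqVneq p3 0.
    right; exists x, y'; split=> // v u xv yv.
    by rewrite !E !linfB ?linfD // xv yv p30; ring.
  left; pose q := p2 / (2 * p3); pose k := (p1 - p3 * q ^+ 2) / (3 * a).
  have hy'' := linf_add hy' (linf_sc k hx); have hz'' := linf_add hz' (linf_sc q hy').
  have hw' := linf_sub (linf_sub hw (linf_sc (3 * a * k ^+ 2) hy')) (linf_sc (a * k ^+ 3) hx).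
  apply: (cubes_ext (unode_E6 a hx hy'' hz'' hw' p30)) => v /=; rewrite E.
  have -> : p2 = 2 * p3 * q by rewrite /q; field.
  have -> : p1 = 3 * a * k + p3 * q ^+ 2 by rewrite /k; field.
  by ring.
have reco r s t u : r * u - s * t != 0 -> exists p1 p2 p3, forall v,
   q1 * y v ^+ 2 + q2 * y v * z v + q3 * z v ^+ 2 =
   p1 * (r * y v + s * z v) ^+ 2 + p2 * (r * y v + s * z v) * (t * y v + u * z v)
   + p3 * (t * y v + u * z v) ^+ 2.
  set D := r * u - s * t => D0.
  exists ((q1 * u ^+ 2 - q2 * u * t + q3 * t ^+ 2) / D ^+ 2),
    ((- 2 * q1 * u * s + q2 * (u * r + s * t) - 2 * q3 * t * r) / D ^+ 2),
    ((q1 * s ^+ 2 - q2 * s * r + q3 * r ^+ 2) / D ^+ 2) => v.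
  by rewrite /D in D0 *; field.
have [hd|/binary_normal] := eqVneq (bindisc h0 h1 h2 h3) 0; last first.
  move=> [r [s [t [u [a [b [D0 a0 b0 E]]]]]]]; left.
  have [p1 [p2 [p3 Eq]]] := reco _ _ _ _ D0.
  have hy' := linf_add (linf_sc r hy) (linf_sc s hz).
  have hz' := linf_add (linf_sc t hy) (linf_sc u hz).
  pose k := p1 / (3 * a); pose m := p3 / (3 * b).
  have hy'' := linf_add hy' (linf_sc k hx); have hz'' := linf_add hz' (linf_sc m hx).
  have hw' : linf (fun v => w v - (3 * a * k ^+ 2 + p2 * m) * (r * y v + s * z v)
      - (3 * b * m ^+ 2 + p2 * k) * (t * y v + u * z v)
      - (a * k ^+ 3 + b * m ^+ 3 + p2 * k * m) * x v).
    exact: linf_sub (linf_sub (linf_sub hw (linf_sc _ hy')) (linf_sc _ hz')) (linf_sc _ hx).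
  apply: (cubes_ext (unode_D4 p2 hx hy'' hz'' hw' a0 b0)) => v /=.
  rewrite ef E Eq; have -> : p1 = 3 * a * k by rewrite /k; field.
  have -> : p3 = 3 * b * m by rewrite /m; field.
  by ring.
have [r [s [t [u E]]]] := binary_double hd.
have hp := linf_add (linf_sc r hy) (linf_sc s hz).
have hm := linf_add (linf_sc t hy) (linf_sc u hz).
have zeroh : (forall v, h0 * y v ^+ 3 + h1 * y v ^+ 2 * z v + h2 * y v * z v ^+ 2
     + h3 * z v ^+ 3 = 0) -> planar_sing f.
  move=> Z; have [a [b [c [d [e1 e2 e3]]]]] := quad_factor q1 q2 q3.
  have hl : linf (fun v => a * y v + b * z v) by exact: linf_add (linf_sc a hy) (linf_sc b hz).
  exists x, (fun v => a * y v + b * z v); split=> // v' u' xv lv.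
  have F v : f v = x v * (a * y v + b * z v) * (c * y v + d * z v) + x v ^+ 2 * w v.
    by rewrite ef Z e1 e2 e3; ring.
  have FB v v'' : f (v + v'') = (x v + x v'') * ((a * y v + b * z v) + (a * y v'' + b * z v''))
    * (c * (y v + y v'') + d * (z v + z v'')) + (x v + x v'') ^+ 2 * (w v + w v'').
    by rewrite F !linfD //; ring.
  by rewrite !FB F xv lv !linfN //; ring.
have [D0|D0] := eqVneq (r * u - s * t) 0; last first.
  have [p1 [p2 [p3 Eq]]] := reco _ _ _ _ D0; left.
  have hy' := linf_add hp (linf_sc (p2 / 2) hx); have hz' := linf_add hm (linf_sc p1 hx).
  have hw' : linf (fun v => w v - (p1 * p2) * (r * y v + s * z v)
      - (p2 ^+ 2 / 4 + 2 * p3 * p1) * (t * y v + u * z v)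
      - (p2 ^+ 2 * p1 / 4 + p3 * p1 ^+ 2) * x v).
    exact: linf_sub (linf_sub (linf_sub hw (linf_sc _ hp)) (linf_sc _ hm)) (linf_sc _ hx).
  apply: (cubes_ext (unode_D5 p3 hx hy' hz' hw')) => v /=.
  by rewrite ef E Eq; field.
have [r0|r0] := eqVneq r 0; have [s0|s0] := eqVneq s 0.
- by right; apply: zeroh => v; rewrite E r0 s0; ring.
- have t0 : t = 0.
    by move/eqP: D0; rewrite r0 mul0r sub0r oppr_eq0 mulf_eq0 (negPf s0) => /eqP.
  have [u0|u0] := eqVneq u 0.
    by right; apply: zeroh => v; rewrite E t0 u0; ring.
  apply: (triple (s ^+ 2 * u) q3 q2 q1 z y hz hy _ _); last by rewrite mulf_neq0 ?expf_neq0.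
  by move=> v; rewrite ef E r0 t0; ring.
- have u0 : u = 0.
    by move/eqP: D0; rewrite s0 mul0r subr0 mulf_eq0 (negPf r0) => /eqP.
  have [t0|t0] := eqVneq t 0.
    by right; apply: zeroh => v; rewrite E t0 u0; ring.
  apply: (triple (r ^+ 2 * t) q1 q2 q3 y z hy hz _ _); last by rewrite mulf_neq0 ?expf_neq0.
  by move=> v; rewrite ef E s0 u0; ring.
have eu : u = s * t / r.
  by apply: (mulfI r0); move/eqP: D0; rewrite subr_eq0 => /eqP ->; field.
have [t0|t0] := eqVneq t 0.
  by right; apply: zeroh => v; rewrite E eu t0; ring.
have D1 : r * 1 - s * 0 != 0 by rewrite mulr1 mulr0 subr0.
have [p1 [p2 [p3 Eq]]] := reco _ _ _ _ D1.
apply: (triple (t / r) p1 p2 p3 _ _ hp hz _ _); last by rewrite mulf_neq0 ?invr_eq0.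
by move=> v; rewrite ef E eu Eq; field.
Qed.

End Unode.

(** * Symmetric trilinear forms and singular vectors *)
Section Trilinear.
Variables (C : numClosedFieldType) (n : nat).
Implicit Types (F G : 'rV[C]_n -> 'rV[C]_n -> 'rV[C]_n -> C).

Definition trilin F := [/\ forall v w, linf (fun u => F u v w),
  forall u v w, F u v w = F v u w & forall u v w, F u v w = F u w v].

Section Theory.
Variable F : 'rV[C]_n -> 'rV[C]_n -> 'rV[C]_n -> C.
Hypothesis hF : trilin F.

Lemma trilC12 u v w : F u v w = F v u w. Proof. by case: hF. Qed.
Lemma trilC23 u v w : F u v w = F u w v. Proof. by case: hF. Qed.
Lemma trilC13 u v w : F u v w = F w v u.
Proof. by rewrite trilC12 trilC23 trilC12. Qed.
Lemma tril1 v w : linf (fun u => F u v w). Proof. by case: hF. Qed.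
Lemma tril2 u w : linf (fun v => F u v w).
Proof. by apply: linf_ext (tril1 u w) _ => v; rewrite trilC12. Qed.
Lemma tril3 u v : linf (fun w => F u v w).
Proof. by apply: linf_ext (tril2 u v) _ => w; rewrite trilC23. Qed.
Lemma trilD1 a b v w : F (a + b) v w = F a v w + F b v w.
Proof. exact: (linfD _ _ (tril1 v w)). Qed.
Lemma trilD2 a b v w : F v (a + b) w = F v a w + F v b w.
Proof. exact: (linfD _ _ (tril2 v w)). Qed.
Lemma trilD3 a b v w : F v w (a + b) = F v w a + F v w b.
Proof. exact: (linfD _ _ (tril3 v w)). Qed.
Lemma trilZ1 k a v w : F (k *: a) v w = k * F a v w.
Proof. exact: (linfZ _ _ (tril1 v w)). Qed.
Lemma trilZ2 k a v w : F v (k *: a) w = k * F v a w.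
Proof. exact: (linfZ _ _ (tril2 v w)). Qed.
Lemma trilZ3 k a v w : F v w (k *: a) = k * F v w a.
Proof. exact: (linfZ _ _ (tril3 v w)). Qed.
Lemma tril01 v w : F 0 v w = 0. Proof. exact: (linf0 (tril1 v w)). Qed.
Lemma trilN1 a v w : F (- a) v w = - F a v w.
Proof. exact: (linfN _ (tril1 v w)). Qed.
Lemma trilN2 a v w : F v (- a) w = - F v a w.
Proof. exact: (linfN _ (tril2 v w)). Qed.
Lemma trilN3 a v w : F v w (- a) = - F v w a.
Proof. exact: (linfN _ (tril3 v w)). Qed.
Definition trilE := (trilD1, trilD2, trilD3, trilZ1, trilZ2, trilZ3, trilN1, trilN2, trilN3).

Lemma tril_sum1 (I : Type) (r : seq I) (P : pred I) (a : I -> 'rV[C]_n) v w :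
  F (\sum_(i <- r | P i) a i) v w = \sum_(i <- r | P i) F (a i) v w.
Proof.
elim: r => [|i r IH]; first by rewrite !big_nil tril01.
by rewrite !big_cons; case: (P i); rewrite ?trilD1 IH.
Qed.

Lemma cubD u v : F (u + v) (u + v) (u + v) =
  F u u u + 3 * F u u v + 3 * F u v v + F v v v.
Proof.
rewrite !trilE (trilC23 u v u) (trilC12 v u u) (trilC23 u v u).
by rewrite (trilC12 v u v) (trilC13 v v u); ring.
Qed.

Lemma polar_sq v u : F v v u =
  (F (v + u) (v + u) (v + u) - F (v - u) (v - u) (v - u) - 2 * F u u u) / 6.
Proof. by rewrite !cubD !trilE; field. Qed.

Lemma polarize u v w : F u v w =
  (F (u + v + w) (u + v + w) (u + v + w) - F (u + v) (u + v) (u + v)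
   - F (u + w) (u + w) (u + w) - F (v + w) (v + w) (v + w)
   + F u u u + F v v v + F w w w) / 6.
Proof.
rewrite !cubD !trilE.
by rewrite (trilC12 v u w); field.
Qed.
End Theory.

Lemma trilin_eq F G : trilin F -> trilin G -> (forall v, F v v v = G v v v) ->
  forall u v w, F u v w = G u v w.
Proof. by move=> hF hG e u v w; rewrite (polarize hF) (polarize hG) !e. Qed.

Lemma trilin_cubes k (l : 'I_k -> 'rV[C]_n -> C) : (forall i, linf (l i)) ->
  trilin (fun u v w => \sum_(i < k) l i u * l i v * l i w).
Proof.
move=> hl; split=> [v w a u u'|u v w|u v w].
- by rewrite mulr_sumr -big_split; apply: eq_bigr => i _; rewrite hl /=; ring.
- by apply: eq_bigr => i _; ring.
by apply: eq_bigr => i _; ring.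
Qed.

(** Polarization turns an equality of cubic forms into one of trilinear forms. *)
Lemma cubes_trilin k F : trilin F -> cubes k (fun v => F v v v) ->
  exists l : 'I_k -> 'rV[C]_n -> C, (forall i, linf (l i)) /\
    forall u v w, F u v w = \sum_(i < k) l i u * l i v * l i w.
Proof.
move=> hF [l [hl e]]; exists l; split=> //.
by apply: trilin_eq => // [|v]; [exact: trilin_cubes | rewrite e; apply: eq_bigr => i _; ring].
Qed.

Definition frame (e : 'I_n -> 'rV[C]_n) (x : 'I_n -> 'rV[C]_n -> C) :=
  [/\ forall i, linf (x i), forall v, v = \sum_i x i v *: e i
    & forall i j, x i (e j) = (i == j)%:R].

Lemma nonzero_coord (z : 'rV[C]_n) : z != 0 -> exists i, z 0 i != 0.
Proof.
move=> z0; apply/existsP; apply: contraNT z0; rewrite negb_exists => /forallP h.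
by apply/eqP/rowP => i; rewrite mxE; apply/eqP; have := h i; rewrite negbK.
Qed.

Lemma nonzero_functional (z : 'rV[C]_n) : z != 0 ->
  exists T : 'rV[C]_n -> C, linf T /\ T z != 0.
Proof.
move=> /nonzero_coord [i hi].
by exists (fun v => v 0 i); split=> // a v w; rewrite !mxE.
Qed.

Lemma frame_unit (P : 'M[C]_n) : P \in unitmx ->
  frame (fun i => row i P) (fun i v => (v *m invmx P) 0 i).
Proof.
move=> hP; split=> [i a u v|v|i j].
- by rewrite mulmxDl -scalemxAl !mxE.
- by rewrite -mulmx_sum_row mulmxKV.
by rewrite -row_mul mulmxV // !mxE eq_sym.
Qed.

Lemma extend_basis m (a : 'I_m -> 'rV[C]_n) :
  (forall c : 'I_m -> C, \sum_i c i *: a i = 0 -> forall i, c i = 0) ->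
  exists e x, frame e x /\ forall (i : 'I_m) (j : 'I_n), i = j :> nat -> e j = a i.
Proof.
move=> ind; pose A := \matrix_i a i.
have fA : row_free A.
  apply: inj_row_free => v; rewrite mulmx_sum_row => h.
  apply/rowP => i; rewrite mxE; apply: ind.
  by rewrite -[RHS]h; apply: eq_bigr => j _; rewrite rowK.
have rA i t : A i t = a i 0 t by rewrite mxE.
have [k ek] : exists k, (m + k)%N = n.
  exists (n - m)%N; rewrite subnKC //; move: fA => /eqP <-; exact: rank_leq_col.
have [P [hP rP]] : exists P : 'M[C]_n, P \in unitmx /\
    forall (i : 'I_m) (j : 'I_n), i = j :> nat -> row j P = a i.
  clear ind; clearbody A; move: a A rA fA; rewrite -ek => a A rA fA.
  have hk : \rank (A^C)%MS = k by rewrite mxrank_compl (eqP fA) addKn.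
  pose B := castmx (hk, erefl) (row_base (A^C)%MS).
  exists (col_mx A B); split.
    rewrite -row_full_unit -sub1mx; have h := addsmx_compl_full A.
    rewrite -sub1mx in h; apply: submx_trans h _.
    rewrite addsmxE; apply/row_subP => i; rewrite -addsmxE.
    apply: submx_trans (row_sub i _) _; rewrite addsmxE.
    rewrite -!addsmxE addsmxS //.
    by rewrite /B eqmx_cast eq_row_base.
  move=> i j ij; have -> : j = lshift k i by apply: val_inj; rewrite /= ij.
  by apply/rowP => t; rewrite mxE col_mxEu rA.
by exists (fun i => row i P), (fun i v => (v *m invmx P) 0 i); split=> //; apply: frame_unit.
Qed.

Lemma linf_mx m (l : 'I_m -> 'rV[C]_n -> C) : (forall i, linf (l i)) ->
  exists A : 'M[C]_(n, m), forall v i, l i v = (v *m A) 0 i.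
Proof.
move=> hl; exists (\matrix_(i, j) l j (delta_mx 0 i)) => v i.
rewrite {1}(row_sum_delta v) mxE.
have -> : forall r : seq 'I_n, l i (\sum_(j <- r) v 0 j *: delta_mx 0 j) =
    \sum_(j <- r) v 0 j * l i (delta_mx 0 j).
  elim=> [|j r IH]; first by rewrite !big_nil linf0.
  by rewrite !big_cons hl IH.
by apply: eq_bigr => j _; rewrite mxE.
Qed.

Lemma common_zero m (l : 'I_m -> 'rV[C]_n -> C) : (forall i, linf (l i)) ->
  (m < n)%N -> exists2 v, v != 0 & forall i, l i v = 0.
Proof.
move=> hl mn; have [A hA] := linf_mx hl.
have : kermx A != 0.
  rewrite -mxrank_eq0 mxrank_ker -lt0n subn_gt0.
  exact: leq_ltn_trans (rank_leq_col A) mn.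
move=> /rowV0Pn [v /sub_kermxP vA v0]; exists v => // i.
by rewrite hA vA mxE.
Qed.

(** Linear independence of two vectors: distinct points of the projective space. *)
Definition prop_free (u v : 'rV[C]_n) := forall a b, a *: u + b *: v = 0 -> a = 0 /\ b = 0.

Lemma prop_freeP (u v : 'rV[C]_n) : u != 0 -> (forall a, v != a *: u) -> prop_free u v.
Proof.
move=> u0 h a b e; have [b0|b0] := eqVneq b 0.
  by move/eqP: e; rewrite b0 scale0r addr0 scaler_eq0 (negPf u0) orbF => /eqP.
case/negP: (h (- a / b)); apply/eqP/(scalerI b0).
by rewrite scalerA mulrC mulfVK // scaleNr; apply/eqP; rewrite -addr_eq0 addrC e.
Qed.

Lemma common_zeros_pair (l m : 'rV[C]_n -> C) : linf l -> linf m -> (3 < n)%N ->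
  exists k1 k2, [/\ prop_free k1 k2, l k1 = 0 /\ m k1 = 0 & l k2 = 0 /\ m k2 = 0].
Proof.
move=> hl hm n3.
have [||k1 k10 h1] := @common_zero 2 (fun i => if i == ord0 then l else m).
- by move=> i; case: ifP.
- exact: ltn_trans n3.
have [T [hT T0]] := nonzero_functional k10.
have [||k2 k20 h2] := @common_zero 3 (fun i => if i == ord0 then T else
   if i == lift ord0 ord0 then l else m).
- by move=> i; case: ifP => // _; case: ifP.
- exact: n3.
exists k1, k2; split.
- apply: prop_freeP => // a; apply/eqP => e.
  have := h2 ord0; rewrite e /= linfZ // => /eqP; rewrite mulf_eq0 (negPf T0) orbF => /eqP a0.
  by move/eqP: k20; apply; rewrite e a0 scale0r.
- by split; [exact: (h1 ord0)|exact: (h1 (lift ord0 ord0))].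
by split; [exact: (h2 (lift ord0 ord0))|exact: (h2 (lift ord0 (lift ord0 ord0)))].
Qed.

Definition sing F (v : 'rV[C]_n) := forall u, F v v u = 0.

Definition finite_sing F := exists s : seq 'rV[C]_n,
  forall v, v != 0 -> sing F v -> exists2 p, p \in s & exists a, v = a *: p.

Lemma infinite_sing F (g : nat -> 'rV[C]_n) : finite_sing F ->
  (forall i, g i != 0) -> (forall i, sing F (g i)) ->
  (forall i j a, i != j -> g i != a *: g j) -> False.
Proof.
move=> [s hs] g0 gs gp.
have idx (i : 'I_(size s).+1) : exists k : 'I_(size s), exists a, g i = a *: nth 0 s k.
  have [p ps [a e]] := hs _ (g0 i) (gs i).
  have h : (index p s < size s)%N by rewrite index_mem.
  by exists (Ordinal h), a; rewrite /= nth_index.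
have [k hk] := fin_all_exists idx.
have [i [j [ij kij]]] : exists i j, i != j /\ k i = k j.
  have [/injectiveP inj|/injectivePn [i [j ij e]]] := boolP (injectiveb k).
    by have := leq_card _ inj; rewrite !card_ord ltnn.
  by exists i, j.
have [a ea] := hk i; have [b eb] := hk j.
have b0 : b != 0 by apply: contraTneq (g0 j) => b0; rewrite eb b0 scale0r eqxx.
have := gp i j (a / b); rewrite -val_eqE /= in ij; move=> /(_ ij) /eqP []; rewrite ea eb kij.
by rewrite scalerA mulfVK.
Qed.

Lemma prop_free_family (u v : 'rV[C]_n) (i j : nat) a : prop_free u v -> i != j ->
  u + i%:R *: v != a *: (u + j%:R *: v).
Proof.
move=> h ij; apply/eqP => e.
have [|e1 e2] := h (1 - a) (i%:R - a * j%:R).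
  rewrite !scalerBl scale1r addrACA -opprD -scalerA -scalerDr -e; exact: subrr.
have a1 : a = 1 by apply/esym/eqP; rewrite -subr_eq0 e1.
by move/eqP: e2; rewrite a1 mul1r subr_eq0 eqr_nat (negPf ij).
Qed.

Lemma pencil_infinite F (u v : 'rV[C]_n) : finite_sing F -> prop_free u v ->
  (forall a b, sing F (a *: u + b *: v)) -> False.
Proof.
move=> fs uv hs; apply: (infinite_sing (g := fun i => u + i%:R *: v) fs) => [i|i|i j a ij].
- apply/eqP => e; have [|/eqP] := uv 1 i%:R; first by rewrite scale1r.
  by rewrite oner_eq0.
- by have := hs 1 i%:R; rewrite scale1r.
exact: prop_free_family.
Qed.

Lemma planar_infinite F (x y : 'rV[C]_n -> C) : (3 < n)%N -> finite_sing F -> linf x -> linf y ->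
  (forall v, x v = 0 -> y v = 0 -> sing F v) -> False.
Proof.
move=> n3 fs hx hy hs; have [u [v [uv [u1 u2] [v1 v2]]]] := common_zeros_pair hx hy n3.
apply: (pencil_infinite fs uv) => a b.
by apply: hs; rewrite linfD // !linfZ // ?u1 ?u2 ?v1 ?v2; ring.
Qed.

End Trilinear.

(** * Coordinate changes and kernels of polar quadrics *)
Section BinaryChange.
Variable C : numClosedFieldType.

Lemma quad_normal (a b c : C) : exists r s t u k m,
  [/\ r * u - s * t != 0, (k == 0) || (m == 0) & forall X Y,
   a * X ^+ 2 + b * X * Y + c * Y ^+ 2 =
   k * (r * X + s * Y) * (t * X + u * Y) + m * (r * X + s * Y) ^+ 2].
Proof.
have [r [s [t [u [-> -> ->]]]]] := quad_factor a b c.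
have [D0|D0] := eqVneq (r * u - s * t) 0; last first.
  by exists r, s, t, u, 1, 0; split; rewrite ?eqxx ?orbT // => X Y; ring.
have [r0|r0] := eqVneq r 0; have [s0|s0] := eqVneq s 0.
- exists 1, 0, 0, 1, 0, 0; split; rewrite ?eqxx ?mulr1 ?mulr0 ?subr0 ?oner_eq0 // => X Y.
  by rewrite r0 s0; ring.
- have t0 : t = 0.
    by move/eqP: D0; rewrite r0 mul0r sub0r oppr_eq0 mulf_eq0 (negPf s0) => /eqP.
  exists 0, 1, 1, 0, 0, (s * u); split; rewrite ?eqxx ?mulr1 ?mulr0 ?sub0r ?oppr_eq0 ?oner_eq0 // => X Y.
  by rewrite r0 t0; ring.
- have u0 : u = 0 by move/eqP: D0; rewrite s0 mul0r subr0 mulf_eq0 (negPf r0) => /eqP.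
  exists 1, 0, 0, 1, 0, (r * t); split; rewrite ?eqxx ?mulr1 ?mulr0 ?subr0 ?oner_eq0 // => X Y.
  by rewrite s0 u0; ring.
have eu : u = s * t / r by apply: (mulfI r0); move/eqP: D0; rewrite subr_eq0 => /eqP ->; field.
exists r, s, 0, 1, 0, (t / r); split; rewrite ?eqxx ?mulr1 ?mulr0 ?subr0 // => X Y.
by rewrite eu; field.
Qed.

Section Change.
Variables r s t u : C.
Hypothesis D0 : r * u - s * t != 0.

Lemma change1 (a b : C) : exists a' b', forall X Y,
  a * X + b * Y = a' * (r * X + s * Y) + b' * (t * X + u * Y).
Proof.
exists ((a * u - b * t) / (r * u - s * t)), ((b * r - a * s) / (r * u - s * t)) => X Y.
by field.
Qed.

Lemma change2 (a b c : C) : exists a' b' c', forall X Y,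
  a * X ^+ 2 + b * X * Y + c * Y ^+ 2 =
  a' * (r * X + s * Y) ^+ 2 + b' * (r * X + s * Y) * (t * X + u * Y)
  + c' * (t * X + u * Y) ^+ 2.
Proof.
have [p [q h1]] := change1 1 0; have [p' [q' h2]] := change1 0 1.
exists (a * p ^+ 2 + b * p * p' + c * p' ^+ 2),
  (2 * a * p * q + b * (p * q' + q * p') + 2 * c * p' * q'),
  (a * q ^+ 2 + b * q * q' + c * q' ^+ 2) => X Y.
have := h1 X Y; have := h2 X Y; rewrite !mul1r !mul0r add0r addr0.
move: (r * X + s * Y) (t * X + u * Y) => X' Y' -> ->; ring.
Qed.

Lemma change3 (a b c d : C) : exists a' b' c' d', forall X Y,
  a * X ^+ 3 + b * X ^+ 2 * Y + c * X * Y ^+ 2 + d * Y ^+ 3 =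
  a' * (r * X + s * Y) ^+ 3 + b' * (r * X + s * Y) ^+ 2 * (t * X + u * Y)
  + c' * (r * X + s * Y) * (t * X + u * Y) ^+ 2 + d' * (t * X + u * Y) ^+ 3.
Proof.
have [p [q h1]] := change1 1 0; have [p' [q' h2]] := change1 0 1.
exists (a * p ^+ 3 + b * p ^+ 2 * p' + c * p * p' ^+ 2 + d * p' ^+ 3),
  (3 * a * p ^+ 2 * q + b * (2 * p * q * p' + p ^+ 2 * q')
    + c * (q * p' ^+ 2 + 2 * p * p' * q') + 3 * d * p' ^+ 2 * q'),
  (3 * a * p * q ^+ 2 + b * (2 * p * q * q' + q ^+ 2 * p')
    + c * (p * q' ^+ 2 + 2 * q * p' * q') + 3 * d * p' * q' ^+ 2),
  (a * q ^+ 3 + b * q ^+ 2 * q' + c * q * q' ^+ 2 + d * q' ^+ 3) => X Y.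
have := h1 X Y; have := h2 X Y; rewrite !mul1r !mul0r add0r addr0.
move: (r * X + s * Y) (t * X + u * Y) => X' Y' -> ->; ring.
Qed.
End Change.
End BinaryChange.

Section Expand.
Variables (C : numClosedFieldType) (n : nat) (F : 'rV[C]_n -> 'rV[C]_n -> 'rV[C]_n -> C).
Hypothesis hF : trilin F.

Lemma expand2 (X Y : C) b c : let v := X *: b + Y *: c in F v v v =
  X ^+ 3 * F b b b + 3 * X ^+ 2 * Y * F b b c + 3 * X * Y ^+ 2 * F b c c
  + Y ^+ 3 * F c c c.
Proof. by rewrite /= (cubD hF) !(trilE hF); ring. Qed.

Lemma expand3 (X Y Z : C) a b c : let v := X *: a + (Y *: b + Z *: c) in F v v v =
  X ^+ 3 * F a a a + 3 * X ^+ 2 * (Y * F a a b + Z * F a a c)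
  + 3 * X * (Y ^+ 2 * F a b b + 2 * Y * Z * F a b c + Z ^+ 2 * F a c c)
  + (Y ^+ 3 * F b b b + 3 * Y ^+ 2 * Z * F b b c + 3 * Y * Z ^+ 2 * F b c c
     + Z ^+ 3 * F c c c).
Proof.
by rewrite /= (cubD hF) expand2 !(trilE hF) (trilC23 hF a c b); ring.
Qed.

Lemma expand4 (X Y Z W : C) a b c d :
  let v := X *: a + (Y *: b + (Z *: c + W *: d)) in F v v v =
  X ^+ 3 * F a a a + 3 * X ^+ 2 * (Y * F a a b + Z * F a a c + W * F a a d)
  + 3 * X * (Y ^+ 2 * F a b b + 2 * Y * (Z * F a b c + W * F a b d)
       + Z ^+ 2 * F a c c + 2 * Z * W * F a c d + W ^+ 2 * F a d d)
  + (Y ^+ 3 * F b b b + 3 * Y ^+ 2 * (Z * F b b c + W * F b b d)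
  + 3 * Y * (Z ^+ 2 * F b c c + 2 * Z * W * F b c d + W ^+ 2 * F b d d)
  + (Z ^+ 3 * F c c c + 3 * Z ^+ 2 * W * F c c d + 3 * Z * W ^+ 2 * F c d d
     + W ^+ 3 * F d d d)).
Proof.
rewrite /= (cubD hF) expand3 !(trilE hF) (trilC23 hF a c b) (trilC23 hF a d b).
by rewrite (trilC23 hF a d c); ring.
Qed.

End Expand.

Section Pull.
Variables (C : numClosedFieldType) (n m : nat) (pi : 'rV[C]_n -> 'rV[C]_m).
Hypothesis hpi : forall a u v, pi (a *: u + v) = a *: pi u + pi v.

Lemma linf_pull l : linf l -> linf (fun v => l (pi v)).
Proof. by move=> h a u v; rewrite hpi h. Qed.

Lemma cubes_pull k f : cubes k f -> cubes k (fun v => f (pi v)).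
Proof.
move=> [l [hl e]]; exists (fun i v => l i (pi v)); split=> [i|v]; last exact: e.
exact: linf_pull.
Qed.
End Pull.

Section HessianPoint.
Variables (C : numClosedFieldType) (n : nat) (F : 'rV[C]_n.+1 -> 'rV[C]_n.+1 -> 'rV[C]_n.+1 -> C).
Hypothesis hF : trilin F.

Definition hess (v : 'rV[C]_n.+1) : 'M[C]_n.+1 := \matrix_(i, j) F v (delta_mx 0 i) (delta_mx 0 j).

Lemma hessE v k w : F v k w = (k *m hess v *m w^T) 0 0.
Proof.
rewrite {1}(row_sum_delta k) (trilC12 hF) (tril_sum1 hF) mxE.
under eq_bigr => i _ do rewrite (trilC12 hF) (trilC13 hF) {1}(row_sum_delta w) (tril_sum1 hF).
under eq_bigr => i _.
  under eq_bigr => j _ do rewrite (trilC13 hF) !(trilE hF).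
  over.
rewrite exchange_big /=; apply: eq_bigr => j _; rewrite !mxE mulr_suml.
by apply: eq_bigr => i _; rewrite !mxE; ring.
Qed.

Lemma hess_ker v k : (forall w, F v k w = 0) <-> k *m hess v = 0.
Proof.
split=> [h|h w]; last by rewrite hessE h mul0mx mxE.
by apply/rowP => j; rewrite [RHS]mxE -(h (delta_mx 0 j)) hessE trmx_delta -colE [RHS]mxE.
Qed.

Lemma hess_sym v : (hess v)^T = hess v.
Proof. by apply/matrixP => i j; rewrite !mxE (trilC23 hF). Qed.

Lemma hess_lin a u v : hess (a *: u + v) = a *: hess u + hess v.
Proof. by apply/matrixP => i j; rewrite !mxE !(trilE hF). Qed.

Lemma singular_ker (A : 'M[C]_n.+1) : A \notin unitmx -> exists2 k : 'rV[C]_n.+1, k != 0 & k *m A = 0.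
Proof.
rewrite -row_free_unit -kermx_eq0 => /rowV0Pn [v /sub_kermxP vA v0].
by exists v.
Qed.

Lemma eigen_exists (A B : 'M[C]_n.+1) : A \in unitmx ->
  exists (t : C) (k : 'rV[C]_n.+1), k != 0 /\ k *m B = t *: (k *m A).
Proof.
move=> hA; have : size (char_poly (B *m invmx A)) != 1%N by rewrite size_char_poly.
move=> /closed_rootP [t]; rewrite -eigenvalue_root_char => /eigenvalueP [k hk k0].
exists t, k; split=> //; move/(congr1 (mulmx^~ A)): hk.
by rewrite -mulmxA mulmxKV // -scalemxAl.
Qed.

Lemma delta_free m : prop_free (delta_mx 0 ord0 : 'rV[C]_m.+2) (delta_mx 0 (lift ord0 ord0)).
Proof.
move=> a b /rowP h; have := h ord0; have := h (lift ord0 ord0).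
by rewrite !mxE /= !mulr1 !mulr0 addr0 add0r.
Qed.

(** The Hessian determinant vanishes somewhere on every line. *)
Lemma hess_point (u0 u1 : 'rV[C]_n.+1) : prop_free u0 u1 ->
  exists v k, [/\ v != 0, k != 0 & forall w, F v k w = 0].
Proof.
move=> uu; have [h|/singular_ker [k k0 hk]] := boolP (hess u0 \in unitmx); last first.
  exists u0, k; split=> //; last exact/hess_ker.
  apply/eqP => e; have [|/eqP] := uu 1 0; first by rewrite e scaler0 scale0r addr0.
  by rewrite oner_eq0.
have [t [k [k0 hk]]] := eigen_exists (hess u1) h.
exists ((- t) *: u0 + u1), k; split=> //.
  apply/eqP => e; have [|_ /eqP] := uu (- t) 1; first by rewrite scale1r.
  by rewrite oner_eq0.
apply/hess_ker; rewrite hess_lin mulmxDr hk -scalemxAr scaleNr; exact: addNr.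
Qed.
End HessianPoint.

Section Extend.
Variable C : numClosedFieldType.

Lemma extend3_1 (a : 'rV[C]_3) : a != 0 -> exists b c x y z,
  [/\ linf x, linf y, linf z & forall v, v = x v *: a + (y v *: b + z v *: c)].
Proof.
move=> a0; have [|e [x [[hx hd _] he]]] := @extend_basis C 3 1 (fun _ => a).
  move=> k; rewrite big_ord1 => /eqP; rewrite scaler_eq0 (negPf a0) orbF => /eqP h i.
  by rewrite ord1.
exists (e (lift ord0 ord0)), (e (lift ord0 (lift ord0 ord0))), (x ord0), (x (lift ord0 ord0)), (x (lift ord0 (lift ord0 ord0))).
split=> // v; rewrite {1}[v]hd !big_ord_recl big_ord0 addr0.
by rewrite (he ord0 ord0 erefl).
Qed.

Lemma extend3_2 (a b : 'rV[C]_3) : prop_free a b -> exists c x y z,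
  [/\ linf x, linf y, linf z & forall v, v = x v *: a + (y v *: b + z v *: c)].
Proof.
move=> ab.
have [|e [x [[hx hd _] he]]] := @extend_basis C 3 2 (fun i => if i == ord0 then a else b).
  move=> k; rewrite !big_ord_recl big_ord0 addr0 /= => /ab [h0 h1] i.
  by case: (unliftP ord0 i) => [j|] ->; rewrite ?(ord1 j).
exists (e (lift ord0 (lift ord0 ord0))), (x ord0), (x (lift ord0 ord0)), (x (lift ord0 (lift ord0 ord0))).
split=> // v; rewrite {1}[v]hd !big_ord_recl big_ord0 addr0.
by rewrite (he ord0 ord0 erefl) (he (lift ord0 ord0) (lift ord0 ord0) erefl).
Qed.

Lemma extend4_2 (a b : 'rV[C]_4) : prop_free a b -> exists c d x y z w,
  [/\ [/\ linf x, linf y, linf z & linf w],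
   forall v, v = x v *: a + (y v *: b + (z v *: c + w v *: d)) &
   [/\ z a = 0, z b = 0, w a = 0 & w b = 0]].
Proof.
move=> ab.
have [|e [x [[hx ex dx] h]]] := @extend_basis C 4 2 (fun i => if i == ord0 then a else b).
  move=> k; rewrite !big_ord_recl big_ord0 addr0 /= => /ab [h0 h1] i.
  by case: (unliftP ord0 i) => [j|] ->; rewrite ?(ord1 j).
have ea : e ord0 = a by rewrite (h ord0 ord0).
have eb : e (lift ord0 ord0) = b by rewrite (h (lift ord0 ord0) (lift ord0 ord0)).
exists (e (lift ord0 (lift ord0 ord0))), (e (lift ord0 (lift ord0 (lift ord0 ord0)))),
  (x ord0), (x (lift ord0 ord0)), (x (lift ord0 (lift ord0 ord0))),
  (x (lift ord0 (lift ord0 (lift ord0 ord0)))); split=> [//|v|].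
  by rewrite {1}[v]ex !big_ord_recl big_ord0 addr0 ea eb.
by rewrite -ea -eb !dx.
Qed.

Lemma extend4_3 (a b c : 'rV[C]_4) :
  (forall p q r, p *: a + (q *: b + r *: c) = 0 -> [/\ p = 0, q = 0 & r = 0]) ->
  exists d x y z w, [/\ linf x, linf y, linf z, linf w &
   forall v, v = x v *: a + (y v *: b + (z v *: c + w v *: d))].
Proof.
move=> abc.
have [|e [x [[hx hd _] he]]] := @extend_basis C 4 3
    (fun i => if i == ord0 then a else if i == lift ord0 ord0 then b else c).
  move=> k; rewrite !big_ord_recl big_ord0 addr0 /= => /abc [h0 h1 h2] i.
  case: (unliftP ord0 i) => [j|] -> //.
  by case: (unliftP ord0 j) => [j'|] ->; rewrite ?(ord1 j').
exists (e (lift ord0 (lift ord0 (lift ord0 ord0)))), (x ord0), (x (lift ord0 ord0)), (x (lift ord0 (lift ord0 ord0))), (x (lift ord0 (lift ord0 (lift ord0 ord0)))).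
split=> // v; rewrite {1}[v]hd !big_ord_recl big_ord0 addr0.
by rewrite (he ord0 ord0 erefl) (he (lift ord0 ord0) (lift ord0 ord0) erefl) (he (lift ord0 (lift ord0 ord0)) (lift ord0 (lift ord0 ord0)) erefl).
Qed.

End Extend.

(** * Plane cubics *)
Section Ternary.
Variables (C : numClosedFieldType) (F : 'rV[C]_3 -> 'rV[C]_3 -> 'rV[C]_3 -> C).
Hypothesis hF : trilin F.

(** A conic with a tangent line, the only plane cubics that are not sums of four cubes:
[l], [m] and [p] are coordinates. *)
Definition conic_tangent (f : 'rV[C]_3 -> C) := exists l m p,
  [/\ linf l, linf m, linf p, forall v, f v = l v ^+ 2 * m v + l v * p v ^+ 2 &
   forall s, linf s -> exists a b c, forall v, s v = a * l v + b * m v + c * p v].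

(** In coordinates at the singular point the cubic is [x q(y, z) + c(y, z)]. If [q] has
two distinct factors the point is a node; if it is a square, the root multiplicities of
[c] relative to that of [q] decide. *)
Lemma ternary_singular (a : 'rV[C]_3) : a != 0 -> sing F a ->
  cubes 4 (fun v => F v v v) \/ conic_tangent (fun v => F v v v).
Proof.
move=> a0 sa; have [b [c [x [y [z [hx hy hz hd]]]]]] := extend3_1 a0.
have E v : F v v v = x v * (3 * F a b b * y v ^+ 2 + 6 * F a b c * y v * z v
    + 3 * F a c c * z v ^+ 2)
   + (F b b b * y v ^+ 3 + 3 * F b b c * y v ^+ 2 * z v + 3 * F b c c * y v * z v ^+ 2
      + F c c c * z v ^+ 3).
  by rewrite {1 2 3}[v]hd (expand3 hF) !sa; ring.
have [r [s [t [u [k [m [D0 km Q]]]]]]] := quad_normal (3 * F a b b) (6 * F a b c) (3 * F a c c).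
have [a' [b' [c' [d' B]]]] := change3 D0 (F b b b) (3 * F b b c) (3 * F b c c) (F c c c).
have hy' := linf_add (linf_sc r hy) (linf_sc s hz).
have hz' := linf_add (linf_sc t hy) (linf_sc u hz).
case/orP: km => /eqP k0; last first.
  have hx' := linf_add (linf_add (linf_sc k hx) (linf_sc b' hy')) (linf_sc c' hz').
  left; apply: (cubes_ext (node_cubes4 1 a' d' hy' hz' hx')) => v /=.
  by rewrite E Q B k0; ring.
have hx' := linf_add (linf_add (linf_sc m hx) (linf_sc a' hy')) (linf_sc b' hz').
have [d0|d0] := eqVneq d' 0; last first.
  left; pose q := c' / (3 * d').
  have h1 := cubes1 d' (linf_add hz' (linf_sc q hy')).
  have hx'' := linf_sub (linf_sub hx' (linf_sc (3 * d' * q ^+ 2) hz')) (linf_sc (d' * q ^+ 3) hy').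
  apply: (cubes_ext (cubesD h1 (sqlin_cubes3 hy' hx''))) => v /=.
  by rewrite E Q B k0 (_ : c' = 3 * d' * q); [ring | rewrite /q; field].
have [c0|c0] := eqVneq c' 0.
  left; apply: (@cubes_weak _ _ 3) => //.
  by apply: (cubes_ext (sqlin_cubes3 hy' hx')) => v /=; rewrite E Q B k0 d0 c0; ring.
have [m0|m0] := eqVneq m 0.
  left; apply: (@cubes_weak _ _ 3) => //.
  by apply: (cubes_ext (binary_cubes3 a' b' c' d' hy' hz')) => v /=; rewrite E Q B k0 m0; ring.
right; have [q hq] := sq_root c'.
have q0 : q != 0 by apply: contraNneq c0 => q0; rewrite -hq q0 expr0n.
exists (fun v => r * y v + s * z v), (fun v => m * x v + a' * (r * y v + s * z v)
  + b' * (t * y v + u * z v)), (fun v => q * (t * y v + u * z v)); split=> //.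
- exact: (linf_sc q hz').
- by move=> v; rewrite E Q B k0 d0 -hq; ring.
move=> g hg; have [p1 [p2 hp]] := change1 D0 (g b) (g c).
exists (p1 - a' * g a / m), (g a / m), ((p2 - b' * g a / m) / q) => v.
have -> : g v = g a * x v + (g b * y v + g c * z v).
  by rewrite {1}[v]hd !linfD // !linfZ //; ring.
by rewrite hp; field; rewrite q0 m0.
Qed.

(** Let [k] be a kernel vector of the polar conic of [v]. If neither is singular, they are
two coordinate vectors for which no monomial contains both coordinates [x] and [y], so
the cubic is a sum of a binary cubic in [x], [z] and one in [y], [z]; a multiple of
[z ^ 3] is moved between them until both are generic. *)
Lemma ternary_cubes4 : cubes 4 (fun v => F v v v) \/ conic_tangent (fun v => F v v v).
Proof.
have [v [k [v0 k0 vk]]] := hess_point hF (@delta_free C 1).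
have [sv|sv] := boolp.pselect (sing F v); first exact: ternary_singular v0 sv.
have [sk|sk] := boolp.pselect (sing F k); first exact: ternary_singular k0 sk.
left; have vk' : prop_free v k.
  apply: prop_freeP => // a; apply/eqP => e; apply: sk => u.
  by rewrite {1}e (trilE hF) vk mulr0.
have [c [x [y [z [hx hy hz hd]]]]] := extend3_2 vk'.
have kv w : F k v w = 0 by rewrite (trilC12 hF) vk.
have E w : F w w w = (F v v v * x w ^+ 3 + 3 * F v v c * x w ^+ 2 * z w
     + 3 * F v c c * x w * z w ^+ 2 + F c c c * z w ^+ 3)
   + (F k k k * y w ^+ 3 + 3 * F k k c * y w ^+ 2 * z w + 3 * F k c c * y w * z w ^+ 2).
  by rewrite {1 2 3}[w]hd (expand3 hF) (trilC23 hF v v k) !vk; ring.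
have nv : (F v v v != 0) || (3 * F v v c != 0).
  apply/norP => -[]; rewrite !negbK mulf_eq0 pnatr_eq0 => /eqP e1 /eqP e2; apply: sv => w.
  by rewrite {1}[w]hd !(trilE hF) e1 e2 (trilC23 hF v v k) vk; ring.
have nk : (F k k k != 0) || (3 * F k k c != 0).
  apply/norP => -[]; rewrite !negbK mulf_eq0 pnatr_eq0 => /eqP e1 /eqP e2; apply: sk => w.
  by rewrite {1}[w]hd !(trilE hF) e1 e2 (trilC23 hF k k v) kv; ring.
have [q [g1 g2]] := cofin_ex (cofin_and
  (binary_cubes2_generic (3 * F v c c) (F c c c) hx hz nv)
  (cofin_neg (binary_cubes2_generic (3 * F k c c) 0 hy hz nk))).
by apply: (cubes_ext (cubesD g1 g2)) => w /=; rewrite E; ring.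
Qed.

End Ternary.

(** * Polar quadrics of rank at most two *)
Section Corank2.
Variables (C : numClosedFieldType) (F : 'rV[C]_4 -> 'rV[C]_4 -> 'rV[C]_4 -> C).
Hypothesis hF : trilin F.

Lemma planar_sing_infinite : planar_sing (fun v => F v v v) -> finite_sing F -> False.
Proof.
move=> [x [y [hx hy h]]] fs; apply: (planar_infinite _ fs hx hy) => // v xv yv u.
by rewrite (polar_sq hF) h // mul0r.
Qed.

Definition row3 (a b c : C) : 'rV[C]_3 :=
  \row_(i < 3) (if i == ord0 then a else if i == lift ord0 ord0 then b else c).

Definition lift3 (a b c : 'rV[C]_4) (u : 'rV[C]_3) : 'rV[C]_4 :=
  u 0 ord0 *: a + (u 0 (lift ord0 ord0) *: b + u 0 (lift ord0 (lift ord0 ord0)) *: c).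

Lemma lift3_lin a b c k u v : lift3 a b c (k *: u + v) = k *: lift3 a b c u + lift3 a b c v.
Proof. by rewrite /lift3 !mxE !scalerDl -!scalerA !scalerDr [RHS]addrACA; congr (_ + _); rewrite [RHS]addrACA. Qed.

Lemma row3_lin (x y z : 'rV[C]_4 -> C) k u v : linf x -> linf y -> linf z ->
  row3 (x (k *: u + v)) (y (k *: u + v)) (z (k *: u + v)) =
  k *: row3 (x u) (y u) (z u) + row3 (x v) (y v) (z v).
Proof.
by move=> hx hy hz; apply/rowP => i; rewrite !mxE; case: ifP => _; [|case: ifP => _]; rewrite ?hx ?hy ?hz.
Qed.

Lemma lift3_row3 a b c p q r : lift3 a b c (row3 p q r) = p *: a + (q *: b + r *: c).
Proof. by rewrite /lift3 !mxE. Qed.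

Lemma trilin_lift3 a b c :
  trilin (fun u v w => F (lift3 a b c u) (lift3 a b c v) (lift3 a b c w)).
Proof.
split=> [v w k u u'|u v w|u v w].
- by rewrite lift3_lin !(trilE hF).
- by rewrite (trilC12 hF).
by rewrite (trilC23 hF).
Qed.

(** In coordinates starting with [a] and [b] the form is [3 w q(x, y) + c(z, x, y)]: the
terms [w z] are missing by the hypothesis on [b]. According to the rank of [q] the point
[a] is a binode, a unode or the vertex of a cone. A cone over a conic with a tangent
line has a line of singular points. *)
Lemma sing_corank2_cubes6 (a b : 'rV[C]_4) : finite_sing F -> prop_free a b ->
  sing F a -> (forall w, F a b w = 0) -> cubes 6 (fun v => F v v v).
Proof.
move=> fs ab sa hab.
have [c [d [w [z [x [y [[hw hz hx hy] hd _]]]]]]] := extend4_2 ab.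
pose G u v w := F (lift3 b c d u) (lift3 b c d v) (lift3 b c d w).
have E v : F v v v = 3 * w v * (F a c c * x v ^+ 2 + 2 * F a c d * x v * y v
     + F a d d * y v ^+ 2)
  + (F b b b * z v ^+ 3 + 3 * z v ^+ 2 * (F b b c * x v + F b b d * y v)
  + 3 * z v * (F b c c * x v ^+ 2 + 2 * F b c d * x v * y v + F b d d * y v ^+ 2)
  + (F c c c * x v ^+ 3 + 3 * F c c d * x v ^+ 2 * y v + 3 * F c d d * x v * y v ^+ 2
     + F d d d * y v ^+ 3)).
  by rewrite {1 2 3}[v]hd (expand4 hF) !sa !hab; ring.
have [r [s [t [u [k [m [D0 km Q]]]]]]] := quad_normal (F a c c) (2 * F a c d) (F a d d).
have [a1 [b1 L]] := change1 D0 (F b b c) (F b b d).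
have [a2 [b2 [c2 Q2]]] := change2 D0 (F b c c) (2 * F b c d) (F b d d).
have [a3 [b3 [c3 [d3 B]]]] := change3 D0 (F c c c) (3 * F c c d) (3 * F c d d) (F d d d).
have hx' := linf_add (linf_sc r hx) (linf_sc s hy).
have hy' := linf_add (linf_sc t hx) (linf_sc u hy).
have dich : cubes 6 (fun v => F v v v) \/ planar_sing (fun v => F v v v) ->
    cubes 6 (fun v => F v v v).
  by case=> // h; case: (planar_sing_infinite h fs).
have [m0|m0] := eqVneq m 0.
  have [k0|k0] := eqVneq k 0; last first.
    have hw' := linf_add (linf_add (linf_add (linf_sc (3 * k) hw) (linf_sc (3 * b2) hz))
      (linf_sc b3 hx')) (linf_sc c3 hy').
    apply: dich; apply: (binode_cubes6 (a1 := F b b b) (a2 := 3 * a1) (a3 := 3 * b1)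
      (a4 := 3 * a2) (a5 := 3 * c2) (a6 := a3) (a7 := d3) hx' hy' hz hw') => v.
    by rewrite E Q L Q2 B m0; ring.
  have hG : trilin G by exact: trilin_lift3.
  have EG v : F v v v = G (row3 (z v) (x v) (y v)) (row3 (z v) (x v) (y v)) (row3 (z v) (x v) (y v)).
    by rewrite /G !lift3_row3 (expand3 hF) E Q k0 m0; ring.
  have hpi p q q' : row3 (z (p *: q + q')) (x (p *: q + q')) (y (p *: q + q')) =
     p *: row3 (z q) (x q) (y q) + row3 (z q') (x q') (y q') by exact: row3_lin.
  have [h|[l [p [q [hl hp hq e _]]]]] := ternary_cubes4 hG.
    apply: (@cubes_weak _ _ 4) => //.
    apply: (cubes_ext (cubes_pull (pi := fun v => row3 (z v) (x v) (y v)) hpi h)) => v.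
    by rewrite EG.
  case: (@planar_sing_infinite _ fs).
  have hl' := linf_pull (pi := fun v => row3 (z v) (x v) (y v)) hpi hl.
  have hp' := linf_pull (pi := fun v => row3 (z v) (x v) (y v)) hpi hp.
  have hq' := linf_pull (pi := fun v => row3 (z v) (x v) (y v)) hpi hq.
  eexists; eexists; split; [exact: hl'|exact: hq'|] => v v' lv qv /=.
  have E' v1 : F v1 v1 v1 = (fun v => l (row3 (z v) (x v) (y v))) v1 ^+ 2
     * (fun v => p (row3 (z v) (x v) (y v))) v1
     + (fun v => l (row3 (z v) (x v) (y v))) v1 * (fun v => q (row3 (z v) (x v) (y v))) v1 ^+ 2.
    by rewrite EG e.
  by rewrite !E' (linfB _ _ hl') (linfB _ _ hp') (linfB _ _ hq') (linfD _ _ hl')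
    (linfD _ _ hp') (linfD _ _ hq') /= lv qv; ring.
have k0 : k = 0 by case/orP: km => /eqP // m0'; rewrite m0' eqxx in m0.
have hw'' : linf (fun v => 3 * m * w v + 3 * a2 * z v + a3 * (r * x v + s * y v)
    + b3 * (t * x v + u * y v)).
  exact: linf_add (linf_add (linf_add (linf_sc (3 * m) hw) (linf_sc (3 * a2) hz))
     (linf_sc a3 hx')) (linf_sc b3 hy').
apply: dich; apply: (unode_cubes6 (h0 := d3) (h1 := 3 * c2) (h2 := 3 * b1) (h3 := F b b b)
  (q1 := c3) (q2 := 3 * b2) (q3 := 3 * a1) hx' hy' hz hw'') => v.
by rewrite E Q L Q2 B k0; ring.
Qed.

(** Let [x] and [s] be the coordinates of [a] and of a vector [d] completing the basis.
Then the form is a binary cubic in [x], [s] plus a plane cubic, and the latter is only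
determined up to a multiple of [s ^ 3]. This freedom avoids a conic with a tangent line,
unless the tangent line is [s = 0]; but then some singular vector has a polar quadric of
rank at most two, which the first hypothesis excludes. *)
Lemma smooth_corank2_cubes6 (a b c : 'rV[C]_4) :
  (forall p q, p != 0 -> sing F p -> (forall w, F p q w = 0) -> exists k, q = k *: p) ->
  ~ sing F a -> prop_free b c -> (forall w, F a b w = 0) -> (forall w, F a c w = 0) ->
  cubes 6 (fun v => F v v v).
Proof.
move=> hns sa bc hab hac.
have abc p q r : p *: a + (q *: b + r *: c) = 0 -> [/\ p = 0, q = 0 & r = 0].
  move=> e; have p0 : p = 0.
    apply/eqP; apply: contraT => p0; case: sa => w.
    have := trilZ2 hF p a a w.
    have -> : p *: a = - (q *: b + r *: c) by apply/eqP; rewrite -addr_eq0 e.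
    rewrite (trilN2 hF) (trilD2 hF) !(trilZ2 hF) hab hac !mulr0 addr0 oppr0 => /esym/eqP.
    by rewrite mulf_eq0 (negPf p0) => /eqP.
  by move: e; rewrite p0 scale0r add0r => /bc [-> ->].
have [d [x [y [z [s [hx hy hz hs hd]]]]]] := extend4_3 abc.
have na : (F a a a != 0) || (3 * F a a d != 0).
  apply/norP => -[]; rewrite !negbK mulf_eq0 pnatr_eq0 => /eqP e1 /eqP e2; apply: sa => w.
  by rewrite {1}[w]hd !(trilE hF) e1 e2 (trilC23 hF a a b) (trilC23 hF a a c) hab hac; ring.
pose pi v := row3 (s v) (y v) (z v).
have hpi p q q' : pi (p *: q + q') = p *: pi q + pi q' by exact: row3_lin.
pose G k u v w := F (lift3 d b c u) (lift3 d b c v) (lift3 d b c w)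
  - k * (u 0 ord0 * v 0 ord0 * w 0 ord0).
have hG k : trilin (G k).
  have [h1 h2 h3] := trilin_lift3 d b c.
  split=> [v w p u u'|u v w|u v w]; rewrite /G.
  - by rewrite h1 !mxE; ring.
  - by rewrite h2; ring.
  by rewrite h3; ring.
have EG v k : F v v v = (F a a a * x v ^+ 3 + 3 * F a a d * x v ^+ 2 * s v
    + 3 * F a d d * x v * s v ^+ 2 + (0 + k) * s v ^+ 3) + G k (pi v) (pi v) (pi v).
  rewrite {1 2 3}[v]hd (expand4 hF) /G /pi !lift3_row3 (expand3 hF) !mxE /=.
  rewrite (trilC23 hF a a b) (trilC23 hF a a c) !hab !hac.
  rewrite (trilC13 hF d d b) (trilC13 hF d d c) (trilC12 hF d b b) (trilC23 hF b d b).
  by rewrite (trilC12 hF d b c) (trilC23 hF b d c) (trilC12 hF d c c) (trilC23 hF c d c); ring.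
have gen := binary_cubes2_generic (3 * F a d d) 0 hx hs na.
have [k gk] := cofin_ex gen.
have fin6 k' : cubes 2 (fun v => F a a a * x v ^+ 3 + 3 * F a a d * x v ^+ 2 * s v
    + 3 * F a d d * x v * s v ^+ 2 + (0 + k') * s v ^+ 3) ->
    cubes 4 (fun v => G k' v v v) -> cubes 6 (fun v => F v v v).
  move=> g1 g2; apply: (cubes_ext (cubesD g1 (cubes_pull hpi g2))) => v.
  by rewrite (EG v k').
have [h|[l [m [p [hl hm hp e sp]]]]] := ternary_cubes4 (hG k); first exact: fin6 gk h.
have hs0 : linf (fun u : 'rV[C]_3 => u 0 ord0) by move=> q u v; rewrite !mxE.
have [a1 [b1 [c1 es]]] := sp _ hs0.
have [n0|] := boolP ((b1 != 0) || (c1 != 0)).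
  have [k' [gk' kk']] := cofin_ex (cofin_and gen (cofin_neq k)).
  apply: (fin6 k' gk'); have kk : k - k' != 0 by rewrite subr_eq0 eq_sym.
  apply: (cubes_ext (conic_tangent_perturbed hl hm hp hs0 es n0 kk)) => v.
  by rewrite -e /G; ring.
rewrite negb_or !negbK => /andP[/eqP b10 /eqP c10].
have hl' := linf_pull hpi hl; have hm' := linf_pull hpi hm; have hp' := linf_pull hpi hp.
have [L [hL eL]] : exists L : 'rV[C]_4 -> C, linf L /\ forall v, L v = l (pi v) by exists (fun v => l (pi v)).
have [M [hM eM]] : exists L : 'rV[C]_4 -> C, linf L /\ forall v, L v = m (pi v) by exists (fun v => m (pi v)).
have [P [hP eP]] : exists L : 'rV[C]_4 -> C, linf L /\ forall v, L v = p (pi v) by exists (fun v => p (pi v)).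
have [A [B [D E]]] : exists A B D, forall v, F v v v = (A * x v ^+ 3
    + B * x v ^+ 2 * (a1 * L v) + D * x v * (a1 * L v) ^+ 2 + k * (a1 * L v) ^+ 3)
    + (L v ^+ 2 * M v + L v * P v ^+ 2).
  exists (F a a a), (3 * F a a d), (3 * F a d d) => v.
  rewrite (EG v k) e eL eM eP; have -> : s v = a1 * l (pi v); last by ring.
  by have := es (pi v); rewrite mxE /= b10 c10 => ->; ring.
have [q q0 [q1 q2 q3]] : exists2 q, q != 0 & [/\ x q = 0, L q = 0 & P q = 0].
  pose f (i : 'I_3) := if i == ord0 then x else if i == lift ord0 ord0 then L else P.
  have [|q q0 hq] := @common_zero C 4 3 f _ isT.
    by move=> i; rewrite /f; case: ifP => // _; case: ifP.
  by exists q => //; have := hq ord0; have := hq (lift ord0 ord0);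
    have := hq (lift ord0 (lift ord0 ord0)).
have [T [hT Tq]] := nonzero_functional q0.
have [r r0 [r1 r2]] : exists2 r, r != 0 & L r = 0 /\ T r = 0.
  pose f (i : 'I_2) := if i == ord0 then L else T.
  have [|r r0 hr] := @common_zero C 4 2 f _ isT; first by move=> i; rewrite /f; case: ifP.
  by exists r => //; have := hr ord0; have := hr (lift ord0 ord0).
have [||K eK] := hns q r q0.
- move=> w; rewrite (polar_sq hF) !E (linfB _ _ hx) (linfB _ _ hL) (linfB _ _ hM) (linfB _ _ hP).
  by rewrite (linfD _ _ hx) (linfD _ _ hL) (linfD _ _ hM) (linfD _ _ hP) q1 q2 q3; field.
- move=> w; rewrite (polarize hF) !E.
  rewrite !(linfD _ _ hx) !(linfD _ _ hL) !(linfD _ _ hM) !(linfD _ _ hP).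
  by rewrite q1 q2 q3 r1; field.
have := r2; rewrite eK (linfZ _ _ hT) => /eqP; rewrite mulf_eq0 (negPf Tq) orbF => /eqP K0.
by rewrite eK K0 scale0r eqxx in r0.
Qed.

(** Either a singular vector has a second kernel vector, or none has, and then [a] itself
is not singular: it would be the only vector in its kernel up to a factor. *)
Lemma corank2_cubes6 : finite_sing F ->
  (exists a b c, [/\ a != 0, prop_free b c, forall w, F a b w = 0 & forall w, F a c w = 0]) ->
  cubes 6 (fun v => F v v v).
Proof.
move=> fs [a [b [c [a0 bc hab hac]]]].
have [[p [q [p0 sp pq ne]]]|hn] := boolp.pselect (exists p q, [/\ p != 0, sing F p,
    forall w, F p q w = 0 & forall k, q != k *: p]).
  exact: (sing_corank2_cubes6 fs (prop_freeP p0 ne) sp pq).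
have hns p q : p != 0 -> sing F p -> (forall w, F p q w = 0) -> exists k, q = k *: p.
  move=> p0 sp pq; apply: boolp.contrapT => ne; apply: hn; exists p, q; split=> // k.
  by apply/eqP => e; apply: ne; exists k.
have [sa|sa] := boolp.pselect (sing F a); last exact: smooth_corank2_cubes6 hns sa bc hab hac.
have [k1 e1] := hns _ _ a0 sa hab; have [k2 e2] := hns _ _ a0 sa hac.
have [|h1 h2] := bc k2 (- k1).
  by rewrite e1 e2 !scalerA mulNr scaleNr mulrC addrN.
have c0 : c = 0 by rewrite e2 h1 scale0r.
have [|_ /eqP] := bc 0 1; first by rewrite c0 scaler0 scale0r addr0.
by rewrite oner_eq0.
Qed.

End Corank2.

(** * Separating the roots of a family of polynomials *)
Section FirstOrder.
Variable C : numClosedFieldType.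
Implicit Types (P Q A B : {poly {poly C}}) (p q : {poly C}).

(** A polynomial over [{poly C}] is a family depending on a parameter; [at0] and [at1] are
its first two Taylor coefficients in the parameter. *)
Definition at0 P : {poly C} := map_poly (horner_eval 0) P.
Definition at1 P : {poly C} := map_poly (coefp 1) P.

Lemma at0E P i : (at0 P)`_i = P`_i`_0.
Proof. by rewrite coef_map /= /horner_eval horner_coef0. Qed.
Lemma at1E P i : (at1 P)`_i = P`_i`_1.
Proof. by rewrite coef_map. Qed.

Lemma at0M P Q : at0 (P * Q) = at0 P * at0 Q.
Proof. by rewrite /at0 rmorphM. Qed.

Lemma at1M P Q : at1 (P * Q) = at0 P * at1 Q + at1 P * at0 Q.
Proof.
apply/polyP => i; rewrite at1E coefD !coefM coef_sum -big_split; apply: eq_bigr => j _ /=.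
by rewrite !at0E !at1E coefM !big_ord_recr big_ord0 /= add0r.
Qed.

Lemma at1_deriv P : at1 P^`() = (at1 P)^`().
Proof. by apply/polyP => i; rewrite at1E !coef_deriv at1E coefMn. Qed.

Lemma at0_deriv P : at0 P^`() = (at0 P)^`().
Proof. by rewrite /at0 deriv_map. Qed.

Lemma at0_eq0 P : at0 P = 0 -> exists Q, P = 'X%:P * Q.
Proof.
move=> h; exists (map_poly (fun p : {poly C} => drop_poly 1 p) P).
have d0 : drop_poly 1 (0 : {poly C}) = 0 by apply/polyP => j; rewrite coef_drop_poly !coef0.
apply/polyP => i; rewrite coefCM coef_map_id0 //.
have h0 : P`_i`_0 = 0 by rewrite -at0E h coef0.
apply/polyP => -[|j]; rewrite coefXM /=; first exact: h0.
by rewrite coef_drop_poly addn1.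
Qed.

(** A relation [A P = B P'] with [B] of degree below that of [P] has a first
order expansion in the parameter. At a root of [P] where [B] vanishes to lower
order than [P], it contradicts that the parameter moves the root at first
order. *)
Lemma no_common_relation P A B : P \is monic -> B != 0 -> (size B < size P)%N ->
  (forall x, root (at0 P) x -> root (at0 P)^`() x -> (at1 P).[x] != 0) ->
  A * P = B * P^`() -> False.
Proof.
move=> mP; have sP : size (at0 P) = size P.
  by rewrite size_map_poly_id0 // (eqP mP) /horner_eval hornerC oner_eq0.
have m0 : at0 P \is monic by rewrite monicE lead_coef_map_id0 ?(eqP mP) /horner_eval ?hornerC ?oner_eq0 ?horner0.
have [k] := ubnP (size (lead_coef B)); elim: k A B => // k IH A B lk B0 sB hx e.
have [b0|b0] := eqVneq (at0 B) 0.
  have [B1 eB] := at0_eq0 b0.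
  have a0 : at0 A = 0.
    have := congr1 at0 e; rewrite !at0M b0 mul0r => /eqP.
    by rewrite mulf_eq0 (negPf (monic_neq0 m0)) orbF => /eqP.
  have [A1 eA] := at0_eq0 a0.
  have X0 : 'X%:P != 0 :> {poly {poly C}} by rewrite polyC_eq0 polyX_eq0.
  have B10 : B1 != 0 by apply: contraNneq B0 => z; rewrite eB z mulr0.
  apply: (IH A1 B1) => //.
  - rewrite -ltnS; apply: leq_trans lk; rewrite eB lead_coefM lead_coefC mulrC size_mulX ?lead_coef_eq0 //.
  - by rewrite (leq_trans _ sB) // ltnS eB mul_polyC size_scale ?polyX_eq0.
  by apply: (mulfI X0); rewrite !mulrA -eA -eB.
set p := at0 P in sP m0 hx *; set b := at0 B in b0 *.
have p0 : p != 0 by exact: monic_neq0.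
have sb : (size b < size p)%N by rewrite sP; apply: leq_ltn_trans sB; exact: size_poly.
have e0 : at0 A * p = b * p^`() by rewrite -at0_deriv -!at0M e.
have e1 : at0 A * at1 P + at1 A * p = b * (at1 P)^`() + at1 B * p^`().
  by rewrite -at1_deriv -[p^`()]at0_deriv -!at1M e.
have [x [m [q [j [c [qx cx ep eb jm]]]]]] : exists x m q j c,
    [/\ ~~ root q x, ~~ root c x, p = q * ('X - x%:P) ^+ m, b = c * ('X - x%:P) ^+ j & (j < m)%N].
  have [g eg] : exists g, p = g * gcdp p b.
    by have /dvdpP [g eg] := dvdp_gcdl p b; exists g.
  have g0 : g != 0 by apply: contraNneq p0 => z; rewrite eg z mul0r.
  have sg : size g != 1%N.
    apply: contraTneq sb => /eqP /size_poly1P [z z0 ez]; rewrite -leqNgt.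
    apply: dvdp_leq => //; rewrite eg ez mul_polyC dvdpZl //; exact: dvdp_gcdr.
  have [x xg] := closed_rootP _ sg.
  have [m [q]] := multiplicity_XsubC p x; rewrite p0 /= => qx ep.
  have [j [c]] := multiplicity_XsubC b x; rewrite b0 /= => cx eb.
  exists x, m, q, j, c; split=> //; rewrite ltnNge; apply/negP => mj.
  have /dvdpP [h eh] : ('X - x%:P) ^+ m %| gcdp p b.
    by rewrite dvdp_gcd ep eb dvdp_mulIr dvdp_mull // dvdp_exp2l.
  have /factor_theorem [g' eg'] := xg.
  case/negP: qx; apply/factor_theorem; exists (g' * h).
  have X0 : ('X - x%:P) ^+ m != 0 by rewrite expf_neq0 // polyXsubC_eq0.
  by apply: (mulIf X0); rewrite -ep eg eh eg'; ring.
have X0 i : ('X - x%:P) ^+ i != 0 :> {poly C} by rewrite expf_neq0 // polyXsubC_eq0.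
have m0' : (0 < m)%N by apply: leq_ltn_trans jm.
case: m m0' jm ep => // m _ jm ep.
have dp : p^`() = ('X - x%:P) ^+ m * (q^`() * ('X - x%:P) + q *+ m.+1).
  rewrite ep derivM deriv_exp derivXsubC mul1r /=.
  by rewrite exprSr mulrnAr; ring.
have kp : (q^`() * ('X - x%:P) + q *+ m.+1).[x] != 0.
  rewrite hornerD hornerM hornerXsubC subrr mulr0 add0r hornerMn mulrn_eq0 /=.
  by rewrite -rootE.
have px : root p x by rewrite ep rootM root_exp_XsubC eqxx orbT.
(* [b] vanishes at [x], since [p] has one root less than [p^`()] there *)
have j0 : (0 < j)%N.
  rewrite lt0n; apply: contraNneq kp => z.
  move: e0; rewrite dp ep eb z expr0 mulr1 exprSr => e0.
  have e2 : at0 A * (q * ('X - x%:P)) = c * (q^`() * ('X - x%:P) + q *+ m.+1).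
    by apply: (mulIf (X0 m)); rewrite -[RHS]mulrA [X in c * X]mulrC -e0; ring.
  have := congr1 (horner^~ x) e2; rewrite /= !hornerM hornerXsubC subrr !mulr0.
  by move/esym/eqP; rewrite mulf_eq0 => /orP[] // /eqP /rootP; rewrite (negPf cx).
case: j j0 jm eb => // j _ jm eb.
have dpx : root p^`() x.
  have mp : (0 < m)%N by apply: leq_ltn_trans (leq0n j) _; rewrite -ltnS.
  by rewrite dp rootM -(prednK mp) root_exp_XsubC eqxx.
have ea : at0 A * q * ('X - x%:P) = c * ('X - x%:P) ^+ j.+1 * (q^`() * ('X - x%:P) + q *+ m.+1).
  apply: (mulIf (X0 m)); move: e0; rewrite dp ep eb => e0.
  via (at0 A * (q * ('X - x%:P) ^+ m.+1)); first by rewrite [in RHS]exprS; ring.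
  by rewrite e0; ring.
have {}ea : at0 A * q = c * ('X - x%:P) ^+ j * (q^`() * ('X - x%:P) + q *+ m.+1).
  by apply: (mulIf (X0 1%N)); rewrite expr1 ea exprS; ring.
have [a ax] : exists a, at0 A = a * ('X - x%:P) ^+ j.
  have : ('X - x%:P) ^+ j %| at0 A * q by rewrite ea -mulrA dvdp_mull // dvdp_mulIl.
  rewrite Gauss_dvdpl; first by move/dvdpP.
  by rewrite coprimep_sym; apply: coprimep_expr; rewrite coprimep_XsubC.
have ax0 : a.[x] != 0.
  have e2 : a * q = c * (q^`() * ('X - x%:P) + q *+ m.+1).
    by apply: (mulIf (X0 j)); rewrite -[LHS]mulrA [q * _]mulrC mulrA -ax ea; ring.
  have := congr1 (horner^~ x) e2; rewrite /= [LHS]hornerM [RHS]hornerM => e3.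
  apply: contraTneq isT => z; move/esym/eqP: e3; rewrite z mul0r mulf_eq0 (negPf kp) orbF.
  by move=> /eqP /rootP; rewrite (negPf cx).
have e2 : a * at1 P = ('X - x%:P) * (c * (at1 P)^`())
    + ('X - x%:P) ^+ (m - j) * (at1 B * (q^`() * ('X - x%:P) + q *+ m.+1) - at1 A * q * ('X - x%:P)).
  have ym : ('X - x%:P) ^+ (m - j) * ('X - x%:P) ^+ j = ('X - x%:P) ^+ m :> {poly C}.
    by rewrite -exprD subnK // ltnW.
  apply: (mulIf (X0 j)).
  via (('X - x%:P) * (c * (at1 P)^`()) * ('X - x%:P) ^+ j + (('X - x%:P) ^+ (m - j)
    * ('X - x%:P) ^+ j) * (at1 B * (q^`() * ('X - x%:P) + q *+ m.+1) - at1 A * q * ('X - x%:P)));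
    last by ring.
  rewrite ym.
  have := e1; rewrite ax eb dp ep => e1'.
  have -> : a * at1 P * ('X - x%:P) ^+ j = (a * ('X - x%:P) ^+ j * at1 P
    + at1 A * (q * ('X - x%:P) ^+ m.+1)) - at1 A * (q * ('X - x%:P) ^+ m.+1) by ring.
  by rewrite e1' !exprS; ring.
have ex : ('X - x%:P).[x] = 0 by rewrite hornerXsubC subrr.
have := congr1 (horner^~ x) e2; rewrite /= hornerM hornerD.
rewrite [X in _ = X + _]hornerM [X in _ = _ + X]hornerM horner_exp ex mul0r add0r.
have jm' : (j < m)%N := jm.
rewrite expr0n subn_eq0 leqNgt jm' mul0r => /eqP.
by rewrite mulf_eq0 (negPf ax0) (negPf (hx _ px dpx)).
Qed.

(** If the parameter moves every multiple root of the central member at first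
order, then almost all members of the family have simple roots. *)
Lemma generic_separable P : P \is monic -> (2 < size P)%N ->
  (forall x, root (at0 P) x -> root (at0 P)^`() x -> (at1 P).[x] != 0) ->
  cofin (fun e => separable_poly (map_poly (horner_eval e) P)).
Proof.
move=> mP sP hx.
have s1 : (1 < size P^`())%N.
  have [n en] : exists n, size P = n.+3 by case: (size P) sP => [|[|[|n]]] // _; exists n.
  rewrite ltnNge; apply/negP => s1.
  have /eqP : P^`()`_n.+1 = 0 by apply: nth_default; apply: leq_trans s1 _.
  have lP : P`_n.+2 = 1 by have := eqP mP; rewrite lead_coefE en.
  by rewrite coef_deriv lP -polyC_natr polyC_eq0 pnatr_eq0.
have R0 : resultant P P^`() != 0.
  apply/negP => /eqP /eqP; rewrite resultant_eq0 => sg.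
  have /Pdiv.Idomain.dvdpP [[c1 q1] /= c10 e1] := dvdp_gcdl P P^`().
  have /Pdiv.Idomain.dvdpP [[c2 q2] /= c20 e2] := dvdp_gcdr P P^`().
  have P0 := monic_neq0 mP.
  have g0 : gcdp P P^`() != 0 by rewrite gcdp_eq0 negb_and P0.
  have q10 : q1 != 0.
    by apply: contraTneq P0 => z; move/eqP: e1; rewrite z mul0r -mul_polyC mulf_eq0 polyC_eq0 (negPf c10) => /eqP ->; rewrite eqxx.
  apply: (@no_common_relation P (c1 *: q2) (c2 *: q1) mP _ _ hx).
  - by rewrite -mul_polyC mulf_eq0 polyC_eq0 negb_or c20.
  - rewrite size_scale // -(size_scale P c10) e1 size_mul // -subn1 -addnBA ?(ltnW sg) //.
    by rewrite -[X in (X < _)%N]addn0 ltn_add2l subn_gt0.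
  rewrite -!mul_polyC in e1 e2 *; via (q2 * (c1%:P * P)); first by ring.
  by rewrite e1; via (q1 * (q2 * gcdp P P^`())); [ring | rewrite -e2; ring].
have [[u v] /= _ euv] := resultant_in_ideal (ltnW sP) s1.
apply: cofin_impl (cofin_poly R0) => e Re.
rewrite separable_poly.unlock; apply/Bezout_coprimepP.
exists (map_poly (horner_eval e) u, map_poly (horner_eval e) v) => /=.
rewrite deriv_map -!rmorphM -rmorphD /= -euv map_polyC /=.
by rewrite polyC_eqp1.
Qed.

End FirstOrder.

(** * Determinants near a symmetric matrix of corank one *)
Section Corank1.
Variable C : numClosedFieldType.

Section Fixed.
Variable n : nat.
Variables (M : 'M[C]_(1 + n)) (k : 'rV[C]_(1 + n)).
Hypotheses (symM : M^T = M) (k0 : k != 0) (kM : k *m M = 0)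
  (kerM : forall x : 'rV[C]_(1 + n), x *m M = 0 -> exists a, x = a *: k).

(** In a basis starting with the kernel vector, the first order term of the
determinant is the corner entry of the perturbation times the complementary
minor, which does not vanish. *)
Lemma det_first_order (N : 'M[C]_(1 + n)) : (k *m N *m k^T) 0 0 != 0 ->
  (\det (map_mx polyC M + 'X *: map_mx polyC N))`_1 != 0.
Proof.
move=> hN.
have [P [hP eP]] : exists P : 'M[C]_(1 + n), P \in unitmx /\ row 0 P = k.
  have [|e [x [fr he]]] := @extend_basis C (1 + n) 1 (fun _ => k).
    move=> c; rewrite big_ord1 => /eqP; rewrite scaler_eq0 (negPf k0) orbF => /eqP h i.
    by rewrite ord1.
  exists (\matrix_i e i); split; last by rewrite rowK (he 0 0 erefl).
  rewrite -row_free_unit; apply: inj_row_free => v; rewrite mulmx_sum_row.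
  under eq_bigr => i _ do rewrite rowK.
  case: fr => hx _ hd h; apply/rowP => i; rewrite mxE.
  have := congr1 (x i) h; rewrite (linf0 (hx i)) => <-.
  have -> : forall r : seq 'I_(1 + n), x i (\sum_(j <- r) v 0 j *: e j) =
      \sum_(j <- r) v 0 j * (i == j)%:R.
    elim=> [|j r IH]; first by rewrite !big_nil (linf0 (hx i)).
    by rewrite !big_cons hx IH hd.
  rewrite (bigD1 i) //= eqxx mulr1 big1 ?addr0 // => j ji.
  by rewrite eq_sym (negPf ji) mulr0.
pose M' := P *m M *m P^T; pose N' := P *m N *m P^T.
have l0 (i : 'I_1) : lshift n i = 0 :> 'I_(1 + n) by apply: val_inj; rewrite (ord1 i).
have M0j j : M' 0 j = 0.
  have : row 0 M' = 0 by rewrite /M' -mulmxA row_mul eP mulmxA kM mul0mx.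
  by move/rowP/(_ j); rewrite !mxE.
have sM' : M'^T = M' by rewrite /M' !trmx_mul trmxK symM mulmxA.
have Mi0 i : M' i 0 = 0 by rewrite -sM' mxE.
have uM : usubmx M' = 0 by apply/matrixP => i j; rewrite [LHS]mxE l0 M0j [RHS]mxE.
have dlM : lsubmx (dsubmx M') = 0.
  by apply/matrixP => i j; rewrite 2![LHS]mxE l0 Mi0 [RHS]mxE.
have uP : P^T \in unitmx by rewrite unitmx_tr.
have hdr : drsubmx M' \in unitmx.
  rewrite -row_free_unit; apply: inj_row_free => y hy.
  have hx : row_mx 0 y *m M' = 0.
    rewrite -[M']vsubmxK uM mul_row_col mul0mx add0r -[dsubmx M']hsubmxK mul_mx_row.
    by rewrite -/(drsubmx M') hy dlM mulmx0 row_mx0.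
  have hx2 : row_mx 0 y *m P *m M = 0.
    have e : row_mx 0 y *m P *m M *m P^T = row_mx 0 y *m M' by rewrite /M' !mulmxA.
    by rewrite -[LHS](mulmxK uP) e hx mul0mx.
  have [a ea] := kerM hx2.
  have e2 : row_mx 0 y = a *: delta_mx 0 (lshift n 0) :> 'rV[C]_(1 + n).
    apply: (can_inj (mulmxK hP)); rewrite ea -scalemxAl -rowE -eP; congr (_ *: row _ _).
    exact: val_inj.
  apply/rowP => j; have := congr1 (fun A : 'rV_(1 + n) => A 0 (rshift 1 j)) e2.
  by rewrite row_mxEr !mxE eqxx /= => ->; rewrite mulr0.
pose f := map_mx (polyC : C -> {poly C}).
pose W := f _ _ M' + 'X *: f _ _ N'.
have dW : \det W = (\det P)%:P * \det (f _ _ M + 'X *: f _ _ N) * (\det P)%:P.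
  have -> : W = f _ _ P *m (f _ _ M + 'X *: f _ _ N) *m f _ _ P^T.
    by rewrite mulmxDr mulmxDl -scalemxAr -scalemxAl /W /f /M' /N' !map_mxM.
  by rewrite !det_mulmx /f !det_map_mx det_tr.
have N00 : N' 0 0 = (k *m N *m k^T) 0 0.
  have -> : k *m N *m k^T = row 0 (P *m N) *m (row 0 P)^T by rewrite row_mul eP.
  by rewrite /N' !mxE; apply: eq_bigr => j _; rewrite !mxE.
clearbody M' N'.
pose K : 'M[{poly C}]_(1 + n) := col_mx (usubmx (f _ _ N')) (dsubmx W).
have eW : W = block_mx 'X%:M 0 0 1%:M *m K.
  rewrite /K -[LHS]vsubmxK -[dsubmx W in RHS]/(dsubmx W) mul_block_col !mul0mx addr0 add0r mul1mx mul_scalar_mx.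
  congr col_mx; apply/matrixP => i j; rewrite !mxE.
  by rewrite l0 M0j polyC0 add0r.
have dK : (\det K).[0] = (\det (drsubmx M')) * N' 0 0.
  rewrite -[LHS]/(horner_eval 0 (\det K)) -det_map_mx.
  have -> : map_mx (horner_eval 0) K = block_mx (ulsubmx N') (ursubmx N') 0 (drsubmx M').
    rewrite /K map_col_mx /block_mx; congr col_mx.
      rewrite -[row_mx _ _]/(row_mx (lsubmx (usubmx N')) (rsubmx (usubmx N'))) hsubmxK.
      by apply/matrixP => i j; rewrite !mxE /horner_eval hornerC.
    rewrite -dlM -[drsubmx M']/(rsubmx (dsubmx M')) hsubmxK.
    by apply/matrixP => i j; rewrite !mxE /horner_eval hornerD hornerM hornerX mul0r addr0 hornerC.
  rewrite det_ublock mulrC; congr (_ * _); rewrite {1}[ulsubmx N']mx11_scalar det_scalar1.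
  by rewrite 2![LHS]mxE !l0.
have d1 : (\det W)`_1 != 0.
  rewrite eW det_mulmx det_ublock det_scalar1 det1 mulr1 coefXM /= -horner_coef0 dK mulf_neq0 ?N00 //.
  by rewrite -unitfE -unitmxE.
by apply: contraNneq d1 => e; rewrite dW -mulrA coefCM coefMC e mul0r mulr0.
Qed.

(** The rows of the adjugate are in the kernel, and so are its columns by symmetry. The
adjugate is not zero, for otherwise the determinant would have no first order term in
any direction, contrary to [det_first_order]. *)
Lemma adj_corank1 : exists2 c, c != 0 & \adj M = c *: (k^T *m k).
Proof.
have dM : \det M = 0.
  apply/eqP; apply: contraNT k0; rewrite -unitfE -unitmxE => uM.
  by rewrite -[k](mulmxK uM) kM mul0mx.
have sA : (\adj M)^T = \adj M by rewrite trmx_adj symM.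
have rA i : exists a, row i (\adj M) = a *: k.
  by apply: kerM; rewrite -row_mul mul_adj_mx dM; apply/rowP => j; rewrite !mxE mul0rn.
have [a ha] := fin_all_exists rA.
have A i j : \adj M i j = a i * k 0 j.
  by have := congr1 (fun v : 'rV_(1 + n) => v 0 j) (ha i); rewrite !mxE.
have [i0 ki0] := nonzero_coord k0.
have ea j : a j = a i0 / k 0 i0 * k 0 j.
  apply: (mulIf ki0); rewrite -A -sA mxE A; field; exact: ki0.
have eA : \adj M = (a i0 / k 0 i0) *: (k^T *m k).
  by apply/matrixP => i j; rewrite A ea !mxE big_ord1 !mxE mulrA.
exists (a i0 / k 0 i0) => //; apply/eqP => z.
pose N : 'M[C]_(1 + n) := delta_mx i0 i0.
have hN : (k *m N *m k^T) 0 0 != 0.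
  have -> : (k *m N *m k^T) 0 0 = k 0 i0 * k 0 i0; last by rewrite mulf_neq0.
  rewrite mxE (bigD1 i0) //= big1 ?addr0.
    rewrite !mxE (bigD1 i0) //= big1 ?addr0; first by rewrite !mxE !eqxx mulr1.
    by move=> j ji; rewrite !mxE (negPf ji) mulr0.
  move=> j ji; rewrite !mxE big1 ?mul0r // => t _.
  by rewrite !mxE (negPf ji) andbF mulr0.
have := det_first_order hN; set W := _ + _ => /eqP; apply.
pose B := \adj W; have e : W *m B = (\det W)%:M by exact: mul_mx_adj.
have c1 : (\det W)`_1 = ((W *m B) i0 i0)`_1 by rewrite e mxE eqxx mulr1n.
have B0 i j : (B i j)`_0 = 0.
  have : map_mx (horner_eval 0) B = \adj M.
    rewrite /B map_mx_adj; congr (\adj _); apply/matrixP => p q.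
    by rewrite mxE /W !mxE /= /horner_eval hornerD hornerM hornerX mul0r addr0 hornerC.
  move/matrixP/(_ i j); rewrite eA z scale0r !mxE /horner_eval horner_coef0 => ->.
  by [].
have c2 : (W *m B) = map_mx polyC M *m B + 'X *: (map_mx polyC N *m B).
  by rewrite mulmxDl scalemxAl.
clearbody B; clearbody W.
(* multiplying by the kernel vector kills the unknown first order part of the
   adjugate *)
have : k *m map_mx (coefp 1) (W *m B) = 0.
  rewrite c2; apply/rowP => j; rewrite !mxE.
  via (\sum_i k 0 i * (\sum_t M i t * (B t j)`_1)).
    apply: eq_bigr => i _; congr (_ * _); rewrite !mxE /= coefD coefXM /= !coef_sum.
    rewrite [X in _ + X]big1 ?addr0; last by move=> t _; rewrite !mxE coefCM B0 mulr0.
    by apply: eq_bigr => t _; rewrite !mxE coefCM.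
  via ((k *m M *m map_mx (coefp 1) B) 0 j); last by rewrite kM mul0mx mxE.
  rewrite -mulmxA mxE; apply: eq_bigr => i _; congr (_ * _); rewrite mxE.
  by apply: eq_bigr => t _; rewrite [map_mx _ B t j]mxE.
rewrite e; move/rowP/(_ i0); rewrite !mxE (bigD1 i0) //= big1 ?addr0.
  by rewrite !mxE eqxx mulr1n /= => /eqP; rewrite mulf_eq0 (negPf ki0) => /eqP.
by move=> j ji; rewrite !mxE (negPf ji) mulr0n coef0 mulr0.
Qed.

End Fixed.
End Corank1.

(** * Generic vectors and cyclic pencils *)
Section Avoid.
Variable C : numClosedFieldType.

Lemma cofin_polyval (Q : C -> C) (P : {poly C}) e0 :
  (forall e, Q e = P.[e]) -> Q e0 != 0 -> cofin (fun e => Q e != 0).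
Proof.
move=> h h0; exists P; last by move=> k; rewrite h.
by apply: contraNneq h0 => z; rewrite h z horner0.
Qed.

Lemma cofin_seq (T : eqType) (s : seq T) (Q : T -> C -> Prop) :
  (forall x, x \in s -> cofin (Q x)) -> cofin (fun e => forall x, x \in s -> Q x e).
Proof.
elim: s => [|x s IH] h; first by exists 1; rewrite ?oner_eq0.
have h1 : cofin (Q x) by apply: h; rewrite mem_head.
have h2 := IH (fun y ys => h y (@mem_behead T (x :: s) y ys)).
apply: cofin_impl (cofin_and h1 h2) => k [a b] y; rewrite inE => /orP[/eqP ->|] //.
exact: b.
Qed.

Lemma cofin_affine (a b : C) : (a != 0) || (b != 0) -> cofin (fun e => a + e * b != 0).
Proof.
move=> h; apply: cofin_impl (@cofin_quad _ 0 b a _); last by rewrite eqxx /= orbC h.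
by move=> k; rewrite mul0r add0r addrC mulrC.
Qed.

Lemma avoid_functionals n (T : eqType) (s : seq T) (l : T -> 'rV[C]_n -> C) :
  (forall x, linf (l x)) -> (forall x, x \in s -> exists t, l x t != 0) ->
  exists u, forall x, x \in s -> l x u != 0.
Proof.
move=> hl; elim: s => [|x s IH] h; first by exists 0.
have [t ht] := h x (mem_head _ _).
have [u hu] := IH (fun y ys => h y (@mem_behead T (x :: s) y ys)).
have [e he] : exists e, forall y, y \in x :: s -> l y u + e * l y t != 0.
  apply: cofin_ex; apply: cofin_seq => y; rewrite inE => /orP[/eqP ->|ys].
    by apply: cofin_affine; rewrite ht orbT.
  by apply: cofin_affine; rewrite hu.
exists (e *: t + u) => y ys; rewrite hl addrC; exact: he.
Qed.

Lemma det_line n (A B : 'M[C]_n) e :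
  \det (A + e *: B) = (\det (map_mx polyC A + 'X *: map_mx polyC B)).[e].
Proof.
rewrite -[RHS]/(horner_eval e _) -det_map_mx; congr (\det _).
by apply/matrixP => i j; rewrite !mxE /= /horner_eval hornerD hornerM hornerX !hornerC.
Qed.

Lemma functional_vanishing (v p : 'rV[C]_4) : exists l : 'rV[C]_4 -> C,
  [/\ linf l, l v = 0, l p = 0 & exists t, l t != 0].
Proof.
pose g (i : 'I_2) (c : 'rV[C]_4) := ((if i == ord0 then v else p) *m c^T) 0 0.
have [|c c0 hc] := @common_zero C 4 2 g _ isT.
  by move=> i a x y; rewrite /g linearD linearZ /= mulmxDr -scalemxAr !mxE.
exists (fun x => (x *m c^T) 0 0); split.
- by move=> a x y; rewrite mulmxDl -scalemxAl !mxE.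
- exact: (hc ord0).
- exact: (hc (lift ord0 ord0)).
have [i hi] := nonzero_coord c0.
by exists (delta_mx 0 i); rewrite -rowE !mxE.
Qed.

Lemma dual_pair n (L1 L2 : 'rV[C]_n -> C) : linf L1 -> linf L2 ->
  (forall a b, (forall u, a * L1 u + b * L2 u = 0) -> a = 0 /\ b = 0) ->
  exists2 e, L1 e = 1 & L2 e = 0.
Proof.
move=> h1 h2 ind.
have [[e [e1 e2]]|hn] := boolp.pselect (exists e, L1 e != 0 /\ L2 e = 0).
  exists ((L1 e)^-1 *: e); rewrite linfZ //; first by rewrite mulVf.
  by rewrite e2 mulr0.
have [e' he'] : exists e', L2 e' != 0.
  apply: boolp.contrapT => hn2; have [u|_ /eqP] := ind 0 1; last by rewrite oner_eq0.
  rewrite mul0r add0r mul1r; apply/eqP; apply: boolp.contrapT => z; apply: hn2.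
  by exists u; apply/negP.
have [u|/eqP] := ind 1 (- (L1 e' / L2 e')); last by rewrite oner_eq0.
have : L1 (u - (L2 u / L2 e') *: e') = 0.
  apply/eqP; apply: boolp.contrapT => z; apply: hn.
  exists (u - (L2 u / L2 e') *: e'); split; first exact/negP.
  by rewrite linfB // linfZ // mulfVK // subrr.
by rewrite linfB // linfZ // => /eqP; rewrite subr_eq0 => /eqP ->; field.
Qed.

(** Unique factorization for products of two linear forms. *)
Lemma linear_factor n (L1 L2 M1 M2 : 'rV[C]_n -> C) :
  linf L1 -> linf L2 -> linf M1 -> linf M2 ->
  (forall a b, (forall u, a * L1 u + b * L2 u = 0) -> a = 0 /\ b = 0) ->
  (forall u, L1 u * M2 u = L2 u * M1 u) ->
  exists c, forall u, M1 u = c * L1 u /\ M2 u = c * L2 u.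
Proof.
move=> h1 h2 k1 k2 ind e.
have [e1 a1 b1] := dual_pair h1 h2 ind.
have [e2 a2 b2] : exists2 e, L2 e = 1 & L1 e = 0.
  apply: dual_pair => // a b h; have [u|? ?] := ind b a; last by split.
  by rewrite addrC h.
have m21 : M2 e1 = 0 by have := e e1; rewrite a1 b1 mul1r mul0r.
have m12 : M1 e2 = 0 by have := e e2; rewrite a2 b2 mul1r mul0r.
have m22 : M2 e2 = M1 e1.
  have := e (e1 + e2); rewrite !linfD // a1 a2 b1 b2 m21 m12 add0r addr0.
  by rewrite !mul1r addr0 !add0r mul1r.
have ker w : L1 w = 0 -> L2 w = 0 -> M1 w = 0 /\ M2 w = 0.
  move=> w1 w2; have := e (e1 + w); have := e (e2 + w).
  rewrite !linfD // a1 a2 b1 b2 w1 w2 m21 m12 !addr0 !mul0r !mul1r !add0r.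
  by move=> <- ->.
exists (M1 e1) => u; pose w := u - (L1 u *: e1 + L2 u *: e2).
have [||w1 w2] := ker w.
- by rewrite /w linfB // linfD // !linfZ // a1 b2; ring.
- by rewrite /w linfB // linfD // !linfZ // b1 a2; ring.
move: w1 w2; rewrite /w !linfB // !linfD // !linfZ // m21 m12 m22.
move=> /eqP; rewrite subr_eq0 => /eqP -> /eqP; rewrite subr_eq0 => /eqP ->.
by split; ring.
Qed.

(** If [H] and [H'] are the polar quadrics of [v] and [v'], then [v' *m H = v *m H'], and the
rows are the Krylov sequence of [v *m H] under multiplication by [H^-1 *m H'], with
[\adj H] in place of the last inverse so that [H] may be singular. *)
Definition krylov_det (R : comNzRingType) (H H' : 'M[R]_4) (v v' : 'rV[R]_4) : R :=
  \det (\matrix_(i < 4) (if i == ord0 then v *m H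
     else if i == lift ord0 ord0 then v' *m H
     else if i == lift ord0 (lift ord0 ord0) then v' *m H'
     else v' *m H' *m \adj H *m H')).

Lemma map_krylov_det (R S : comNzRingType) (f : {rmorphism R -> S}) H H' v v' :
  f (krylov_det H H' v v') =
  krylov_det (map_mx f H) (map_mx f H') (map_mx f v) (map_mx f v').
Proof.
rewrite /krylov_det -det_map_mx; congr (\det _); apply/row_matrixP => i.
rewrite -map_row !rowK; do !case: ifP => _; by rewrite ?map_mxM ?map_mx_adj.
Qed.

Lemma cofin_krylov (H0 H1 K0 K1 : 'M[C]_4) (v0 v1 w0 w1 : 'rV[C]_4) e0 :
  krylov_det (H0 + e0 *: H1) (K0 + e0 *: K1) (v0 + e0 *: v1) (w0 + e0 *: w1) != 0 ->
  cofin (fun e => krylov_det (H0 + e *: H1) (K0 + e *: K1) (v0 + e *: v1) (w0 + e *: w1) != 0).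
Proof.
pose L m n (A B : 'M[C]_(m, n)) := map_mx polyC A + 'X *: map_mx polyC B.
apply: (@cofin_polyval _ (krylov_det (L _ _ H0 H1) (L _ _ K0 K1) (L _ _ v0 v1) (L _ _ w0 w1))).
move=> e; rewrite -[RHS]/(horner_eval e _) map_krylov_det.
have E m n (A B : 'M[C]_(m, n)) : map_mx (horner_eval e) (L _ _ A B) = A + e *: B.
  by apply/matrixP => i j; rewrite !mxE /= /horner_eval hornerD hornerM hornerX !hornerC.
by rewrite !E.
Qed.
End Avoid.

(** * A good line *)
Section GoodLine.
Variables (C : numClosedFieldType) (F : 'rV[C]_4 -> 'rV[C]_4 -> 'rV[C]_4 -> C).
Hypothesis hF : trilin F.
Hypothesis kerF : forall a b c, a != 0 -> (forall w, F a b w = 0) ->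
  (forall w, F a c w = 0) -> ~ prop_free b c.

Local Notation H := (hess F).

Lemma corank1_kernel a k x : a != 0 -> k != 0 -> (forall w, F a k w = 0) ->
  (forall w, F a x w = 0) -> exists t, x = t *: k.
Proof.
move=> a0 k0 ak ax; apply: boolp.contrapT => hn; apply: (kerF a0 ak ax).
by apply: prop_freeP => // t; apply/eqP => e; apply: hn; exists t.
Qed.

Lemma corank1_kernel_mx a k : a != 0 -> k != 0 -> (forall w, F a k w = 0) ->
  forall x : 'rV[C]_4, x *m H a = 0 -> exists t, x = t *: k.
Proof. by move=> a0 k0 ak x /(hess_ker hF) ax; apply: corank1_kernel ak ax. Qed.

Lemma hessN v : H (- v) = - H v.
Proof. by rewrite -scaleN1r -[LHS]addr0 -[_ *: v]addr0 (hess_lin hF) scaleN1r /hess; apply/matrixP => i j; rewrite !mxE (tril01 hF) !addr0. Qed.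

Lemma hess_entry v k w : (k *m H v *m w^T) 0 0 = F v k w.
Proof. by rewrite -(hessE hF). Qed.

(** Otherwise [k] would be singular with itself in its kernel; but [a] is in this kernel
too, so it would be a multiple of [k], hence singular. *)
Lemma smooth_kernel a k : a != 0 -> ~ sing F a -> k != 0 -> (forall w, F a k w = 0) ->
  exists t, F t k k != 0.
Proof.
move=> a0 sa k0 ak; apply: boolp.contrapT => hn.
have sk : forall w, F k k w = 0.
  move=> w; rewrite (trilC13 hF); apply/eqP; apply: boolp.contrapT => z; apply: hn.
  by exists w; apply/negP.
have ka w : F k a w = 0 by rewrite (trilC12 hF).
have [t et] := corank1_kernel k0 k0 sk ka.
by apply: sa => w; rewrite {2}et (trilE hF) ak mulr0.
Qed.

(** Moving the base point of the line splits the multiple roots of the Hessian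
determinant restricted to it: if [p] is not singular and its polar quadric has the
kernel vector [k], the Hessian determinant has differential [F _ k k] at [p] up to a
factor, and this differential is not zero. *)
Lemma generic_line v0 v1 : H v0 \in unitmx -> (forall t, ~ sing F (v1 - t *: v0)) ->
  exists u, cofin (fun e =>
    separable_poly (char_poly (H (v1 + e *: u) *m invmx (H v0)))).
Proof.
move=> u0 ns; pose A0 := H v0; pose A1 := H v1.
have n0 t : v1 - t *: v0 != 0.
  by apply/eqP => e; apply: (ns t) => w; rewrite e (tril01 hF).
pose p := char_poly (A1 *m invmx A0).
have kex x : exists k : 'rV[C]_4, root p x -> k != 0 /\ forall w, F (v1 - x *: v0) k w = 0.
  have [rx|rx] := boolP (root p x); last by exists 0.
  move: rx; rewrite -eigenvalue_root_char => /eigenvalueP [k hk k0].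
  exists k => _; split=> //; apply/(hess_ker hF).
  rewrite addrC -scaleNr (hess_lin hF) mulmxDr -scalemxAr.
  have -> : k *m H v1 = x *: (k *m H v0).
    by move/(congr1 (mulmx^~ A0)): hk; rewrite -mulmxA mulmxKV // -scalemxAl.
  by rewrite scaleNr addNr.
have [K hK] := boolp.choice kex.
have [r er] := closed_field_poly_normal p.
have p0 : p \is monic by exact: char_poly_monic.
have rp x : root p x -> x \in r.
  by rewrite er (eqP p0) scale1r root_prod_XsubC.
have rp' x : x \in r -> root p x.
  by rewrite er (eqP p0) scale1r root_prod_XsubC.
have [|x xr|u hu] := @avoid_functionals C 4 _ r (fun x t => F t (K x) (K x)).
- by move=> x; exact: tril1.
- by have [k0 hk] := hK _ (rp' _ xr); apply: smooth_kernel (n0 x) (ns x) k0 hk.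
exists u; pose A2 := H u.
pose B1 := A1 *m invmx A0; pose B2 := A2 *m invmx A0.
pose Be := map_mx polyC B1 + 'X *: map_mx polyC B2.
have evB e : map_mx (horner_eval e) Be = H (v1 + e *: u) *m invmx A0.
  rewrite addrC (hess_lin hF) mulmxDl -scalemxAl addrC.
  by apply/matrixP => i j; rewrite !mxE /= /horner_eval hornerD hornerM hornerX !hornerC.
have B0 : map_mx (horner_eval 0) Be = B1 by rewrite evB scale0r addr0.
have h0 : at0 (char_poly Be) = p by rewrite /at0 map_char_poly B0.
apply: cofin_impl (@generic_separable _ (char_poly Be) (char_poly_monic _) _ _).
- by move=> e; rewrite map_char_poly evB.
- by rewrite size_char_poly.
move=> x; rewrite h0 => rx _; have [k0 hk] := hK _ rx; set k := K x in k0 hk.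
have -> : (at1 (char_poly Be)).[x] = ((char_poly Be).[x%:P])`_1.
  rewrite !horner_coef coef_sum; rewrite (big_ord_widen _ (fun i => (at1 (char_poly Be))`_i * x ^+ i) (size_poly _ _)).
  rewrite big_mkcond; apply: eq_bigr => i _.
  rewrite -polyC_exp coefMC; case: ltnP => hi; first by rewrite at1E.
  by rewrite -at1E [X in X * _]nth_default ?mul0r.
have -> : (char_poly Be).[x%:P] = \det (x%:P%:M - Be).
  rewrite /char_poly -[LHS]/(horner_eval x%:P _) -det_map_mx; congr (\det _).
  apply/matrixP => i j; rewrite !mxE /= /horner_eval hornerD hornerN hornerC hornerMn hornerX.
  by [].
have -> : x%:P%:M - Be = (map_mx polyC (H (x *: v0 - v1)) + 'X *: map_mx polyC (- A2))
     *m map_mx polyC (invmx A0).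
  have -> : H (x *: v0 - v1) = x *: A0 - A1 by rewrite (hess_lin hF) hessN.
  have gen (X Y : 'M[C]_4) : x%:P%:M - (map_mx polyC X + 'X *: map_mx polyC Y) =
      map_mx polyC (x *: 1%:M - X) + 'X *: map_mx polyC (- Y).
    apply/matrixP => i j; rewrite !mxE polyCB polyCM polyCN.
    by case: (i == j); rewrite ?mulr1n ?mulr0n ?polyC1 ?polyC0; ring.
  by rewrite gen mulmxDl -scalemxAl -!map_mxM mulmxBl -scalemxAl mulmxV // mulNmx.
rewrite det_mulmx det_map_mx coefMC mulf_neq0 //; last first.
  by rewrite det_inv invr_eq0 -unitfE -unitmxE.
have n0' : x *: v0 - v1 != 0 by rewrite -opprB oppr_eq0.
have hk' w : F (x *: v0 - v1) k w = 0 by rewrite -opprB (trilN1 hF) hk oppr0.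
apply: (@det_first_order _ 3 _ k).
- exact: hess_sym.
- exact: k0.
- exact/(hess_ker hF).
- exact: corank1_kernel_mx n0' k0 hk'.
by rewrite mulmxN mulNmx mxE hess_entry oppr_eq0; apply: hu; exact: rp.
Qed.

Lemma separable_eigen v0 v1 : H v0 \in unitmx ->
  separable_poly (char_poly (H v1 *m invmx (H v0))) ->
  exists (t : 'I_4 -> C) (k : 'I_4 -> 'rV[C]_4), [/\ injective t,
    forall i, k i != 0 & forall i w, F v1 (k i) w = t i * F v0 (k i) w].
Proof.
move=> u0; set p := char_poly _ => sp.
have [r er] := closed_field_poly_normal p.
have mp : p \is monic by exact: char_poly_monic.
have {}er : p = \prod_(z <- r) ('X - z%:P) by rewrite er (eqP mp) scale1r.
have ur : uniq r by rewrite -separable_prod_XsubC -er.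
have sr : size r = 4%N.
  by apply: succn_inj; rewrite -(size_prod_XsubC r id) -er size_char_poly.
have kex (i : 'I_4) : exists k : 'rV[C]_4, k != 0 /\
    forall w, F v1 k w = r`_i * F v0 k w.
  have : root p r`_i by rewrite er root_prod_XsubC mem_nth // sr.
  rewrite -eigenvalue_root_char => /eigenvalueP [k hk k0].
  exists k; split=> // w; rewrite !(hessE hF).
  have -> : k *m H v1 = r`_i *: (k *m H v0).
    by move/(congr1 (mulmx^~ (H v0))): hk; rewrite -mulmxA mulmxKV // -scalemxAl.
  by rewrite -scalemxAl mxE.
have [k hk] := fin_all_exists kex.
exists (fun i => r`_i), k; split.
- by move=> i j /eqP; rewrite nth_uniq ?sr // => /eqP /val_inj.
- by move=> i; case: (hk i).
by move=> i; case: (hk i).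
Qed.

(** If [F v v k] vanished, the eigenvector [k] would be orthogonal to every row of the
Krylov matrix. *)
Lemma krylov_cyclic v v' t k : H v \in unitmx -> k != 0 ->
  (forall w, F v' k w = t * F v k w) ->
  krylov_det (H v) (H v') v v' != 0 -> F v v k != 0.
Proof.
move=> uv k0 hk; apply: contraNneq => vk.
set M := krylov_det _ _ _ _; rewrite /M /krylov_det {M}; set M := (X in \det X).
have e (a b : 'rV[C]_4) : a *m H b *m k^T = const_mx (F b a k).
  by apply/matrixP => i j; rewrite !ord1 hess_entry mxE.
have kt : H v' *m k^T = t *: (H v *m k^T).
  rewrite -[H v']trmxK -trmx_mul (hess_sym hF) -[H v]trmxK -trmx_mul (hess_sym hF).
  rewrite -linearZ /=; congr (_^T); apply/rowP => j.
  have := hk (delta_mx 0 j); rewrite !(hessE hF) trmx_delta -!colE.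
  by rewrite [LHS]mxE [X in _ = _ * X]mxE => ->; rewrite [RHS]mxE.
have vv' : F v v' k = 0 by rewrite (trilC12 hF) (trilC23 hF) hk (trilC23 hF) vk mulr0.
have z : v' *m H v' *m k^T = 0.
  by rewrite -mulmxA kt -scalemxAr mulmxA e vv'; apply/matrixP => i j; rewrite !mxE mulr0.
have Mk : M *m k^T = 0.
  apply/row_matrixP => i; rewrite row0 row_mul rowK; do !case: ifP => _.
  - by rewrite e vk; apply/matrixP => a b; rewrite !mxE.
  - by rewrite e vv'; apply/matrixP => a b; rewrite !mxE.
  - exact: z.
  have -> : v' *m H v' *m \adj (H v) *m H v' *m k^T =
      t *: (v' *m H v' *m (\adj (H v) *m H v) *m k^T).
    by rewrite -!mulmxA kt -!scalemxAr.
  by rewrite mul_adj_mx mul_mx_scalar -scalemxAl z !scaler0.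
apply: contraNT k0; rewrite -unitfE -unitmxE => uM.
by rewrite -[k]trmxK -[k^T](mulKmx uM) Mk mulmx0 trmx0.
Qed.

End GoodLine.

Section Rows.
Variable C : numClosedFieldType.

Definition rows4 (a b c d : 'rV[C]_4) : 'M[C]_4 := \matrix_(i < 4) (if i == ord0 then a
  else if i == lift ord0 ord0 then b
  else if i == lift ord0 (lift ord0 ord0) then c else d).

Lemma rows4_comb (x : 'rV[C]_4) a b c d : x *m rows4 a b c d =
  x 0 ord0 *: a + (x 0 (lift ord0 ord0) *: b + (x 0 (lift ord0 (lift ord0 ord0)) *: c
   + x 0 (lift ord0 (lift ord0 (lift ord0 ord0))) *: d)).
Proof. by rewrite mulmx_sum_row !big_ord_recl big_ord0 addr0 !rowK. Qed.

Lemma rows4_det a b c d : (forall p q r s, p *: a + (q *: b + (r *: c + s *: d)) = 0 ->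
   [/\ p = 0, q = 0, r = 0 & s = 0]) -> \det (rows4 a b c d) != 0.
Proof.
move=> h; rewrite -unitfE -unitmxE -row_free_unit; apply: inj_row_free => x.
rewrite rows4_comb => /h [h0 h1 h2 h3]; apply/rowP => i; rewrite mxE.
case: (unliftP ord0 i) => [j ->|-> //]; case: (unliftP ord0 j) => [l ->|-> //].
by case: (unliftP ord0 l) => [m ->|-> //]; rewrite (ord1 m).
Qed.

Lemma rows4_free a b c d : \det (rows4 a b c d) != 0 ->
  forall p q r s, p *: a + (q *: b + (r *: c + s *: d)) = 0 ->
   [/\ p = 0, q = 0, r = 0 & s = 0].
Proof.
rewrite -unitfE -unitmxE => u p q r s e.
pose x : 'rV[C]_4 := \row_(i < 4) (if i == ord0 then p
  else if i == lift ord0 ord0 then q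
  else if i == lift ord0 (lift ord0 ord0) then r else s).
have x0 : x = 0.
  rewrite -[x](mulmxK u) rows4_comb !mxE /= e; exact: mul0mx.
have X i : x 0 i = 0 by rewrite x0 mxE.
by split; [have := X ord0 | have := X (lift ord0 ord0) | have := X (lift ord0 (lift ord0 ord0))
  | have := X (lift ord0 (lift ord0 (lift ord0 ord0)))]; rewrite mxE.
Qed.

Lemma rows4_line e a b c d a' b' c' d' :
  rows4 (a + e *: a') (b + e *: b') (c + e *: c') (d + e *: d') =
  rows4 a b c d + e *: rows4 a' b' c' d'.
Proof.
apply/row_matrixP => i; rewrite linearD linearZ /= !rowK.
by do 3?case: ifP.
Qed.

Lemma cofin_rows4 a b c d a' b' c' d' e0 :
  \det (rows4 (a + e0 *: a') (b + e0 *: b') (c + e0 *: c') (d + e0 *: d')) != 0 ->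
  cofin (fun e => \det (rows4 (a + e *: a') (b + e *: b') (c + e *: c') (d + e *: d')) != 0).
Proof. by apply: cofin_polyval => e; rewrite rows4_line det_line. Qed.
End Rows.

Section GoodLineExists.
Variables (C : numClosedFieldType) (F : 'rV[C]_4 -> 'rV[C]_4 -> 'rV[C]_4 -> C).
Hypothesis hF : trilin F.
Hypothesis kerF : forall a b c, a != 0 -> (forall w, F a b w = 0) ->
  (forall w, F a c w = 0) -> ~ prop_free b c.
Hypothesis finF : finite_sing F.

Local Notation H := (hess F).

Lemma off_surface : exists p, F p p p != 0.
Proof.
apply: boolp.contrapT => hn.
have F0 p : F p p p = 0 by apply/eqP; apply: boolp.contrapT => z; apply: hn; exists p; apply/negP.
have FF u v w : F u v w = 0 by rewrite (polarize hF) !F0; field.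
apply: (@kerF (delta_mx 0 ord0) _ _ _ _ _ (@delta_free C 2)) => //.
by apply/eqP => /rowP/(_ ord0); rewrite !mxE /= => /eqP; rewrite oner_eq0.
Qed.

Lemma hess_lineE v u e : H (v + e *: u) = H v + e *: H u.
Proof. by rewrite addrC (hess_lin hF) addrC. Qed.

Lemma cofin_unit v u e0 : H (v + e0 *: u) \in unitmx ->
  cofin (fun e => H (v + e *: u) \in unitmx).
Proof.
rewrite unitmxE unitfE => h0.
apply: cofin_impl (@cofin_polyval _ (fun e => \det (H (v + e *: u))) _ e0 _ h0).
  by move=> e; rewrite unitmxE unitfE.
by move=> e; rewrite hess_lineE det_line.
Qed.

(** Near a point off the surface the Hessian determinant has a first order term. *)
Lemma nondegenerate_point : exists q, H q \in unitmx.
Proof.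
have [p p0] := off_surface; apply: boolp.contrapT => hn.
have sg q : H q \notin unitmx by apply/negP => h; apply: hn; exists q.
have p1 : p != 0 by apply: contraNneq p0 => ->; rewrite (tril01 hF).
have np : ~ sing F p by move=> h; move: p0; rewrite h eqxx.
have [k k0 /(hess_ker hF) hk] := singular_ker (sg p).
have [t ht] := smooth_kernel hF kerF p1 np k0 hk.
have d1 := @det_first_order C 3 (H p) k (hess_sym hF p) k0 (proj1 (hess_ker hF p k) hk)
  (corank1_kernel_mx hF kerF p1 k0 hk) (H t).
have {d1}/d1 d1 : (k *m H t *m k^T) 0 0 != 0 by rewrite (hess_entry hF).
have P0 : \det (map_mx polyC (H p) + 'X *: map_mx polyC (H t)) != 0.
  by apply: contraNneq d1 => ->; rewrite coef0.
have [e he] := cofin_ex (cofin_poly P0).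
by have := sg (p + e *: t); rewrite hess_lineE unitmxE unitfE det_line he.
Qed.

Lemma cofin_cubic v u e0 : F (v + e0 *: u) (v + e0 *: u) (v + e0 *: u) != 0 ->
  cofin (fun e => F (v + e *: u) (v + e *: u) (v + e *: u) != 0).
Proof.
apply: (@cofin_polyval _ _ (Poly [:: F v v v; 3 * F v v u; 3 * F v u u; F u u u])) => e.
by rewrite horner_Poly /= (cubD hF) !(trilE hF); ring.
Qed.

(** The lines through [v0] meeting the finite singular locus are avoided by
leaving finitely many planes. *)
Lemma cofin_smooth_line v0 : v0 != 0 -> exists t, forall v1,
  cofin (fun e => forall s, ~ sing F (v1 + e *: t - s *: v0)).
Proof.
move=> v00; have [s hs] := finF.
have fx (p : 'rV[C]_4) := functional_vanishing v0 p.
have [l hl] := boolp.choice fx.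
have [|p _|t ht] := @avoid_functionals C 4 _ (0 :: s) l.
- by move=> p; case: (hl p).
- by case: (hl p).
exists t => v1.
have hc : cofin (fun e => forall p, p \in 0 :: s -> l p v1 + e * l p t != 0).
  by apply: cofin_seq => p ps; apply: cofin_affine; rewrite (ht _ ps) orbT.
apply: cofin_impl hc => e he r sg.
have key p : p \in 0 :: s -> (exists a, v1 + e *: t - r *: v0 = a *: p) -> False.
  move=> ps [a ea]; have [lp l0 l1 _] := hl p.
  have := congr1 (l p) ea; rewrite linfB // linfD // !linfZ // l0 l1 !mulr0 subr0.
  by move/eqP; rewrite (negPf (he _ ps)).
have [z|z] := eqVneq (v1 + e *: t - r *: v0) 0.
  by apply: (key 0 (mem_head _ _)); exists 0; rewrite z scale0r.
have [p ps ea] := hs _ z sg; apply: (key p) => //; by rewrite inE ps orbT.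
Qed.

(** A generic line has four distinct points with singular polar quadric, and a line
through a point off the surface meets the surface in at most three points. *)
Lemma hessian_point_off : exists v k, [/\ F v v v != 0, k != 0 & forall w, F v k w = 0].
Proof.
have [p p0] := off_surface; have [q q0] := nondegenerate_point.
have [e [fv uv]] : exists e, F (p + e *: (q - p)) (p + e *: (q - p)) (p + e *: (q - p)) != 0
    /\ H (p + e *: (q - p)) \in unitmx.
  apply: cofin_ex; apply: cofin_and.
    by apply: (@cofin_cubic _ _ 0); rewrite scale0r addr0.
  by apply: (@cofin_unit _ _ 1); rewrite scale1r addrC subrK.
move: (p + e *: (q - p)) fv uv => v fv uv.
have v0 : v != 0 by apply: contraNneq fv => ->; rewrite (tril01 hF).
have [t ht] := cofin_smooth_line v0.
have [d hd] := cofin_ex (ht 0).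
have [u hu] := generic_line hF kerF uv hd.
have [b sb] := cofin_ex hu.
have [r [k [ir k0 hk]]] := separable_eigen hF uv sb.
move: (0 + d *: t + b *: u) hk {sb} => v' hk.
have [i hi] : exists i, F (v' - r i *: v) (v' - r i *: v) (v' - r i *: v) != 0.
  apply: boolp.contrapT => hn.
  pose P := Poly [:: F v' v' v'; - 3 * F v' v' v; 3 * F v' v v; - F v v v].
  have P0 : P != 0.
    apply: contraNneq fv => z; have : P`_3 = 0 by rewrite z coef0.
    by rewrite coef_Poly /= => /eqP; rewrite oppr_eq0.
  have : all (root P) [seq r i | i <- enum 'I_4].
    apply/allP => x /mapP [i _ ->]; apply/eqP.
    have : F (v' - r i *: v) (v' - r i *: v) (v' - r i *: v) = 0.
      by apply/eqP; apply: boolp.contrapT => z; apply: hn; exists i; apply/negP.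
    rewrite (cubD hF) !(trilE hF) horner_Poly /= => h0.
    by rewrite -[RHS]h0; ring.
  move=> /(max_poly_roots P0); rewrite map_inj_uniq ?enum_uniq // => /(_ isT).
  rewrite size_map size_enum_ord => h4; have := size_Poly [:: F v' v' v'; - 3 * F v' v' v; 3 * F v' v v; - F v v v].
  by move=> /= h5; have := leq_trans h4 h5; rewrite ltnn.
exists (v' - r i *: v), (k i); split=> // w.
by rewrite !(trilE hF) hk subrr.
Qed.

Section AtHessianPoint.
Variables v k : 'rV[C]_4.
Hypotheses (fv : F v v v != 0) (k0 : k != 0) (hk : forall w, F v k w = 0).

Local Notation R a b := (a *m H b).

Let v0 : v != 0.
Proof. by apply: contraNneq fv => ->; rewrite (tril01 hF). Qed.

Lemma smooth_partner : exists t, F k k t != 0.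
Proof.
have [t ht] := smooth_kernel hF kerF v0 (fun s => negP fv (introT eqP (s v))) k0 hk.
by exists t; rewrite -(trilC13 hF).
Qed.

Lemma rowE0 (a b : 'rV[C]_4) : (forall w, F b a w = 0) -> R a b = 0.
Proof. by move/(hess_ker hF). Qed.

Lemma row_comb p q r s (a b c d a' b' c' d' : 'rV[C]_4) w :
  p *: R a a' + (q *: R b b' + (r *: R c c' + s *: R d d')) = 0 ->
  p * F a' a w + (q * F b' b w + (r * F c' c w + s * F d' d w)) = 0.
Proof.
have E x y : (R x y *m w^T) 0 0 = F y x w by rewrite (hess_entry hF).
move=> e; have := congr1 (fun x : 'rV[C]_4 => (x *m w^T) 0 0) e.
rewrite /= mul0mx [RHS]mxE => h; rewrite -!E -[RHS]h !mulmxDl -!scalemxAl.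
have aE (A B : 'M[C]_1) : (A + B) 0 0 = A 0 0 + B 0 0 by rewrite mxE.
have sE x (A : 'M[C]_1) : (x *: A) 0 0 = x * A 0 0 by rewrite mxE.
by rewrite !(aE, sE).
Qed.

(** If the four covectors were dependent for every [u], the products of linear forms
below would agree. If [F k k k] is not zero, unique factorization then produces a second
kernel vector at some point of the line through [v] and [k]. If it is zero, [z1 = k] is
admissible, and only one of the two products vanishes identically. *)
Lemma independent_polars : exists u,
  \det (rows4 (R v v) (R u v) (R u k) (R k k)) != 0.
Proof.
apply: boolp.contrapT => hn.
have [t0 ht0] := smooth_partner.
have kv w : F k v w = 0 by rewrite (trilC12 hF).
have key z1 z2 u : F v v z1 = 0 -> F v v z2 = 0 -> F k k z1 = 0 -> F k k z2 = 0 ->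
    F v z1 u * F k z2 u = F v z2 u * F k z1 u.
  move=> a1 a2 b1 b2; apply/eqP; apply: boolp.contrapT => ne; apply: hn; exists u.
  apply: rows4_det => p q r s e.
  have e1 := row_comb z1 e; have e2 := row_comb z2 e.
  rewrite a1 b1 !mulr0 add0r addr0 in e1; rewrite a2 b2 !mulr0 add0r addr0 in e2.
  have D : F v u z1 * F k u z2 - F v u z2 * F k u z1 != 0.
    by rewrite subr_eq0 !(trilC23 hF _ u); apply/negP.
  have q0 : q = 0.
    apply: (mulIf D); rewrite mul0r.
    via ((q * F v u z1 + r * F k u z1) * F k u z2 - (q * F v u z2 + r * F k u z2) * F k u z1).
      by ring.
    by rewrite e1 e2; ring.
  have r0 : r = 0.
    apply: (mulIf D); rewrite mul0r.
    via (F v u z1 * (q * F v u z2 + r * F k u z2) - F v u z2 * (q * F v u z1 + r * F k u z1)).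
      by ring.
    by rewrite e1 e2; ring.
  have p0 : p = 0.
    have := row_comb v e; rewrite q0 r0 (trilC23 hF k k v) kv !mul0r mulr0 !addr0 => /eqP.
    by rewrite mulf_eq0 (negPf fv) orbF => /eqP.
  split=> //; have := row_comb t0 e; rewrite q0 r0 p0 !mul0r !add0r => /eqP.
  by rewrite mulf_eq0 (negPf ht0) orbF => /eqP.
have zz T : linf T -> exists z, [/\ z != 0, F v v z = 0, F k k z = 0 & T z = 0].
  move=> hT; pose f (i : 'I_3) := if i == ord0 then F v v else if i == lift ord0 ord0 then F k k else T.
  have [|z z0 hz] := @common_zero C 4 3 f _ isT.
    by move=> i; rewrite /f; case: ifP => _; [exact: tril3|case: ifP => _ //; exact: tril3].
  by exists z; split=> //; [have := hz ord0 | have := hz (lift ord0 ord0)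
    | have := hz (lift ord0 (lift ord0 ord0))].
have [kkk|kkk] := eqVneq (F k k k) 0.
  have [T [hT Tk]] := nonzero_functional k0.
  have [z [z0 za zb zT]] := zz T hT.
  have [x|x xin|u hu] := @avoid_functionals C 4 _ [:: true; false]
      (fun x u => if x then F v z u else F k k u).
  - by case: x; exact: tril3.
  - case: x xin => _; last by exists t0.
    apply: boolp.contrapT => hz; have [w|s es] := corank1_kernel kerF v0 k0 hk (x := z).
      by apply/eqP; apply: boolp.contrapT => nz; apply: hz; exists w; apply/negP.
    move: zT; rewrite es linfZ // => /eqP; rewrite mulf_eq0 (negPf Tk) orbF => /eqP s0.
    by move: z0; rewrite es s0 scale0r eqxx.
  have := key k z u; rewrite hk mul0r (trilC23 hF v v k) hk => /(_ erefl za kkk zb) /esym/eqP.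
  by rewrite mulf_eq0 (negPf (hu true isT)) (negPf (hu false isT)).
have [z1 [z10 a1 b1 _]] := zz _ (@linf_cst0 C 4).
have [T [hT Tz]] := nonzero_functional z10.
have [z2 [z20 a2 b2 T2]] := zz T hT.
have zfree a b : a *: z1 + b *: z2 = 0 -> a = 0 /\ b = 0.
  move=> e; have := congr1 T e; rewrite linfD // !linfZ // T2 mulr0 addr0 linf0 // => /eqP.
  rewrite mulf_eq0 (negPf Tz) orbF => /eqP az; split=> //.
  by move/eqP: e; rewrite az scale0r add0r scaler_eq0 (negPf z20) orbF => /eqP.
have ind a b : (forall u, a * F v z1 u + b * F v z2 u = 0) -> a = 0 /\ b = 0.
  move=> h; apply: zfree; have [w|s es] := corank1_kernel kerF v0 k0 hk (x := a *: z1 + b *: z2).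
    by rewrite !(trilE hF) h.
  have : F k k (a *: z1 + b *: z2) = 0 by rewrite !(trilE hF) b1 b2; ring.
  rewrite es (trilE hF) => /eqP; rewrite mulf_eq0 (negPf kkk) orbF => /eqP ->.
  exact: scale0r.
have [c hc] := linear_factor (tril3 hF v z1) (tril3 hF v z2) (tril3 hF k z1) (tril3 hF k z2)
  ind (fun u => key z1 z2 u a1 a2 b1 b2).
apply: (@kerF (k - c *: v) z1 z2) => //.
- apply: contraNneq k0 => /eqP; rewrite subr_eq0 => /eqP ek.
  have := hk v; rewrite ek !(trilE hF) => /eqP; rewrite mulf_eq0 (negPf fv) orbF => /eqP ->.
  by rewrite scale0r.
- by move=> w; rewrite !(trilE hF) (proj1 (hc w)) subrr.
by move=> w; rewrite !(trilE hF) (proj2 (hc w)) subrr.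
Qed.

(** The last Krylov row at [v'] is a multiple of [k *m H v'], because the adjugate of [H v] is
a multiple of [k^T *m k]. With [v' = k + e *: u] the first two rows are [v *m H v] and
[e *: (u *m H v)], and the third differs from [k *m H v'] by [e *: (u *m H k + e *: (u *m H u))].
Up to a nonzero factor the determinant is therefore a deformation of the one in
[independent_polars]. *)
Lemma krylov_near : exists v', krylov_det (H v) (H v') v v' != 0.
Proof.
have [c c0 adjE] := adj_corank1 (n := 3) (hess_sym hF v) k0 (proj1 (hess_ker hF v k) hk)
  (corank1_kernel_mx hF kerF v0 k0 hk).
have [t0 ht0] := smooth_partner; have [u0 hu0] := independent_polars.
have RD a a' b e : R (a + e *: a') b = R a b + e *: R a' b.
  by rewrite mulmxDl -scalemxAl.
have [u [hu hs]] : exists u, \det (rows4 (R v v) (R u v) (R u k) (R k k)) != 0 /\ F k k u != 0.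
  have hc := @cofin_rows4 C (R v v) (R u0 v) (R u0 k) (R k k) 0 (R t0 v) (R t0 k) 0 0.
  rewrite !scale0r !addr0 in hc.
  have ha : (F k k u0 != 0) || (F k k t0 != 0) by rewrite ht0 orbT.
  have [e [h1 h2]] := cofin_ex (cofin_and (hc hu0) (cofin_affine ha)).
  exists (u0 + e *: t0); rewrite !RD !(trilE hF); split=> //.
  by move: h1; rewrite !scaler0 !addr0.
have hc := @cofin_rows4 C (R v v) (R u v) (R u k) (R k k) 0 0 (R u u) (R u k) 0.
rewrite !scale0r !addr0 in hc.
have hq : [|| F u u k != 0, 2 * F k k u != 0 | F k k k != 0].
  by rewrite [2 * _ == 0]mulf_eq0 pnatr_eq0 (negPf hs) orbT.
have [e [h1 [h2 e0]]] := cofin_ex (cofin_and (hc hu) (cofin_and (cofin_quad hq) (cofin_neq 0))).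
rewrite !scaler0 !addr0 in h1.
exists (k + e *: u).
have Rku : R k u = R u k.
  apply/rowP => j; have := trilC12 hF u k (delta_mx 0 j).
  by rewrite !(hessE hF) trmx_delta -!colE [LHS]mxE [X in _ = X]mxE.
have r2 : R (k + e *: u) v = e *: R u v by rewrite RD rowE0 ?add0r.
have r3 : R (k + e *: u) (k + e *: u) = (R k k + e *: R u k) + e *: (R u k + e *: R u u).
  by rewrite RD hess_lineE !mulmxDr -!scalemxAr Rku !scalerDr.
have r4 : R (k + e *: u) (k + e *: u) *m \adj (H v) *m H (k + e *: u) =
    (c * (F u u k * e ^+ 2 + 2 * F k k u * e + F k k k)) *: (R k k + e *: R u k).
  have ek : R (k + e *: u) (k + e *: u) *m k^T =
      (F u u k * e ^+ 2 + 2 * F k k u * e + F k k k)%:M.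
    rewrite [LHS]mx11_scalar (hess_entry hF) !(trilE hF) (trilC13 hF u k k) (trilC23 hF k u k).
    by congr (_%:M); ring.
  have kH : k *m H (k + e *: u) = R k k + e *: R u k.
    by rewrite hess_lineE mulmxDr -scalemxAr Rku.
  by rewrite adjE -scalemxAr -scalemxAl mulmxA ek mul_scalar_mx -scalemxAl kH scalerA.
rewrite /krylov_det; apply: rows4_det => p q r s.
rewrite r4 r2 r3 => E.
set g := c * _ in E.
have [|p0 q0 r0 s0] := rows4_free h1 (p := p) (q := q * e) (r := r * e) (s := r + s * g).
  rewrite -[RHS]E; congr (_ + _); rewrite scalerA; congr (_ + _).
  rewrite [r *: (_ + _)]scalerDr !scalerA scalerDl.
  by rewrite addrC -addrA addrAC -addrA; congr (_ + _); rewrite addrC.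
have {}q0 : q = 0 by move/eqP: q0; rewrite mulf_eq0 (negPf e0) orbF => /eqP.
have {}r0 : r = 0 by move/eqP: r0; rewrite mulf_eq0 (negPf e0) orbF => /eqP.
have g0 : g != 0 by rewrite mulf_neq0.
by split=> //; move/eqP: s0; rewrite r0 add0r mulf_eq0 (negPf g0) orbF => /eqP.
Qed.

End AtHessianPoint.

Lemma krylov_nonzero : exists v v', krylov_det (H v) (H v') v v' != 0.
Proof.
have [v [k [fv k0 hk]]] := hessian_point_off.
by have [v' hv'] := krylov_near fv k0 hk; exists v, v'.
Qed.

(** A nonzero Krylov determinant survives three small perturbations: of [v], to make its
polar quadric nondegenerate; of [v'], to make the line avoid the singular points; and
of [v'] again, to make the four roots distinct. *)
Lemma good_line : exists v v' (t : 'I_4 -> C) (k : 'I_4 -> 'rV[C]_4),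
  [/\ injective t, forall i, k i != 0, forall i w, F v' (k i) w = t i * F v (k i) w,
     H v \in unitmx & forall i, F v v (k i) != 0].
Proof.
have [vb [vb' hb]] := krylov_nonzero; have [q hq] := nondegenerate_point.
have hc1 := @cofin_krylov C (H vb) (H (q - vb)) (H vb') 0 vb (q - vb) vb' 0 0.
rewrite !scale0r !addr0 in hc1.
have [e [h1 h2]] : exists e, krylov_det (H vb + e *: H (q - vb)) (H vb' + e *: 0)
    (vb + e *: (q - vb)) (vb' + e *: 0) != 0 /\ H (vb + e *: (q - vb)) \in unitmx.
  apply: cofin_ex; apply: cofin_and; first exact: hc1.
  by apply: (@cofin_unit _ _ 1); rewrite scale1r addrC subrK.
rewrite -hess_lineE !scaler0 !addr0 in h1.
move: (vb + e *: (q - vb)) h1 h2 => v hv uv.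
have v0 : v != 0.
  apply/eqP => z; move: uv; rewrite z.
  have -> : H 0 = 0 by apply/matrixP => i j; rewrite !mxE (tril01 hF).
  by rewrite unitmxE det0 unitr0.
have [t ht] := cofin_smooth_line v0.
have hc2 := @cofin_krylov C (H v) 0 (H vb') (H t) v 0 vb' t 0.
rewrite !scale0r !addr0 in hc2.
have [e' [h1 h2]] := cofin_ex (cofin_and (hc2 hv) (ht vb')).
rewrite -hess_lineE !scaler0 !addr0 in h1.
move: (vb' + e' *: t) h1 h2 => v' hv' ns.
have [u hu] := generic_line hF kerF uv ns.
have hc3 := @cofin_krylov C (H v) 0 (H v') (H u) v 0 v' u 0.
rewrite !scale0r !addr0 in hc3.
have [d [h1 h2]] := cofin_ex (cofin_and (hc3 hv') hu).
rewrite -hess_lineE !scaler0 !addr0 in h1.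
have [r [k [ir k0 hk]]] := separable_eigen hF uv h2.
exists v, (v' + d *: u), r, k; split=> // i.
exact: (krylov_cyclic hF uv (k0 i) (hk i) h1).
Qed.

End GoodLineExists.

(** * Residues and interpolation *)
Section Residues.
Variable C : numClosedFieldType.
Implicit Types p q G : {poly C}.

Lemma cofin_comp (Q : C -> Prop) (a b : C) : a != 0 -> cofin Q -> cofin (fun k => Q (a * k + b)).
Proof.
move=> a0 [P P0 h]; exists (P \Po (a *: 'X + b%:P)) => [|k].
  rewrite -size_poly_eq0 size_comp_poly2 ?size_poly_eq0 // size_polyDl.
    by rewrite size_scale // size_polyX.
  by rewrite size_scale // size_polyX (leq_ltn_trans (size_polyC_leq1 _)).
by rewrite horner_comp hornerD hornerZ hornerX hornerC => /h.
Qed.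

(** The coefficient of ['X * p] at the degree of [p] is the second highest one
of [p], and zero when [p] is constant. *)
Lemma coef_second p q a b : (size p <= a.+1)%N -> (size q <= b.+1)%N ->
  (p * q)`_(a + b) = p`_a * q`_b /\
  ('X * (p * q))`_(a + b) = p`_a * ('X * q)`_b + ('X * p)`_a * q`_b.
Proof.
have dec n (r : {poly C}) : (size r <= n.+1)%N ->
    exists2 r1 : {poly C}, r = r`_n *: 'X^n + r1 & (size r1 <= n)%N.
  move=> sr; exists (r - r`_n *: 'X^n); first by rewrite addrC subrK.
  apply/leq_sizeP => j; rewrite leq_eqVlt => /orP[/eqP <-|nj].
    by rewrite coefB coefZ coefXn eqxx mulr1 subrr.
  rewrite coefB coefZ coefXn (gtn_eqF nj) mulr0 subr0.
  by move/leq_sizeP: sr; apply.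
move=> /dec [p1 ep sp] /dec [q1 eq sq].
set x := p`_a in ep *; set y := q`_b in eq *.
have low : (size (p1 * q1)%R <= (a + b).-1)%N.
  have [->|p10] := eqVneq p1 0; first by rewrite mul0r size_poly0.
  have [->|q10] := eqVneq q1 0; first by rewrite mulr0 size_poly0.
  by rewrite size_mul // -!subn1 leq_sub2r // leq_add.
have E : p * q = (x * y) *: 'X^(a + b) + x *: ('X^a * q1) + y *: ('X^b * p1) + p1 * q1.
  by rewrite ep eq exprD -!mul_polyC polyCM; ring.
have p1a : p1`_a = 0 by move/leq_sizeP: sp; apply.
have q1b : q1`_b = 0 by move/leq_sizeP: sq; apply.
have low0 : (p1 * q1)`_(a + b) = 0.
  by move/leq_sizeP: low; apply; exact: leq_pred.
have low1 : ('X * (p1 * q1))`_(a + b) = 0.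
  rewrite coefXM; case: eqP => // /eqP ab0.
  by move/leq_sizeP: low; apply.
have Xn n i : ('X * 'X^n)`_i = (i == n.+1)%:R :> C by rewrite -exprS coefXn.
split.
  rewrite E !coefD !coefZ coefXn eqxx !coefXnM ltnNge leq_addr addKn /=.
  by rewrite ltnNge leq_addl addnK /= low0 p1a q1b; ring.
have -> : 'X * (p * q) = (x * y) *: ('X * 'X^(a + b)) + x *: ('X^a * ('X * q1))
    + y *: ('X^b * ('X * p1)) + 'X * (p1 * q1).
  by rewrite E -!mul_polyC; ring.
have -> : ('X * q)`_b = ('X * q1)`_b.
  by rewrite eq mulrDr coefD -scalerAr coefZ Xn ltn_eqF // mulr0 add0r.
have -> : ('X * p)`_a = ('X * p1)`_a.
  by rewrite ep mulrDr coefD -scalerAr coefZ Xn ltn_eqF // mulr0 add0r.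
rewrite !coefD !coefZ Xn ltn_eqF // !coefXnM ltnNge leq_addr addKn /=.
by rewrite ltnNge leq_addl addnK /= low1; ring.
Qed.

(** The sum of the residues of [G / Phi] at its finite poles, for [deg G <= deg Phi]: modulo
[Phi], the polynomial [G] is its Lagrange interpolation at the roots. *)
Lemma residue_sum (r : seq C) G d : uniq r -> size r = d.+1 -> (size G <= d.+2)%N ->
  let Phi := \prod_(z <- r) ('X - z%:P) in
  \sum_(z <- r) G.[z] / Phi^`().[z] = G`_d - G`_d.+1 * Phi`_d.
Proof.
move=> ur sr sG Phi.
have mP : Phi \is monic by exact: monic_prod_XsubC.
have sP : size Phi = d.+2 by rewrite size_prod_XsubC sr.
pose q z := Phi %/ ('X - z%:P).
have qE z : z \in r -> Phi = q z * ('X - z%:P).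
  by move=> zr; rewrite divpK // dvdp_XsubCl root_prod_XsubC.
have sq z : z \in r -> size (q z) = d.+1 by move=> zr; rewrite size_divp ?polyXsubC_eq0 // size_XsubC sP.
have mq z : z \in r -> (q z)`_d = 1.
  move=> zr; have := eqP mP; rewrite {1}(qE z zr) lead_coefM lead_coefXsubC mulr1.
  by rewrite lead_coefE sq.
have dz z : z \in r -> Phi^`().[z] = (q z).[z].
  move=> zr; rewrite {1}(qE z zr) derivM derivXsubC mulr1 hornerD hornerM.
  by rewrite hornerXsubC subrr mulr0 add0r.
have qw z w : z \in r -> w \in r -> z != w -> (q z).[w] = 0.
  move=> zr wr zw; have : Phi.[w] = 0 by apply/eqP; rewrite -/(root Phi w) root_prod_XsubC.
  rewrite (qE z zr) hornerM hornerXsubC => /eqP; rewrite mulf_eq0 subr_eq0 [w == z]eq_sym (negPf zw) orbF.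
  by move/eqP.
have qz z : z \in r -> (q z).[z] != 0.
  move=> zr; apply/negP => rz.
  have /separable_nosquare : separable_poly Phi by rewrite separable_prod_XsubC.
  move=> /(_ ('X - z%:P) 2%N isT); rewrite size_XsubC => /(_ isT) /negP; apply.
  by rewrite (qE z zr) exprS expr1 dvdp_mul // dvdp_XsubCl.
pose L := \sum_(z <- r) (G.[z] / Phi^`().[z]) *: q z.
pose E := G - G`_d.+1 *: Phi - L.
have sL : (size L <= d.+1)%N.
  rewrite /L big_seq; apply: (leq_trans (size_sum _ _ _)); apply/bigmax_leqP_seq => z zr _.
  by rewrite (leq_trans (size_scale_leq _ _)) // sq.
have sE : (size E <= d.+1)%N.
  apply/leq_sizeP => j dj; rewrite /E !coefB coefZ.
  have -> : L`_j = 0 by move/leq_sizeP: sL; apply.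
  move: dj; rewrite leq_eqVlt => /orP[/eqP <-|dj].
    by have := eqP mP; rewrite lead_coefE sP => ->; rewrite mulr1 subrr subr0.
  rewrite [Phi`_j]nth_default ?sP // mulr0 !subr0.
  by move/leq_sizeP: sG; apply.
have E0 : E = 0.
  apply/eqP; apply: contraTT sE => nE; rewrite -ltnNge -sr; apply: max_poly_roots => //.
  apply/allP => w wr; apply/eqP; rewrite /E !hornerD !hornerN hornerZ.
  have -> : Phi.[w] = 0 by apply/eqP; rewrite -/(root Phi w) root_prod_XsubC.
  have -> : L.[w] = G.[w]; last by ring.
  rewrite /L horner_sum (bigD1_seq w) //= hornerZ dz // divfK ?qz // big_seq_cond big1 ?addr0 //.
  by move=> z /andP[zr zw]; rewrite hornerZ qw // mulr0.
have : E`_d = 0 by rewrite E0 coef0.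
rewrite /E !coefB coefZ => /eqP; rewrite subr_eq0 => /eqP ->.
rewrite /L coef_sum big_seq [RHS]big_seq; apply: eq_bigr => z zr.
by rewrite coefZ mq // mulr1.
Qed.
End Residues.

Section Nodes.
Variable C : numClosedFieldType.

Lemma cubes_seq n (s : seq C) (k : C -> C) (l : C -> 'rV[C]_n -> C) :
  (forall z, linf (l z)) -> cubes (size s) (fun v => \sum_(z <- s) k z * l z v ^+ 3).
Proof.
move=> hl; elim: s => [|z s IH].
  by apply: (cubes_ext (cubes0 C n)) => v; rewrite big_nil.
by apply: (cubes_ext (cubesD (cubes1 (k z) (hl z)) IH)) => v; rewrite big_cons.
Qed.

(** The polynomial [chi] has the roots [lam a], and [ch a] is [chi] without the factor of
[lam a]. The polynomial [N v] interpolates the values [al a * x a v * ea a], and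
[psi k] is a family of monic polynomials with prescribed values at the [lam a]. *)
Variables (m e n : nat) (lam al c : 'I_m.+1 -> C) (g : {poly C})
  (x : 'I_m.+1 -> 'rV[C]_n -> C).
Hypotheses (em : (e + m.+1 = 4)%N) (ilam : injective lam) (al0 : forall i, al i != 0)
  (c0 : forall i, c i != 0) (mg : g \is monic) (sg : size g = e.+1)
  (g0 : forall i, g.[lam i] != 0) (hx : forall i, linf (x i)).

Let u v := \sum_i al i * x i v.
Let w v := \sum_i al i * lam i * x i v.

Let ls := [seq lam i | i <- enum 'I_m.+1].
Let chi := \prod_(z <- ls) ('X - z%:P).
Let ch a := \prod_(b | b != a) ('X - (lam b)%:P).
Let ea a := (ch a).[lam a].

Let chiE a : chi = ('X - (lam a)%:P) * ch a.
Proof. by rewrite /chi /ls big_map big_enum /= (bigD1 a). Qed.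

Let ch_neq a b : a != b -> (ch a).[lam b] = 0.
Proof.
move=> ab; rewrite /ch (bigD1 b) 1?eq_sym //= hornerM hornerXsubC subrr; exact: mul0r.
Qed.

Let ea0 a : ea a != 0.
Proof.
rewrite /ea /ch horner_prod; apply/prodf_neq0 => b ba.
by rewrite hornerXsubC subr_eq0 (inj_eq ilam) eq_sym.
Qed.

Let size_chi : size chi = m.+2.
Proof. by rewrite size_prod_XsubC size_map size_enum_ord. Qed.

Let mchi : chi \is monic. Proof. exact: monic_prod_XsubC. Qed.

Let size_ch a : size (ch a) = m.+1.
Proof.
have c00 : ch a != 0.
  by apply: contraNneq (monic_neq0 mchi) => z; rewrite (chiE a) z mulr0.
by have := size_chi; rewrite (chiE a) size_mul ?polyXsubC_eq0 // size_XsubC => -[].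
Qed.

Let lead_ch a : (ch a)`_m = 1.
Proof.
have := eqP mchi; rewrite (chiE a) lead_coefM lead_coefXsubC mul1r lead_coefE size_ch.
by [].
Qed.

Let dchi a : chi^`().[lam a] = ea a.
Proof.
by rewrite (chiE a) derivM derivXsubC mul1r hornerD hornerM hornerXsubC subrr mul0r addr0.
Qed.

Let chi_lam a : chi.[lam a] = 0.
Proof. by rewrite (chiE a) hornerM hornerXsubC subrr; exact: mul0r. Qed.

(* the value of [psi] that makes the residue of [g N^3 / (chi psi)] at [lam a] equal to
   [- 3 c a * x a ^ 3] *)
Let d a := - al a ^+ 3 * g.[lam a] * ea a ^+ 2 / (3 * c a).

Let d0 a : d a != 0.
Proof. by rewrite !mulf_neq0 ?oppr_eq0 ?invr_eq0 ?expf_neq0 ?mulf_neq0 ?pnatr_eq0. Qed.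

Let rho := \sum_a (d a / ea a) *: ch a.

Let rho_lam a : rho.[lam a] = d a.
Proof.
rewrite /rho horner_sum (bigD1 a) //= hornerZ divfK // big1 ?addr0 // => b ba.
by rewrite hornerZ ch_neq // mulr0.
Qed.

Let size_rho : (size rho <= m.+1)%N.
Proof.
apply: (leq_trans (size_sum _ _ _)); apply/bigmax_leqP => a _.
by rewrite (leq_trans (size_scale_leq _ _)) // size_ch.
Qed.

Let psi k := ('X + k%:P) * chi + rho.

Let psi_lam k a : (psi k).[lam a] = d a.
Proof. by rewrite /psi hornerD hornerM chi_lam mulr0 add0r rho_lam. Qed.

Let Xk (k : C) : 'X + k%:P = 'X - (- k)%:P :> {poly C}. Proof. by rewrite polyCN opprK. Qed.

Let size_psi k : size (psi k) = m.+3.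
Proof.
have sp : size (('X + k%:P) * chi) = m.+3.
  by rewrite Xk size_Mmonic ?polyXsubC_eq0 // size_XsubC size_chi.
by rewrite /psi size_polyDl // sp; apply: leq_ltn_trans size_rho _.
Qed.

Let mpsi k : psi k \is monic.
Proof.
rewrite monicE /psi lead_coefDl; last first.
  by rewrite Xk size_Mmonic ?polyXsubC_eq0 // size_XsubC size_chi; apply: leq_ltn_trans size_rho _.
by rewrite Xk lead_coefM lead_coefXsubC (eqP mchi) mulr1.
Qed.

(* The pencil spanned by [chi] and ['X * chi + rho] has no base point, so its
   general member has simple roots. *)
Let psi_simple : cofin (fun k => forall z, root (psi k) z -> ~~ root (psi k)^`() z).
Proof.
pose W := chi ^+ 2 + rho^`() * chi - rho * chi^`().
have W0 : W != 0.
  apply/eqP => z; have := congr1 (horner^~ (lam ord0)) z.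
  rewrite /= horner0 /W hornerD hornerN hornerD horner_exp !hornerM chi_lam dchi rho_lam.
  by rewrite expr0n mulr0 !add0r => /eqP; rewrite oppr_eq0 mulf_eq0 (negPf (d0 _)) (negPf (ea0 _)).
have [r er] := closed_field_poly_normal W.
have hc : cofin (fun k => forall z, z \in r -> k != - (z * chi.[z] + rho.[z]) / chi.[z]).
  by apply: cofin_seq => z _; exact: cofin_neq.
apply: cofin_impl hc => k hk z rz; apply/negP => rz'.
have hz : (z + k) * chi.[z] + rho.[z] = 0.
  by move/rootP: rz; rewrite /psi hornerD hornerM hornerD hornerX hornerC.
have hz' : chi.[z] + (z + k) * chi^`().[z] + rho^`().[z] = 0.
  move/rootP: rz'; rewrite /psi derivD derivM derivD derivX derivC addr0 mul1r.
  by rewrite !hornerD hornerM hornerD hornerX hornerC.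
have cz : chi.[z] != 0.
  rewrite -/(root _ z) /chi root_prod_XsubC; apply/negP => /mapP [a _ ez].
  move: hz; rewrite ez chi_lam mulr0 add0r rho_lam => /eqP.
  by rewrite (negPf (d0 a)).
have Wz : W.[z] = 0.
  rewrite /W hornerD hornerN hornerD horner_exp !hornerM.
  via (chi.[z] * (chi.[z] + (z + k) * chi^`().[z] + rho^`().[z])
    - chi^`().[z] * ((z + k) * chi.[z] + rho.[z])); first by ring.
  by rewrite hz hz'; ring.
have zr : z \in r.
  move/eqP: Wz; rewrite {1}er hornerZ mulf_eq0 lead_coef_eq0 (negPf W0) /=.
  by rewrite -/(root _ z) root_prod_XsubC.
case/negP: (hk z zr); apply/eqP; apply: (mulIf cz); rewrite divfK //.
by apply/eqP; rewrite -addr_eq0; apply/eqP; rewrite -[RHS]hz; ring.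
Qed.

Let N v := \sum_a (al a * x a v) *: ch a.

Let size_N v : (size (N v) <= m.+1)%N.
Proof.
apply: (leq_trans (size_sum _ _ _)); apply/bigmax_leqP => a _.
by rewrite (leq_trans (size_scale_leq _ _)) // size_ch.
Qed.

Let N_lam v a : (N v).[lam a] = al a * x a v * ea a.
Proof.
rewrite /N horner_sum (bigD1 a) //= hornerZ big1 ?addr0 // => b ba.
by rewrite hornerZ ch_neq // mulr0.
Qed.

Let s := ('X * chi)`_m.+1.

Let second_ch a : ('X * ch a)`_m = s + lam a.
Proof.
have [_] := @coef_second C ('X - (lam a)%:P) (ch a) 1 m (eq_leq (size_XsubC _)) (eq_leq (size_ch a)).
rewrite -chiE add1n -/s => ->; rewrite lead_ch [X in _ + X * _ + _]coefXM.
by rewrite !coefB !coefX !coefC /=; ring.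
Qed.

Let N_top v : (N v)`_m = u v.
Proof. by rewrite /N coef_sum; apply: eq_bigr => a _; rewrite coefZ lead_ch mulr1. Qed.

Let N_second v : ('X * N v)`_m = s * u v + w v.
Proof.
rewrite /N mulr_sumr coef_sum /u /w mulr_sumr -big_split; apply: eq_bigr => a _ /=.
by rewrite -scalerAr coefZ second_ch; ring.
Qed.

(** The residues of [g N^3 / (chi psi)] at the roots of [chi] restore the given cubes, those
at the roots of [psi], where [N] is a linear functional of [v], are the new cubes, and
the residue at infinity is a combination of [u ^ 2 * w] and [u ^ 3]. *)
Lemma interpolated_cubes : exists K, cofin (fun k => cubes m.+2 (fun v =>
  3 * (\sum_i c i * x i v ^+ 3) + 3 * u v ^+ 2 * w v + (K - k) * u v ^+ 3)).
Proof.
exists (s + ('X * g)`_e); apply: cofin_impl psi_simple => k hk.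
have [r er] := closed_field_poly_normal (psi k).
move: er; rewrite (eqP (mpsi k)) scale1r => er.
have sr : size r = m.+2.
  by apply: succn_inj; rewrite -(size_prod_XsubC r id) -er size_psi.
have ur : uniq r.
  rewrite -separable_prod_XsubC -er separable_poly.unlock.
  by apply/Pdiv.ClosedField.coprimepP => z; exact: hk.
have uls : uniq (ls ++ r).
  rewrite cat_uniq ur andbT map_inj_uniq // enum_uniq /=.
  apply/hasPn => z zr; apply/negP => /mapP [a _ ez].
  have := psi_lam k a; rewrite -ez er.
  have -> : (\prod_(z0 <- r) ('X - z0%:P)).[z] = 0 by apply/rootP; rewrite root_prod_XsubC.
  by move/esym/eqP; rewrite (negPf (d0 a)).
have Phi : \prod_(z <- ls ++ r) ('X - z%:P) = chi * psi k by rewrite big_cat er.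
have ed : (e + (m + m + m))%N = (m + m).+3 by move: em; lia.
have sls : size (ls ++ r) = (m + m).+3 by rewrite size_cat size_map size_enum_ord sr; lia.
pose l z v := (N v).[z].
have hl z : linf (l z).
  rewrite /l /N; apply: (@linf_ext _ _ (fun v => \sum_a (al a * (ch a).[z]) * x a v)).
    by apply: linf_sum => a; exact: linf_sc.
  by move=> v; rewrite horner_sum; apply: eq_bigr => a _; rewrite hornerZ; ring.
have := cubes_seq r (fun z => g.[z] / (chi * psi k)^`().[z]) hl; rewrite sr => H.
apply: (cubes_ext H) => v.
pose G := g * (N v * N v * N v).
have [t2 s2] := coef_second (size_N v) (size_N v).
have sN2 : (size (N v * N v)%R <= (m + m).+1)%N.
  have := size_N v; have := size_polyMleq (N v) (N v).
  move: (size _) (size _) => p q; lia.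
have [t3 s3] := coef_second sN2 (size_N v).
have sN3 : (size (N v * N v * N v)%R <= (m + m + m).+1)%N.
  have := size_N v; have := size_polyMleq (N v * N v) (N v); move: sN2.
  move: (size _) (size _) (size _) => p q t; lia.
have [t4 s4] := @coef_second C g (N v * N v * N v) e (m + m + m) (eq_leq sg) sN3.
rewrite -/G ed in t4 s4.
have sG : (size G <= (m + m).+4)%N.
  have := size_polyMleq g (N v * N v * N v); rewrite -/G sg; move: sN3 ed.
  move: (size _) (size _) => p q; lia.
have lg : g`_e = 1 by have := eqP mg; rewrite lead_coefE sg.
have := @residue_sum C (ls ++ r) G (m + m).+2 uls sls sG.
rewrite Phi /= big_cat /=.
have -> : \sum_(z <- ls) G.[z] / (chi * psi k)^`().[z] = - 3 * \sum_i c i * x i v ^+ 3.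
  rewrite /ls big_map big_enum mulr_sumr; apply: eq_bigr => a _.
  rewrite /G !hornerM N_lam derivM hornerD !hornerM dchi chi_lam psi_lam mul0r addr0 /d.
  by field; rewrite ea0 g0 al0 c0.
have -> : G`_(m + m).+3 = u v ^+ 3.
  by rewrite t4 lg t3 t2 N_top; ring.
have -> : G`_(m + m).+2 = ('X * G)`_(m + m).+3 by rewrite coefXM.
rewrite s4 t3 s3 t2 s2 !N_top !N_second lg.
have -> : (chi * psi k)`_(m + m).+2 = 2 * s + k.
  have -> : (chi * psi k)`_(m + m).+2 = ('X * (chi * psi k))`_(m.+1 + m.+2).
    by rewrite coefXM addSn addnS addnS.
  have [_ ->] := @coef_second C chi (psi k) m.+1 m.+2 (eq_leq size_chi) (eq_leq (size_psi k)).
  have -> : chi`_m.+1 = 1 by have := eqP mchi; rewrite lead_coefE size_chi.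
  have -> : (psi k)`_m.+2 = 1 by have := eqP (mpsi k); rewrite lead_coefE size_psi.
  have -> : ('X * psi k)`_m.+2 = s + k.
    rewrite /psi mulrDr coefD [X in _ + X]coefXM /= [X in _ + X]nth_default ?size_rho // addr0.
    have sX : (size ('X + k%:P)%R <= 2)%N by rewrite Xk size_XsubC.
    have [_] := @coef_second C ('X + k%:P) chi 1 m.+1 sX (eq_leq size_chi).
    rewrite add1n => ->.
    have -> : chi`_m.+1 = 1 by have := eqP mchi; rewrite lead_coefE size_chi.
    rewrite -/s [X in _ + X * _]coefXM.
    by rewrite !coefD !coefX !coefC /=; ring.
  by rewrite -/s; ring.
move=> R; apply/eqP; rewrite -subr_eq0; apply/eqP.
have -> : \sum_(z <- r) g.[z] / (chi * psi k)^`().[z] * l z v ^+ 3 =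
    \sum_(z <- r) G.[z] / (chi * psi k)^`().[z].
  by apply: eq_bigr => z _; rewrite /G /l !hornerM; ring.
move: R; set A := \sum_(z <- r) _; set B := \sum_i _ => R.
have -> : A = (- 3 * B + A) + 3 * B by ring.
by rewrite R; ring.
Qed.
End Nodes.

(** * Six cubes *)
Section Tail.
Variable C : numClosedFieldType.

(** Two linear conditions with distinct slopes cut out of [C^4] a plane on which any
two coordinates are independent. *)
Lemma two_zeros (t z : 'I_4 -> C) i j : injective t -> i != j -> \sum_a z a = 0 ->
  \sum_a t a * z a = 0 -> z i = 0 -> z j = 0 -> forall a, z a = 0.
Proof.
move=> it ij s0 s1 zi zj a.
have [->//|ai] := eqVneq a i; have [->//|aj] := eqVneq a j.
(* [b] is the fourth index *)
have [b [ba hb]] : exists b : 'I_4, b != a /\ forall c, [|| c == a, c == i, c == j | c == b].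
  move: ij ai aj; rewrite -!val_eqE /= => ij ai aj.
  have ltn3 (c : 'I_4) : (c < 4)%N by [].
  have := ltn3 i; have := ltn3 j; have := ltn3 a => l1 l2 l3.
  have lb : (6 - i - j - a < 4)%N by lia.
  exists (Ordinal lb); split=> [|c]; rewrite -!val_eqE /=; first by lia.
  by have := ltn3 c => l4; lia.
have : \sum_c (t c - t b) * z c = 0.
  under eq_bigr => c _ do rewrite mulrBl.
  by rewrite sumrB s1 -mulr_sumr s0 mulr0 subrr.
rewrite (bigD1 a) //= big1 ?addr0 => [/eqP|c ca].
  by rewrite mulf_eq0 subr_eq0 (inj_eq it) eq_sym (negPf ba) => /eqP.
have := hb c; rewrite (negPf ca) /= => /or3P[] /eqP ->; rewrite ?zi ?zj ?mulr0 //.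
by rewrite subrr mul0r.
Qed.

Section W.
Variables (n : nat) (c eta t al be : 'I_4 -> C) (x : 'I_4 -> 'rV[C]_n -> C).
Hypotheses (hx : forall i, linf (x i)) (c0 : forall i, c i != 0)
  (eta0 : forall i, eta i != 0) (it : injective t)
  (a0 : \sum_i al i * eta i = 0) (a1 : \sum_i al i * eta i * t i = 0)
  (b0 : \sum_i be i * eta i = 0) (b1 : \sum_i be i * eta i * t i = 0).

Let p v := \sum_i al i * x i v.
Let r v := \sum_i be i * x i v.

Let hp : linf p. Proof. by apply: linf_sum => i; exact: linf_sc. Qed.
Let hr : linf r. Proof. by apply: linf_sum => i; exact: linf_sc. Qed.

Let dep_zeros a b i j : i != j -> a * al i + b * be i = 0 -> a * al j + b * be j = 0 ->
  forall k, a * al k + b * be k = 0.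
Proof.
move=> ij hi hj k; apply: (mulIf (eta0 k)); rewrite mul0r.
apply: (@two_zeros t (fun k => (a * al k + b * be k) * eta k) _ _ it ij); last 2 first.
- by rewrite hi mul0r.
- by rewrite hj mul0r.
- via (a * (\sum_i al i * eta i) + b * (\sum_i be i * eta i)); last by rewrite a0 b0 !mulr0 addr0.
  by rewrite !mulr_sumr -big_split; apply: eq_bigr => m _ /=; ring.
- via (a * (\sum_i al i * eta i * t i) + b * (\sum_i be i * eta i * t i)).
    by rewrite !mulr_sumr -big_split; apply: eq_bigr => m _ /=; ring.
  by rewrite a1 b1 !mulr0 addr0.
Qed.

Let dependent_pair i j : i != j -> al i * be j = al j * be i ->
  exists a b, (a != 0) || (b != 0) /\ forall k, a * al k + b * be k = 0.
Proof.
move=> ij h.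
have [/andP[/eqP ai /eqP bi]|ni] := boolP ((al i == 0) && (be i == 0)); last first.
  exists (be i), (- al i); split; first by rewrite oppr_eq0 -negb_and andbC.
  by apply: (dep_zeros ij); [ring|rewrite mulNr h; ring].
have [/andP[/eqP aj /eqP bj]|nj] := boolP ((al j == 0) && (be j == 0)); last first.
  exists (be j), (- al j); split; first by rewrite oppr_eq0 -negb_and andbC.
  by apply: (dep_zeros ij); [rewrite ai bi; ring|ring].
exists 1, 0; split; first by rewrite oner_eq0.
by apply: (dep_zeros ij); rewrite ?ai ?aj ?bi ?bj; ring.
Qed.

Let dependent_cubes a b : (a != 0) || (b != 0) -> (forall k, a * al k + b * be k = 0) ->
  cubes 6 (fun v => \sum_i c i * x i v ^+ 3 + p v ^+ 2 * r v).
Proof.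
move=> ab h; have pr v : a * p v + b * r v = 0.
  rewrite /p /r !mulr_sumr -big_split big1 // => k _ /=.
  by via ((a * al k + b * be k) * x k v); [ring|rewrite h mul0r].
have [k hk] : exists k, forall v, p v ^+ 2 * r v = k * p v ^+ 3.
  have [b0'|b0'] := eqVneq b 0.
    exists 0 => v; move: ab (pr v); rewrite b0' eqxx orbF mul0r addr0 => a0' /eqP.
    by rewrite mulf_eq0 (negPf a0') => /eqP ->; ring.
  exists (- a / b) => v; have -> : r v = - a / b * p v; last by ring.
  apply: (mulfI b0'); apply/eqP; rewrite -subr_eq0; apply/eqP.
  by rewrite -(pr v); field.
apply: (@cubes_weak _ _ 5) => //.
by apply: (cubes_ext (cubesD (cubes_sum c hx) (cubes1 k hp))) => v /=; rewrite hk.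
Qed.

(** The pairs [(al i, be i)] are the coefficients of [p] and [r]. If two of them are
proportional, so are all, and [p ^ 2 * r] is a multiple of one cube. Otherwise the
quotients [be i / al i] are distinct interpolation nodes. At most one [al i] vanishes;
in that case only three nodes are used, the remaining degree is filled by [g], and the
terms in [x i0] form a binary cubic with [p]. *)
Lemma diagonal_tangent_cubes6 :
  cubes 6 (fun v => \sum_i c i * x i v ^+ 3 + p v ^+ 2 * r v).
Proof.
have [[i [j [ij h]]]|hn] := boolp.pselect (exists i j, i != j /\ al i * be j = al j * be i).
  by have [a [b [ab]]] := dependent_pair ij h; exact: dependent_cubes.
have inj i j : i != j -> al i * be j != al j * be i.
  by move=> ij; apply/eqP => h; apply: hn; exists i, j.
have [[i0 ai0]|hn0] := boolp.pselect (exists i, al i = 0); last first.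
  have al0 i : al i != 0 by apply/eqP => h; apply: hn0; exists i.
  have ilam : injective (fun i => be i / al i).
    move=> i j e; apply/eqP; apply: contraT => /inj /eqP; case.
    move: e => /(congr1 (fun z => z * al i * al j)) /=.
    by rewrite divfK // [RHS]mulrAC divfK // => e; rewrite mulrC -e mulrC.
  have g0 i : (1 : {poly C}).[be i / al i] != 0 by rewrite hornerC oner_eq0.
  have [K hK] := @interpolated_cubes C 3 0 n _ _ _ 1 x erefl ilam al0 c0 (monic1 _)
    (size_poly1 _) g0 hx.
  have [k hk] := cofin_ex hK.
  apply: (cubes_ext (cubesD (cubes_scale 3^-1 hk) (cubes1 ((k - K) / 3) hp))) => v.
  have -> : \sum_i al i * (be i / al i) * x i v = r v.
    by apply: eq_bigr => i _; rewrite mulrCA divff // mulr1.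
  by rewrite -/(p v); field.
have al0 i : al (lift i0 i) != 0.
  apply/eqP => h; have /eqP := inj _ _ (neq_lift i0 i); case.
  by rewrite ai0 h !mul0r.
pose lam i := be (lift i0 i) / al (lift i0 i).
have ilam : injective lam.
  move=> i j e; apply/eqP; apply: contraT => ij.
  have ij' : lift i0 i != lift i0 j by rewrite (inj_eq lift_inj).
  have /eqP := inj _ _ ij'; case.
  move: e; rewrite /lam => /(congr1 (fun z => z * al (lift i0 i) * al (lift i0 j))) /=.
  by rewrite divfK // [RHS]mulrAC divfK // => e; rewrite mulrC -e mulrC.
have [tau htau] : exists tau, forall i, lam i != tau.
  have : cofin (fun tau => forall i, i \in enum 'I_3 -> tau != lam i).
    by apply: cofin_seq => i _; exact: cofin_neq.
  case/cofin_ex => tau h; exists tau => i; rewrite eq_sym; apply: h; exact: mem_enum.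
have g0 i : ('X - tau%:P).[lam i] != 0 by rewrite hornerXsubC subr_eq0.
have [K hK] := @interpolated_cubes C 2 1 n lam (fun i => al (lift i0 i))
  (fun i => c (lift i0 i)) ('X - tau%:P) (fun i => x (lift i0 i)) erefl ilam al0
  (fun i => c0 _) (monicXsubC _) (size_XsubC _) g0 (fun i => hx _).
have c3 : (c i0 != 0) || (0 != 0 :> C) by rewrite c0.
have hB := binary_cubes2_generic (be i0) (- K / 3) (hx i0) hp c3.
have i3 : (3^-1 : C) != 0 by rewrite invr_eq0 pnatr_eq0.
have [k [hk1 hk2]] := cofin_ex (cofin_and hK (cofin_comp 0 i3 hB)).
apply: (cubes_ext (cubesD (cubes_scale 3^-1 hk1) hk2)) => v.
have pE : \sum_i al (lift i0 i) * x (lift i0 i) v = p v.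
  by rewrite /p [RHS](bigD1_ord i0) //= ai0 mul0r add0r.
have rE : r v = be i0 * x i0 v +
    \sum_i al (lift i0 i) * lam i * x (lift i0 i) v.
  rewrite /r (bigD1_ord i0) //=; congr (_ + _).
  by apply: eq_bigr => i _; rewrite /lam mulrCA divff // mulr1.
rewrite (bigD1_ord i0) //= pE rE; clearbody p; by field.
Qed.
End W.
End Tail.

Section Finite.
Variables (C : numClosedFieldType) (F : 'rV[C]_4 -> 'rV[C]_4 -> 'rV[C]_4 -> C).
Hypothesis hF : trilin F.

Lemma eigenvectors_free n (M : 'M[C]_n.+1) m (t : 'I_m -> C) (k : 'I_m -> 'rV[C]_n.+1) :
  injective t -> (forall i, k i != 0) -> (forall i, k i *m M = t i *: k i) ->
  forall c, \sum_i c i *: k i = 0 -> forall i, c i = 0.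
Proof.
move=> it k0 hk c h i.
have /mxdirect_sumsP/(_ i isT) := @mxdirect_sum_eigenspace C _ _ M predT t (in2W it).
move=> cap0; apply/eqP; have: c i *: k i == 0.
  rewrite -submx0 -cap0 sub_capmx; apply/andP; split.
    by apply: scalemx_sub; apply/eigenspaceP.
  move: h; rewrite (bigD1 i) //= => /eqP; rewrite addr_eq0 => /eqP ->.
  rewrite eqmx_opp; apply: summx_sub_sums => j _.
  by apply: scalemx_sub; apply/eigenspaceP.
by rewrite scaler_eq0 (negPf (k0 i)) orbF.
Qed.

(** The pencil of quadrics of a good line is simultaneously diagonal in the
coordinates [x], so [F] differs from a combination of their cubes by a cone whose vertex
contains that line. *)
Lemma diagonal_decomposition (v v' : 'rV[C]_4) (t : 'I_4 -> C) (k : 'I_4 -> 'rV[C]_4) :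
  injective t -> (forall i, k i != 0) -> (forall i w, F v' (k i) w = t i * F v (k i) w) ->
  hess F v \in unitmx -> (forall i, F v v (k i) != 0) ->
  exists (c : 'I_4 -> C) (x : 'I_4 -> 'rV[C]_4 -> C),
  [/\ frame k x, forall i, c i != 0, forall i, x i v != 0, forall i, x i v' = t i * x i v &
    forall a, (a = v \/ a = v') -> forall b d,
    F a b d = \sum_i c i * x i a * x i b * x i d].
Proof.
move=> it k0 hk Hv fk.
have kM i : k i *m (hess F v' *m invmx (hess F v)) = t i *: k i.
  have -> : hess F v' = t i *: hess F v + hess F (- t i *: v + v').
    by rewrite (hess_lin hF) addrA scaleNr subrr add0r.
  have e : k i *m hess F (- t i *: v + v') = 0.
    by apply/(hess_ker hF) => w; rewrite !(trilE hF) hk; ring.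
  by rewrite mulmxA mulmxDr e addr0 -scalemxAr -scalemxAl mulmxK.
have [e [x [fr he]]] := extend_basis (eigenvectors_free it k0 kM).
have ek : e = k by apply: boolp.funext => i; exact: he.
move: fr; rewrite ek => fr; have [hx kx dx] := fr.
have orth i j : i != j -> F v (k i) (k j) = 0.
  move=> ij; have := hk i (k j); rewrite (trilC23 hF) hk (trilC23 hF) => /eqP.
  by rewrite -subr_eq0 -mulrBl mulf_eq0 subr_eq0 (inj_eq it) eq_sym (negPf ij) => /eqP.
pose a i := F v (k i) (k i).
have Fv b i : F v b (k i) = a i * x i b.
  rewrite {1}[b]kx (trilC12 hF) (tril_sum1 hF) (bigD1 i) //= big1 ?addr0 => [|j ji].
    by rewrite !(trilE hF) (trilC12 hF) mulrC.
  by rewrite !(trilE hF) (trilC12 hF) orth // mulr0.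
have xv i : x i v != 0 by apply: contraNneq (fk i) => z; rewrite Fv z mulr0.
have a0 i : a i != 0 by apply: contraNneq (fk i) => z; rewrite Fv z mul0r.
have xv' i : x i v' = t i * x i v.
  apply: (mulfI (a0 i)); rewrite -Fv (trilC12 hF) (trilC23 hF) hk -trilC23 // Fv; ring.
exists (fun i => a i / x i v), x; split=> // [i|p hp b d].
  by rewrite mulf_neq0 ?invr_eq0.
rewrite {1}[d]kx (trilC13 hF) (tril_sum1 hF); apply: eq_bigr => i _.
rewrite (trilE hF) (trilC13 hF).
case: hp => ->; first by rewrite Fv; field.
by rewrite (trilC23 hF) hk (trilC23 hF) Fv xv'; field.
Qed.

(** The difference between [F] and the diagonal cubic kills [v] and [v'], so it is a binary
cubic in two functionals vanishing at [v] and [v']. This gives the linear relations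
between their coefficients in the [x i] and the values [x i v], [x i v' = t i * x i v]. *)
Lemma corank1_cubes6 : (forall a b c, a != 0 -> (forall w, F a b w = 0) ->
    (forall w, F a c w = 0) -> ~ prop_free b c) -> finite_sing F ->
  cubes 6 (fun v => F v v v).
Proof.
move=> kerF finF; have [v [v' [t [k [it k0 hk Hv fk]]]]] := good_line hF kerF finF.
have [c [x [[hx kx dx] c0 xv xv' hG]]] := diagonal_decomposition it k0 hk Hv fk.
have vv' : prop_free v v'.
  move=> a b h; have e i : a + b * t i = 0.
    apply: (mulIf (xv i)); rewrite mul0r.
    via (x i (a *: v + b *: v')); last by rewrite h; exact: linf0.
    by rewrite linfD // !linfZ // xv'; ring.
  have b0 : b = 0.
    have /eqP : b * (t ord0 - t (lift ord0 ord0)) = 0.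
      via ((a + b * t ord0) - (a + b * t (lift ord0 ord0))); first by ring.
      by rewrite !e subrr.
    by rewrite mulf_eq0 subr_eq0 (inj_eq it) orbF => /eqP.
  by have := e ord0; rewrite b0 mul0r addr0.
have [p [q [X [Y [Z [W [[hX hY hZ hW] dec [Zv Zv' Wv Wv']]]]]]]] := extend4_2 vv'.
pose G a b d := F a b d - \sum_i c i * x i a * x i b * x i d.
have hg : trilin G.
  split=> [b d e a a'|a b d|a b d]; rewrite /G.
  - rewrite !(trilE hF) (_ : \sum_i _ = e * (\sum_i c i * x i a * x i b * x i d) +
       \sum_i c i * x i a' * x i b * x i d); first by ring.
    by rewrite mulr_sumr -big_split; apply: eq_bigr => i _; rewrite hx /=; ring.
  - by rewrite (trilC12 hF); congr (_ - _); apply: eq_bigr => i _; ring.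
  - by rewrite (trilC23 hF); congr (_ - _); apply: eq_bigr => i _; ring.
have Gv b d : G v b d = 0 by rewrite /G hG ?subrr //; left.
have Gv' b d : G v' b d = 0 by rewrite /G hG ?subrr //; right.
have [A [B [D [E hB]]]] : exists A B D E, forall u, G u u u =
    A * Z u ^+ 3 + B * Z u ^+ 2 * W u + D * Z u * W u ^+ 2 + E * W u ^+ 3.
  exists (G p p p), (3 * G p p q), (3 * G p q q), (G q q q) => u.
  have h b d : G u b d = G (Z u *: p + W u *: q) b d.
    by rewrite {1}[u]dec !(trilE hg) Gv Gv'; ring.
  rewrite h (trilC12 hg) h (trilC13 hg) h.
  by rewrite (expand2 hg); ring.
have fE u : F u u u = \sum_i c i * x i u ^+ 3 + G u u u.
  rewrite /G addrC; under [X in _ + X]eq_bigr => i _ do rewrite exprSr expr2 !mulrA.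
  by rewrite subrK.
have [disc|disc] := eqVneq (bindisc A B D E) 0; last first.
  apply: (cubes_ext (cubesD (cubes_sum c hx) (binary_cubes2 hZ hW disc))) => u.
  by rewrite fE hB.
have [r [s [t1 [u1 bd]]]] := binary_double disc.
pose al i := r * Z (k i) + s * W (k i); pose be i := t1 * Z (k i) + u1 * W (k i).
have lin (l : 'rV[C]_4 -> C) : linf l -> forall u, l u = \sum_i l (k i) * x i u.
  move=> hl u; rewrite {1}[u]kx; elim/big_rec2: _ => [|i y z _ <-]; first exact: linf0.
  by rewrite linfD // linfZ //; ring.
have hp' : linf (fun u => r * Z u + s * W u) by apply: linf_add; apply: linf_sc.
have hr' : linf (fun u => t1 * Z u + u1 * W u) by apply: linf_add; apply: linf_sc.
have H := @diagonal_tangent_cubes6 C 4 c (fun i => x i v) t al be x hx c0 xv it.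
have e1 := lin _ hp'; have e2 := lin _ hr'; cbv beta in e1, e2.
apply: (cubes_ext (H _ _ _ _)) => [||||u].
- by rewrite -e1 Zv Wv; ring.
- under eq_bigr => i _ do rewrite -mulrA [_ * t i]mulrC -xv'.
  by rewrite -e1 Zv' Wv'; ring.
- by rewrite -e2 Zv Wv; ring.
- under eq_bigr => i _ do rewrite -mulrA [_ * t i]mulrC -xv'.
  by rewrite -e2 Zv' Wv'; ring.
by rewrite fE hB bd -e1 -e2.
Qed.

Theorem finite_sing_cubes6 : finite_sing F -> cubes 6 (fun v => F v v v).
Proof.
move=> fin.
have [h|h] := boolp.pselect (exists a b c, [/\ a != 0, prop_free b c,
   forall w, F a b w = 0 & forall w, F a c w = 0]).
  exact: corank2_cubes6.
by apply: corank1_cubes6 => // a b c a0 hb hc bc; apply: h; exists a, b, c.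
Qed.
End Finite.

(** * Four singular points *)
Section Cayley.
Variables (C : numClosedFieldType) (F : 'rV[C]_4 -> 'rV[C]_4 -> 'rV[C]_4 -> C).
Hypotheses (hF : trilin F) (finF : finite_sing F).

Lemma sing_comb a b c : sing F a -> sing F b -> sing F c -> forall X Y Z u,
  let v := X *: a + (Y *: b + Z *: c) in
  F v v u = 2 * (X * Y * F a b u + X * Z * F a c u + Y * Z * F b c u).
Proof.
move=> ha hb hc X Y Z u v; rewrite /v !(trilE hF).
by rewrite (trilC12 hF b a) (trilC12 hF c a) (trilC12 hF c b) ha hb hc; ring.
Qed.

Lemma sing_pair a b : sing F a -> sing F b -> F a b a = 0 /\ F a b b = 0.
Proof. by move=> ha hb; rewrite (trilC23 hF) ha (trilC13 hF) hb. Qed.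

(** Otherwise every point of the chord would be singular. *)
Lemma singular_chord a b : prop_free a b -> sing F a -> sing F b -> exists w, F a b w != 0.
Proof.
move=> ab ha hb; apply: boolp.contrapT => h; apply: (pencil_infinite finF ab) => p q w.
have z : F a b w = 0.
  by apply/eqP; apply: boolp.contrapT => /negP n; apply: h; exists w.
by rewrite !(trilE hF) (trilC12 hF b a) z ha hb; ring.
Qed.

Lemma three_singular_free a b c : prop_free a b -> prop_free a c -> prop_free b c ->
  sing F a -> sing F b -> sing F c ->
  forall p q r, p *: a + (q *: b + r *: c) = 0 -> [/\ p = 0, q = 0 & r = 0].
Proof.
move=> ab ac bc ha hb hc p q r h.
have [r0|r0] := eqVneq r 0.
  by move: h; rewrite r0 scale0r addr0 => /ab [-> ->].
have [q0|q0] := eqVneq q 0.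
  by move: h; rewrite q0 scale0r add0r => /ac [-> ->].
have [w hw] := singular_chord bc hb hc.
have e : q *: b + r *: c = - p *: a by rewrite scaleNr; apply/eqP; rewrite -addr_eq0 addrC h.
have := hb w; have := hc w => h1 h2.
have : F (- p *: a) (- p *: a) w = 0 by rewrite !(trilE hF) ha; ring.
rewrite -e !(trilE hF) (trilC12 hF c b) h1 h2 => /eqP.
rewrite (_ : _ + _ = 2 * (q * (r * F b c w))); last by ring.
by rewrite !mulf_eq0 pnatr_eq0 (negPf q0) (negPf r0) (negPf hw).
Qed.

(** If the plane cubic through three nodes had no [xyz] term, the surface would
contain a conic of singular points through them. *)
Lemma three_singular_product a b c : prop_free a b -> prop_free a c -> prop_free b c ->
  sing F a -> sing F b -> sing F c -> F a b c != 0.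
Proof.
move=> ab ac bc ha hb hc; apply/eqP => z.
have fr := three_singular_free ab ac bc ha hb hc.
have [d [x [y [x3 [x4 [hx hy h3 h4 dec]]]]]] := extend4_3 fr.
pose al := F a b d; pose be := F a c d; pose ga := F b c d.
have [w hw] := singular_chord ab ha hb.
have hab u : F a b u = x4 u * al.
  have [e1 e2] := sing_pair ha hb.
  by rewrite {1}[u]dec !(trilE hF) e1 e2 z -/al; ring.
have hac u : F a c u = x4 u * be.
  have [e1 e2] := sing_pair ha hc.
  by rewrite {1}[u]dec !(trilE hF) e1 e2 (trilC23 hF a c b) z -/be; ring.
have hbc u : F b c u = x4 u * ga.
  have [e1 e2] := sing_pair hb hc.
  by rewrite {1}[u]dec !(trilE hF) e1 e2 (trilC13 hF b c a) (trilC23 hF a c b) z -/ga; ring.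
have al0 : al != 0.
  by apply: contraNneq hw => al0; rewrite hab al0 mulr0.
have [n0 hn0] : exists n0 : nat, forall n, al + be * (n + n0)%:R != 0.
  have [[n0 e]|h] := boolp.pselect (exists n : nat, al + be * n%:R = 0); last first.
    by exists 0%N => n; apply/eqP => e; apply: h; exists (n + 0)%N.
  exists n0.+1 => n; have be0 : be != 0.
    by apply: contraNneq al0 => b0; rewrite -e b0 mul0r addr0.
  rewrite addnS -addSn natrD mulrDr addrCA e addr0.
  by rewrite mulf_neq0 // pnatr_eq0.
pose N n : C := (n + n0)%:R; pose Y n := al + be * N n.
pose g n := - ga * N n *: a + (Y n *: b + N n * Y n *: c).
apply: (@infinite_sing C 4 F g finF) => [n|n u|n m t nm].
- by apply/eqP => /fr [_ /eqP]; rewrite (negPf (hn0 n)).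
- by rewrite /g (sing_comb ha hb hc) hab hac hbc /Y; ring.
apply/eqP => e.
have : (- ga * N n - t * (- ga * N m)) *: a + ((Y n - t * Y m) *: b +
    (N n * Y n - t * (N m * Y m)) *: c) = 0.
  via (g n - t *: g m); last by rewrite e subrr.
  by apply/rowP => l; rewrite /g !mxE; ring.
move/fr => [_ /eqP e1 /eqP e2].
move: e1 e2; rewrite !subr_eq0 => /eqP e1; rewrite e1 => /eqP e2.
have /eqP : (N n - N m) * (t * Y m) = 0 by rewrite mulrBl e2; ring.
rewrite -e1 mulf_eq0 (negPf (hn0 n)) orbF subr_eq0 eqr_nat eqn_add2r.
by rewrite (negPf nm).
Qed.

(** The Cayley cubic: in coordinates at the four nodes only the products of three
distinct coordinates survive, and [24 y1 y2 y3 + ... = 2 s^3 - sum (s - 2 y_i)^3]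
with [s] the sum of the [y_i]. *)
Lemma four_singular_cubes5 a b c d :
  [/\ prop_free a b, prop_free a c & prop_free a d] ->
  [/\ prop_free b c, prop_free b d & prop_free c d] ->
  [/\ sing F a, sing F b, sing F c & sing F d] ->
  cubes 5 (fun v => F v v v).
Proof.
move=> [ab ac ad] [bc bd cd] [ha hb hc hd].
have abc := three_singular_product ab ac bc ha hb hc.
have abd := three_singular_product ab ad bd ha hb hd.
have acd := three_singular_product ac ad cd ha hc hd.
have bcd := three_singular_product bc bd cd hb hc hd.
have fr := three_singular_free ab ac bc ha hb hc.
have [Fab1 Fab2] := sing_pair ha hb.
have [Fac1 Fac2] := sing_pair ha hc.
have [Fbc1 Fbc2] := sing_pair hb hc.
have free4 p q r s : p *: a + (q *: b + (r *: c + s *: d)) = 0 ->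
    [/\ p = 0, q = 0, r = 0 & s = 0].
  move=> h; have [s0|s0] := eqVneq s 0.
    by move: h; rewrite s0 scale0r addr0 => /fr [-> -> ->].
  have e : p *: a + (q *: b + r *: c) = - s *: d.
    by rewrite scaleNr; apply/eqP; rewrite -addr_eq0 -!addrA h.
  have z u : 2 * (p * q * F a b u + p * r * F a c u + q * r * F b c u) = 0.
    by rewrite -(sing_comb ha hb hc) e !(trilE hF) hd; ring.
  have := z a; have := z b; have := z c.
  rewrite Fab1 Fab2 Fac1 Fac2 Fbc1 Fbc2.
  rewrite (trilC13 hF b c a) !(trilC23 hF a c b).
  rewrite !mulr0 !addr0 !add0r => /eqP z1 /eqP z2 /eqP z3; move: z1 z2 z3.
  rewrite !mulf_eq0 pnatr_eq0 (negPf abc) /= !orbF.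
  have nd (x y : 'rV[C]_4) k : prop_free x y -> k *: x = - s *: y -> False.
    move=> xy ek; have [|_ /eqP] := xy k s.
      by rewrite ek scaleNr addNr.
    by rewrite (negPf s0).
  move=> /orP h1 /orP h2 /orP h3; exfalso.
  have [q0|q0] := eqVneq q 0.
    have [r0|r0] := eqVneq r 0.
      by apply: (nd _ _ p ad); rewrite -e q0 r0 !scale0r !addr0.
    have p0 : p = 0 by case: h2 => /eqP // /eqP; rewrite (negPf r0).
    by apply: (nd _ _ r cd); rewrite -e q0 p0 !scale0r !add0r.
  have p0 : p = 0 by case: h1 => /eqP // /eqP; rewrite (negPf q0).
  have r0 : r = 0 by case: h3 => /eqP // /eqP; rewrite (negPf q0).
  by apply: (nd _ _ q bd); rewrite -e r0 p0 !scale0r add0r addr0.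
have M0 := rows4_det free4.
have uM : rows4 a b c d \in unitmx by rewrite unitmxE unitfE.
pose X i (v : 'rV[C]_4) : C := (v *m invmx (rows4 a b c d)) 0 i.
have hX i : linf (X i).
  by move=> k u v; rewrite /X mulmxDl -scalemxAl !mxE.
pose x := X ord0; pose y := X (lift ord0 ord0).
pose z := X (lift ord0 (lift ord0 ord0)).
pose w := X (lift ord0 (lift ord0 (lift ord0 ord0))).
have [hx hy] : linf x /\ linf y by split; apply: hX.
have [hz hw] : linf z /\ linf w by split; apply: hX.
have dec v : v = x v *: a + (y v *: b + (z v *: c + w v *: d)).
  by rewrite -{1}[v](mulmxKV uM) rows4_comb.
have fE v : F v v v = 6 * (F a b c * x v * y v * z v + F a b d * x v * y v * w v
    + F a c d * x v * z v * w v + F b c d * y v * z v * w v).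
  have [Fad1 Fad2] := sing_pair ha hd.
  have [Fbd1 Fbd2] := sing_pair hb hd.
  have [Fcd1 Fcd2] := sing_pair hc hd.
  rewrite {1 2 3}[v]dec (expand4 hF) !ha !hb !hc !hd Fab2 Fac2 Fad2 Fbc2 Fbd2 Fcd2.
  by ring.
clearbody x y z w => {X hX}.
pose p v := x v / F b c d; pose q v := y v / F a c d; pose r v := z v / F a b d.
pose s v := w v / F a b c.
have hp : linf p by apply: linf_ext (linf_sc (F b c d)^-1 hx) _ => v; rewrite mulrC.
have hq : linf q by apply: linf_ext (linf_sc (F a c d)^-1 hy) _ => v; rewrite mulrC.
have hr : linf r by apply: linf_ext (linf_sc (F a b d)^-1 hz) _ => v; rewrite mulrC.
have hs : linf s by apply: linf_ext (linf_sc (F a b c)^-1 hw) _ => v; rewrite mulrC.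
have hsum : linf (fun v => p v + q v + r v + s v) by do !apply: linf_add.
have K l : linf l -> cubes 1 (fun v => (-1) * (p v + q v + r v + s v - 2 * l v) ^+ 3).
  by move=> hl; apply: cubes1; apply: (linf_sub hsum); exact: linf_sc.
pose A := F a b c * F a b d * F a c d * F b c d.
apply: (cubes_ext (cubes_scale (A / 4) (cubesD (cubes1 2 hsum)
  (cubesD (K p hp) (cubesD (K q hq) (cubesD (K r hr) (K s hs))))))) => v.
rewrite /= fE /A /p /q /r /s.
move: abc abd acd bcd; clear; move: (F a b c) (F a b d) (F a c d) (F b c d) (x v) (y v) (z v) (w v) => k1 k2 k3 k4 X Y Z W n1 n2 n3 n4; field.
by rewrite n1 n2 n3 n4.
Qed.
End Cayley.

(** * Sums of few cubes *)
Section FewCubes.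
Variables (C : numClosedFieldType) (F : 'rV[C]_4 -> 'rV[C]_4 -> 'rV[C]_4 -> C).
Hypothesis hF : trilin F.

Definition sing_reps k (p : 'I_k -> 'rV[C]_4) := [/\ forall i, p i != 0,
  forall i, sing F (p i), forall i j, i != j -> prop_free (p i) (p j)
  & forall v, v != 0 -> sing F v -> exists i a, v = a *: p i].

Lemma sing_reps_finite k (p : 'I_k -> 'rV[C]_4) : sing_reps p -> finite_sing F.
Proof.
case=> _ _ _ h; exists (codom p) => v v0 /(h v v0) [i [a e]].
by exists (p i); [exact: codom_f | exists a].
Qed.

Lemma cubes2_infinite : finite_sing F -> cubes 2 (fun v => F v v v) -> False.
Proof.
move=> fin /(cubes_trilin hF) [l [hl Fl]].
apply: (@planar_infinite C 4 F (l ord0) (l (lift ord0 ord0)) isT fin (hl _) (hl _)).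
by move=> v x0 y0 w; rewrite Fl !big_ord_recl big_ord0 x0 y0; ring.
Qed.

Lemma cubes3_singular : cubes 3 (fun v => F v v v) -> exists2 v, v != 0 & sing F v.
Proof.
move=> /(cubes_trilin hF) [l [hl Fl]].
have [v v0 hv] := @common_zero C 4 3 l hl isT; exists v => // w.
by rewrite Fl big1 // => i _; rewrite hv; ring.
Qed.

(** Either the four linear forms are coordinates and the surface is smooth, or it
is a cone whose vertex is joined to any other singular point by a singular line. *)
Lemma cubes4_one_singular a b : finite_sing F -> cubes 4 (fun v => F v v v) ->
  sing F a -> sing F b -> ~ prop_free a b.
Proof.
move=> fin /(cubes_trilin hF) [l [hl Fl]] ha hb ab.
have [A hA] := linf_mx hl.
have [uA|] := boolP (A \in unitmx).
  have z v : sing F v -> v = 0.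
    move=> hv; rewrite -[v](mulmxK uA) (_ : v *m A = 0) ?mul0mx //.
    apply/rowP => i; rewrite [RHS]mxE -hA.
    have dual j : l j (delta_mx 0 i *m invmx A) = (j == i)%:R by rewrite hA mulmxKV // !mxE.
    have := hv (delta_mx 0 i *m invmx A); rewrite Fl (bigD1 i) //= big1 => [|j ji].
      by rewrite addr0 dual eqxx mulr1 => /eqP; rewrite mulf_eq0 orbb => /eqP.
    by rewrite dual (negPf ji) mulr0.
  by have [|/eqP] := ab 1 0; [rewrite (z a ha) (z b hb) !scaler0 addr0|rewrite oner_eq0].
case/singular_ker => v v0 hv.
have Fv u w : F v u w = 0.
  by rewrite Fl big1 // => i _; rewrite hA hv mxE !mul0r.
have vert c : sing F c -> exists k, c = k *: v.
  move=> hc; apply: boolp.contrapT => n.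
  apply: (@pencil_infinite C 4 F v c fin).
    by apply: prop_freeP => // k; apply/eqP => e; apply: n; exists k.
  move=> p q w; rewrite !(trilE hF) hc (trilC12 hF c) !Fv; ring.
have [p ep] := vert a ha; have [q eq] := vert b hb.
have [|q0 /eqP] := ab q (- p).
  by rewrite ep eq !scalerA -scalerDl (_ : _ + _ = 0) ?scale0r //; ring.
rewrite oppr_eq0 => /eqP p0.
have [|/eqP] := ab 1 1; last by rewrite oner_eq0.
by rewrite ep eq q0 p0 !scale0r scaler0 addr0.
Qed.

Theorem sing_reps_rank k r (p : 'I_k -> 'rV[C]_4) : sing_reps p -> (k <= 4)%N ->
  cubes r (fun v => F v v v) -> (forall s, cubes s (fun v => F v v v) -> (r <= s)%N) ->
  [\/ r = 3 /\ k = 1, r = 4 /\ (k = 0 \/ k = 1), r = 5 /\ (k <= 4)%N | r = 6 /\ (k <= 3)%N]%N.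
Proof.
move=> np k4 hr minr; have fin := sing_reps_finite np; have [p0 ps pf pall] := np.
have k1 : (r <= 4)%N -> (k <= 1)%N.
  move=> r4; rewrite leqNgt; apply/negP => k2.
  apply: (@cubes4_one_singular (p (Ordinal (ltnW k2))) (p (Ordinal k2)) fin) => //.
    exact: cubes_weak hr.
  exact: pf.
have k0 : (r <= 3)%N -> (0 < k)%N.
  move=> r3; have [v v0 sv] := cubes3_singular (cubes_weak r3 hr).
  by have [i _] := pall v v0 sv; apply: leq_ltn_trans (ltn_ord i).
have r2 : (2 < r)%N.
  by rewrite ltnNge; apply/negP => r2; exact: cubes2_infinite fin (cubes_weak r2 hr).
have r6 : (r <= 6)%N := minr _ (finite_sing_cubes6 hF fin).
have k3 : k = 4 -> (r <= 5)%N.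
  move=> ek; subst k; apply: minr.
  pose i0 : 'I_4 := ord0; pose i1 : 'I_4 := lift ord0 ord0.
  pose i2 : 'I_4 := lift ord0 (lift ord0 ord0).
  pose i3 : 'I_4 := lift ord0 (lift ord0 (lift ord0 ord0)).
  apply: (@four_singular_cubes5 C F hF fin (p i0) (p i1) (p i2) (p i3)).
  - by split; apply: pf.
  - by split; apply: pf.
  by split.
move: r2 r6 k0 k1 k3; clear - k4.
case: r => [|[|[|[|[|[|[|r]]]]]]] // _ _ k0 k1 k3.
- by apply: Or41; move: (k0 isT) (k1 isT); case: k {k4 k0 k1 k3} => [|[]].
- by apply: Or42; move: (k1 isT); case: k {k4 k0 k1 k3} => [|[|]] //; auto.
- by apply: Or43.
- apply: Or44; split=> //; move: k4; rewrite leq_eqVlt => /orP[/eqP|//] /k3.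
  by [].
Qed.
End FewCubes.

(** * Polynomials, polar forms and projective points *)
Section Polarization.
Variables (C : numClosedFieldType) (n : nat).
Implicit Types p f g : {mpoly C[n]}.

Lemma mpoly_euler d p : p \is d.-homog -> \sum_i 'X_i * p^`M(i) = p *+ d.
Proof.
move/dhomogP => hp.
have -> : p *+ d = \sum_(m <- msupp p) (p@_m *+ d) *: 'X_[m].
  by rewrite {1}[p]mpolyE -sumrMnl; apply: eq_bigr => m _; rewrite scalerMnl.
under eq_bigr => i _ do rewrite /mderiv mulr_sumr.
rewrite exchange_big /= big_seq [RHS]big_seq; apply: eq_bigr => m /hp /= dm.
under eq_bigr => i _.
  have -> : 'X_i * (((m i)%:R * p@_m) *: 'X_[m - U_(i)]) = (p@_m *+ m i) *: 'X_[m] :> {mpoly C[n]}.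
    rewrite -scalerAr mulr_natl; have [->|mi] := eqVneq (m i) 0%N; first by rewrite mulr0n !scale0r.
    rewrite -mpolyXD addmC submK //; apply/mnm_lepP => j; rewrite mnm1E.
    by case: eqP => // <-; rewrite lt0n.
  over.
by rewrite -scaler_suml sumrMnr -mdegE dm.
Qed.

Lemma mderiv_homog d p i : p \is d.+1.-homog -> p^`M(i) \is d.-homog.
Proof.
move=> hp; apply/dhomogP => m; rewrite mcoeff_msupp mcoeff_mderiv => h.
have : p@_(m + U_(i)) != 0 by apply: contraNneq h => ->; rewrite mul0rn.
rewrite -mcoeff_msupp => /(dhomog_mf hp) /=.
by rewrite mdegD mdeg1 addn1 => -[].
Qed.

Lemma homog0_const p v : p \is 0.-homog -> p = (p.@[v])%:MP.
Proof.
move=> hp; have e : p = (p@_0)%:MP.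
  apply/mpolyP => m; rewrite mcoeffC; have [->|m0] := eqVneq m 0%MM.
    by rewrite mulr1.
  rewrite mulr0; apply: (dhomog_nemf_coeff hp).
  by rewrite mdeg_eq0.
by rewrite {2}e mevalC -e.
Qed.

(** The third derivatives of a cubic form are constants, evaluated here at zero. *)
Definition polar f (u v w : 'rV[C]_n) : C :=
  \sum_i \sum_j \sum_k u 0 i * v 0 j * w 0 k * (f^`M(i)^`M(j)^`M(k)).@[fun=> 0] / 6.

Lemma polar_trilin f : trilin (polar f).
Proof.
split=> [v w a u u'|u v w|u v w]; rewrite /polar.
- rewrite mulr_sumr -big_split; apply: eq_bigr => i _ /=.
  rewrite mulr_sumr -big_split; apply: eq_bigr => j _ /=.
  rewrite mulr_sumr -big_split; apply: eq_bigr => k _ /=.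
  by rewrite !mxE; ring.
- rewrite exchange_big; apply: eq_bigr => i _; apply: eq_bigr => j _; apply: eq_bigr => k _.
  by rewrite (mderiv_comm i j); ring.
apply: eq_bigr => i _; rewrite exchange_big; apply: eq_bigr => j _; apply: eq_bigr => k _.
by rewrite (mderiv_comm j k); ring.
Qed.

Lemma meval_euler d p (v : 'I_n -> C) : p \is d.+1.-homog ->
  p.@[v] = (\sum_i v i * (p^`M(i)).@[v]) / d.+1%:R.
Proof.
move=> hp; apply: (mulIf (_ : d.+1%:R != 0)); first by rewrite pnatr_eq0.
rewrite divfK ?pnatr_eq0 // mulr_natr -mevalMn -(mpoly_euler hp) raddf_sum.
by apply: eq_bigr => i _ /=; rewrite mevalM mevalXU.
Qed.

Variable f : {mpoly C[n]}.
Hypothesis hf : f \is 3.-homog.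

Lemma third_const v i j k : (f^`M(i)^`M(j)^`M(k)).@[v] = (f^`M(i)^`M(j)^`M(k)).@[fun=> 0].
Proof.
have h0 : f^`M(i)^`M(j)^`M(k) \is 0.-homog by do !apply: mderiv_homog.
by rewrite (homog0_const (fun=> 0) h0) !mevalC.
Qed.

Lemma polar_deriv (v : 'rV[C]_n) i : (f^`M(i)).@[v 0] = 3 * polar f v v (delta_mx 0 i).
Proof.
have [_ c12 c23] := polar_trilin f; rewrite c23 c12.
rewrite (meval_euler _ (mderiv_homog i hf)) /polar [in RHS](bigD1 i) //= [X in _ + X]big1 => [|l li].
  rewrite addr0 !mxE !eqxx /= mulr_suml mulr_sumr; apply: eq_bigr => j _.
  have h1 : f^`M(i)^`M(j) \is 1.-homog by do !apply: mderiv_homog.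
  rewrite (meval_euler _ h1) mulr_suml !mulr_sumr mulr_suml; apply: eq_bigr => k _.
  by rewrite third_const; field.
by apply: big1 => j _; apply: big1 => k _; rewrite mxE (negPf li) andbF !mul0r.
Qed.

Lemma polar_diag (v : 'rV[C]_n) : f.@[v 0] = polar f v v v.
Proof.
rewrite (meval_euler _ hf); under eq_bigr => i _ do rewrite polar_deriv.
have hT := polar_trilin f.
have -> : polar f v v v = \sum_i v 0 i * polar f v v (delta_mx 0 i).
  rewrite {1}[v]row_sum_delta (tril_sum1 hT); apply: eq_bigr => i _.
  by rewrite (trilZ1 hT) (trilC13 hT).
by rewrite mulr_suml; apply: eq_bigr => i _; field.
Qed.

Lemma polar_singular (v : 'rV[C]_n) : (forall i, (f^`M(i)).@[v 0] = 0) <-> sing (polar f) v.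
Proof.
split=> [h u|h i]; last by rewrite polar_deriv h mulr0.
have hT := polar_trilin f.
rewrite (trilC13 hT) [u]row_sum_delta (tril_sum1 hT) big1 // => i _.
have /eqP := h i; rewrite polar_deriv mulf_eq0 pnatr_eq0 => /eqP e.
by rewrite (trilZ1 hT) (trilC13 hT) e mulr0.
Qed.

Lemma polar_delta i j k : polar f (delta_mx 0 i) (delta_mx 0 j) (delta_mx 0 k) =
  (f^`M(i)^`M(j)^`M(k)).@[fun=> 0] / 6.
Proof.
rewrite /polar (bigD1 i) //= [X in _ + X]big1 => [|a ai]; last first.
  by apply: big1 => b _; apply: big1 => c _; rewrite mxE (negPf ai) andbF !mul0r.
rewrite addr0 (bigD1 j) //= [X in _ + X]big1 => [|b bj]; last first.
  by apply: big1 => c _; rewrite ![delta_mx _ _ _ b]mxE (negPf bj) andbF mulr0 !mul0r.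
rewrite addr0 (bigD1 k) //= [X in _ + X]big1 => [|c ck]; last first.
  by rewrite ![delta_mx _ _ _ c]mxE (negPf ck) andbF mulr0 !mul0r.
by rewrite addr0 !mxE !eqxx !mul1r.
Qed.

(** The polar form vanishes, so all third derivatives do; Euler's identity descends from
them to the form. *)
Lemma homog_eq0 : (forall v : 'rV[C]_n, f.@[v 0] = 0) -> f = 0.
Proof.
move=> h0.
have z u v w : polar f u v w = 0.
  rewrite (@polarize _ _ _ (polar_trilin f)) -!polar_diag !h0; ring.
have up d p : p \is d.+1.-homog -> (forall i, p^`M(i) = 0) -> p = 0.
  move=> hp e; have /eqP := mpoly_euler hp.
  rewrite big1 => [|i _]; last by rewrite e mulr0.
  by rewrite -scaler_nat eq_sym scaler_eq0 pnatr_eq0 => /eqP.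
apply: (up _ _ hf) => i; apply: (up _ _ (mderiv_homog i hf)) => j.
apply: (up _ _ (mderiv_homog j (mderiv_homog i hf))) => k.
have h0k : f^`M(i)^`M(j)^`M(k) \is 0.-homog by do !apply: mderiv_homog.
have /eqP := polar_delta i j k; rewrite z eq_sym mulf_eq0 invr_eq0 pnatr_eq0 orbF => /eqP e.
by rewrite (homog0_const (fun=> 0) h0k) e mpolyC0.
Qed.
End Polarization.

Section Forms.
Variables (C : numClosedFieldType).
Implicit Types f : {mpoly C[4]}.

Definition form_of (l : 'rV[C]_4 -> C) : {mpoly C[4]} := \sum_i l (delta_mx 0 i) *: 'X_i.

Lemma form_of_homog l : form_of l \is 1.-homog.
Proof. by apply: rpred_sum => i _; apply: rpredZ; rewrite dhomogX /= mdeg1. Qed.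

Lemma form_of_meval l (v : 'rV[C]_4) : linf l -> (form_of l).@[v 0] = l v.
Proof.
move=> hl; rewrite /form_of raddf_sum /= {2}[v]row_sum_delta.
elim/big_rec2: _ => [|i x y _ IH]; first by rewrite linf0.
by rewrite linfD // linfZ // mevalZ mevalXU mulrC -IH.
Qed.

Lemma cube_homog (l : {mpoly C[4]}) : l \is 1.-homog -> l ^+ 3 \is 3.-homog.
Proof. by move=> h; have := dhomogMn 3 h; rewrite mul1n. Qed.

Lemma linear_meval (l : {mpoly C[4]}) : l \is 1.-homog -> linf (fun v : 'rV[C]_4 => l.@[v 0]).
Proof.
move=> hl a u v; rewrite !(meval_euler _ hl) !divr1 mulr_sumr -big_split.
apply: eq_bigr => i _ /=; rewrite !mxE.
have h0 := mderiv_homog i hl; rewrite (homog0_const (fun=> 0) h0) !mevalC; ring.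
Qed.

Lemma sum_of_cubesP f r : f \is 3.-homog ->
  sum_of_cubes f r <-> cubes r (fun v => polar f v v v).
Proof.
move=> hf; split=> [[l [hl e]]|[l [hl e]]].
  exists (fun i v => (l i).@[v 0]); split=> [i|v]; first exact: linear_meval.
  rewrite -polar_diag // e raddf_sum; apply: eq_bigr => i _ /=.
  by rewrite rmorphXn.
exists (fun i => form_of (l i)); split=> [i|]; first exact: form_of_homog.
apply/eqP; rewrite -subr_eq0; apply/eqP; apply: homog_eq0.
  apply: rpredB => //; apply: rpred_sum => i _; apply: cube_homog; exact: form_of_homog.
move=> v; rewrite mevalB polar_diag // e [X in _ - X]raddf_sum /= -sumrB big1 // => i _ /=.
by rewrite rmorphXn /= form_of_meval // subrr.
Qed.

Lemma cubic_of_cubes (F : 'rV[C]_4 -> 'rV[C]_4 -> 'rV[C]_4 -> C) r : trilin F ->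
  cubes r (fun v => F v v v) -> exists2 f, f \is 3.-homog & forall u v w, polar f u v w = F u v w.
Proof.
move=> hF [l [hl e]]; exists (\sum_i form_of (l i) ^+ 3).
  apply: rpred_sum => i _; apply: cube_homog; exact: form_of_homog.
apply: trilin_eq => //; first exact: polar_trilin.
move=> v; rewrite -polar_diag.
  by rewrite raddf_sum e; apply: eq_bigr => i _ /=; rewrite rmorphXn /= form_of_meval.
apply: rpred_sum => i _; apply: cube_homog; exact: form_of_homog.
Qed.

Lemma singular_pointP f (v : 'rV[C]_4) (L : P3 C) : f \is 3.-homog -> v != 0 ->
  val L = <[v]>%VS -> singular_point f L <-> sing (polar f) v.
Proof.
move=> hf v0 eL; split=> [h|h w].
  by apply/(polar_singular hf) => i; apply: h => //; rewrite eL memv_line.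
rewrite eL => /vlineP [k ->] _; apply/(polar_singular hf) => u.
by rewrite !(trilE (polar_trilin f)) h !mulr0.
Qed.

Definition line_point (v : 'rV[C]_4) (v0 : v != 0) : P3 C :=
  exist _ <[v]>%VS (eq_ind_r (fun d => d == 1%N) (eqxx 1%N) (etrans (dim_vline v) (congr1 nat_of_bool v0))).

Lemma point_line (L : P3 C) : exists2 v : 'rV[C]_4, v != 0 & val L = <[v]>%VS.
Proof.
case: L => L /= /eqP dL; exists (vpick L).
  by rewrite vpick0 -dimv_eq0 dL.
apply/eqP; rewrite eq_sym eqEdim -memvE memv_pick dL dim_vline vpick0 -dimv_eq0 dL.
by [].
Qed.

Lemma prop_free_line (u v : 'rV[C]_4) : u != 0 -> v != 0 ->
  <[u]>%VS != <[v]>%VS -> prop_free u v.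
Proof.
move=> u0 v0 uv; apply: prop_freeP => // a; apply: contraNneq uv => e.
rewrite eq_sym eqEdim -memvE !dim_vline u0 v0 andbT; apply/vlineP; by exists a.
Qed.

Lemma exactly_k_sing_reps f k : f \is 3.-homog ->
  exactly_k_singular_points f k <-> exists p : 'I_k -> 'rV[C]_4, sing_reps (polar f) p.
Proof.
move=> hf; split=> [[s [us sk hs]]|[p [p0 ps pf pall]]].
  have [g hg] := boolp.choice (fun L => (fun h : exists2 v : 'rV[C]_4, v != 0 & val L = <[v]>%VS =>
     let: ex_intro2 v a b := h in ex_intro (fun v => v != 0 /\ val L = <[v]>%VS) v (conj a b)) (point_line L)).
  subst k; exists (fun i => g (tnth (in_tuple s) i)); split=> [i|i|i j ij|v v0 sv].
  - by case: (hg (tnth (in_tuple s) i)).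
  - have [a b] := hg (tnth (in_tuple s) i); apply/(singular_pointP hf a b)/hs.
    exact: mem_tnth.
  - have [a b] := hg (tnth (in_tuple s) i); have [a' b'] := hg (tnth (in_tuple s) j).
    apply: prop_free_line => //; rewrite -b -b'; apply: contraNneq ij => /val_inj e.
    by apply/eqP; move: e; apply: tuple_uniqP.
  have /hs Ls : singular_point f (line_point v0) by apply/(singular_pointP hf v0).
  have /tnthP [i ei] : line_point v0 \in in_tuple s by exact: Ls.
  exists i; have [a b] := hg (tnth (in_tuple s) i); apply/vlineP.
  by rewrite -b -ei /= memv_line.
exists [seq line_point (p0 i) | i <- enum 'I_k]; split.
- rewrite map_inj_uniq ?enum_uniq // => i j /(congr1 val) /= e.
  apply/eqP; apply: contraT => /pf ij.
  have /vlineP [a ea] : p i \in <[p j]>%VS by rewrite -e memv_line.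
  have [|/eqP] := ij 1 (- a); last by rewrite oner_eq0.
  by rewrite scale1r ea scaleNr subrr.
- by rewrite size_map size_enum_ord.
move=> L; split=> [/mapP [i _ ->]|].
  by apply/(singular_pointP hf (p0 i)).
have [v v0 eL] := point_line L; move/(singular_pointP hf v0 eL) => sv.
have [i [a e]] := pall v v0 sv; apply/mapP; exists i; first exact: mem_enum.
apply: val_inj; rewrite eL /=; apply/eqP; rewrite eqEdim -memvE !dim_vline v0 (p0 i) andbT.
by apply/vlineP; exists a.
Qed.
End Forms.

(** * Examples *)
Section Building.
Variables (C : numClosedFieldType) (n : nat).
Implicit Types (F G : 'rV[C]_n -> 'rV[C]_n -> 'rV[C]_n -> C).

Lemma linf_coord (i : 'I_n) : linf (fun v : 'rV[C]_n => v 0 i).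
Proof. by move=> a u v; rewrite !mxE. Qed.

Lemma trilin_diag m (c : 'I_m -> C) (x : 'I_m -> 'rV[C]_n -> C) : (forall i, linf (x i)) ->
  trilin (fun u v w => \sum_i c i * x i u * x i v * x i w).
Proof.
move=> hx; split=> [v w a u u'|u v w|u v w].
- by rewrite mulr_sumr -big_split; apply: eq_bigr => i _; rewrite hx /=; ring.
- by apply: eq_bigr => i _; ring.
- by apply: eq_bigr => i _; ring.
Qed.

Lemma trilin_add F G : trilin F -> trilin G -> trilin (fun u v w => F u v w + G u v w).
Proof.
move=> hF hG; split=> [v w a u u'|u v w|u v w].
- by rewrite !(trilE hF) !(trilE hG); ring.
- by rewrite (trilC12 hF) (trilC12 hG).
- by rewrite (trilC23 hF) (trilC23 hG).
Qed.

Lemma trilin_tangent (p r : 'rV[C]_n -> C) : linf p -> linf r ->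
  trilin (fun u v w => p u * p v * r w + p u * r v * p w + r u * p v * p w).
Proof.
move=> hp hr; split=> [v w a u u'|u v w|u v w] /=; [rewrite hp hr| |]; ring.
Qed.

Lemma trilin_scale c F : trilin F -> trilin (fun u v w => c * F u v w).
Proof.
move=> hF; split=> [v w a u u'|u v w|u v w]; last by rewrite (trilC23 hF).
  by rewrite !(trilE hF); ring.
by rewrite (trilC12 hF).
Qed.
End Building.

Section Charts.
Variables (C : numClosedFieldType) (F : 'rV[C]_4 -> 'rV[C]_4 -> 'rV[C]_4 -> C).

(** Vectors with the same nonzero value under [T] are independent as soon as they are
distinct. *)
Lemma sing_reps_of_chart (A : eqType) (d : A) (s : seq A) (q : A -> 'rV[C]_4) (T : 'rV[C]_4 -> C) :
  linf T -> uniq s -> {in s &, injective q} ->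
  {in s, forall t, T (q t) = 1 /\ sing F (q t)} ->
  (forall v, v != 0 -> sing F v -> exists2 t, t \in s & exists a, v = a *: q t) ->
  sing_reps F (fun i : 'I_(size s) => q (nth d s i)).
Proof.
move=> hT us iq hq all_s; have mem i : (i < size s)%N -> nth d s i \in s by exact: mem_nth.
split=> [i|i|i j ij|v v0 /all_s h].
- apply/eqP => e; have [] := hq _ (mem i (ltn_ord i)).
  by rewrite e linf0 // => /esym/eqP; rewrite oner_eq0.
- by case: (hq _ (mem i (ltn_ord i))).
- have [Ti _] := hq _ (mem i (ltn_ord i)); have [Tj _] := hq _ (mem j (ltn_ord j)).
  move=> a b e; have ab : a + b = 0.
    by have := congr1 T e; rewrite linf0 // linfD // !linfZ // Ti Tj !mulr1.
  have b' : b = - a by apply/eqP; rewrite -addr_eq0 addrC ab.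
  have a0 : a = 0.
    apply: contraNeq ij => a0; rewrite -val_eqE /= -(nth_uniq d _ _ us) //.
    apply/eqP; apply: iq; [exact: mem|exact: mem|].
    apply/eqP; rewrite -subr_eq0 -(can_eq (scalerK a0)) scaler0 scalerBr.
    by rewrite -scaleNr -b' e.
  by rewrite b' a0 oppr0.
have [t ts [a e]] := h v0; have it : (index t s < size s)%N by rewrite index_mem.
by exists (Ordinal it), a; rewrite /= nth_index.
Qed.
End Charts.

Lemma signed_sum (R : comNzRingType) (s : seq nat) (t : seq bool) : size t = size s ->
  \sum_(i < size s) (-1) ^+ nth false t i * (nth 0%N s i)%:R + 2 * (sumn (mask t s))%:R =
  (sumn s)%:R :> R.
Proof.
elim: s t => [|b s IH] [|e t] //= => [_|[st]]; first by rewrite big_ord0; ring.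
rewrite big_ord_recl /= natrD -(IH t st); case: e => /=; rewrite ?natrD; ring.
Qed.

Section RankOne.
Variables (C : numClosedFieldType) (n : nat).
Implicit Types F : 'rV[C]_n -> 'rV[C]_n -> 'rV[C]_n -> C.

(** All minors of order two of the polar quadric vanish: its rank is at most one. *)
Definition double_polar F v := forall a b a' b', F v a b * F v a' b' = F v a b' * F v a' b.

Lemma one_form_polar F k (l : 'I_k -> 'rV[C]_n -> C) j v :
  (forall u v w, F u v w = \sum_i l i u * l i v * l i w) ->
  (forall i, i != j -> l i v = 0) -> double_polar F v.
Proof.
move=> hl hv; have e a b : F v a b = l j v * l j a * l j b.
  by rewrite hl (bigD1 j) //= big1 ?addr0 // => i ij; rewrite hv // !mul0r.
by move=> a b a' b'; rewrite !e; ring.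
Qed.
End RankOne.

Section PlusCube.
Variables (C : numClosedFieldType) (m n : nat) (g : 'I_m.+3 -> 'I_n) (c : 'I_m.+3 -> C) (k : C).
Hypotheses (ig : injective g) (c0 : forall i, c i != 0) (k0 : k != 0).

Definition plus_cube (u v w : 'rV[C]_n) : C := \sum_i c i * u 0 (g i) * v 0 (g i) * w 0 (g i) +
  k * ((\sum_i u 0 (g i)) * (\sum_i v 0 (g i)) * (\sum_i w 0 (g i))).

Let S (v : 'rV[C]_n) := \sum_i v 0 (g i).
Let S_lin : linf S. Proof. by apply: linf_sum => i; exact: linf_coord. Qed.

Lemma plus_cube_trilin : trilin plus_cube.
Proof.
have h1 : trilin (fun u v w : 'rV[C]_n => \sum_i c i * u 0 (g i) * v 0 (g i) * w 0 (g i)).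
  by apply: (@trilin_diag _ _ _ c (fun i v => v 0 (g i))) => i; exact: linf_coord.
have h2 : trilin (fun u v w : 'rV[C]_n => k * (S u * S v * S w)).
  apply: trilin_scale; split=> [v w a u u'|u v w|u v w]; [|ring|ring].
  by rewrite S_lin; ring.
exact: trilin_add h1 h2.
Qed.

Lemma plus_cube_cubes : cubes m.+4 (fun v => plus_cube v v v).
Proof.
have h : forall i, linf (fun v : 'rV[C]_n => v 0 (g i)) by move=> i; exact: linf_coord.
have := cubesD (cubes1 k S_lin) (cubes_sum c h); rewrite add1n => H.
apply: (cubes_ext H) => v; rewrite /plus_cube -/(S v) addrC; congr (_ + _).
  by ring.
by apply: eq_bigr => i _; ring.
Qed.

Lemma plus_cube_singP v : sing plus_cube v <->
  forall i, c i * v 0 (g i) ^+ 2 + k * S v ^+ 2 = 0.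
Proof.
have e w : plus_cube v v w = \sum_i (c i * v 0 (g i) ^+ 2 + k * S v ^+ 2) * w 0 (g i).
  rewrite /plus_cube -/(S v) mulrA [X in _ + X]mulr_sumr -big_split.
  by apply: eq_bigr => i _ /=; ring.
split=> [h i|h w]; last by rewrite e big1 // => i _; rewrite h mul0r.
have := h (delta_mx 0 (g i)); rewrite e (bigD1 i) //= big1 => [|j ji].
  by rewrite mxE !eqxx mulr1 addr0.
by rewrite mxE (inj_eq ig) (negPf ji) andbF mulr0.
Qed.

Lemma plus_cube_polar v i j :
  plus_cube v (delta_mx 0 (g i)) (delta_mx 0 (g j)) = c i * v 0 (g i) * (i == j)%:R + k * S v.
Proof.
have d a b : delta_mx 0 (g a) 0 (g b) = (a == b)%:R :> C by rewrite mxE (inj_eq ig) eq_sym.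
have Sd a : S (delta_mx 0 (g a)) = 1.
  by rewrite /S (bigD1 a) //= big1 ?addr0 ?d ?eqxx // => b ba; rewrite d eq_sym (negPf ba).
rewrite /plus_cube -/(S _) -/(S (delta_mx 0 (g i))) -/(S (delta_mx 0 (g j))) !Sd !mulr1.
congr (_ + _); rewrite (bigD1 i) //= big1 ?addr0 => [|a ai].
  by rewrite !d eqxx mulr1 eq_sym.
by rewrite !d [i == a]eq_sym (negPf ai) mulr0 mul0r.
Qed.

(** The polar quadric of [v] is diagonal with entries [a i = c i * v 0 (g i)], up to adding
[k * S v] to all entries. Its minors of order two give [a i * S v = 0] and
[a i * a j = 0], so at most one [a i] is nonzero, and then it determines [S v]. *)
Lemma plus_cube_double_polar v : double_polar plus_cube v -> forall i, v 0 (g i) = 0.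
Proof.
move=> h; pose a i := c i * v 0 (g i).
have P i j : plus_cube v (delta_mx 0 (g i)) (delta_mx 0 (g j)) = a i * (i == j)%:R + k * S v.
  exact: plus_cube_polar.
have others (i j : 'I_m.+3) : exists l, (l != i) && (l != j).
  apply/existsP; apply: contraT; rewrite negb_exists => /forallP no.
  have : (#|[set: 'I_m.+3]| <= #|[set i; j]|)%N.
    by apply: subset_leq_card; apply/subsetP => l _; rewrite !inE; have := no l; do 2!case: eqP.
  rewrite cardsT card_ord cards2; by case: (i != j).
have aS i : a i * (k * S v) = 0.
  have [j /andP[ji _]] := others i i; have [l /andP[li lj]] := others i j.
  have := h (delta_mx 0 (g i)) (delta_mx 0 (g i)) (delta_mx 0 (g j)) (delta_mx 0 (g l)).
  rewrite !P eqxx [j == l]eq_sym [i == l]eq_sym (negPf li) (negPf lj) (negPf ji) /= !mulr0n !mulr1n.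
  by move/eqP; rewrite -subr_eq0 => /eqP e; rewrite -[RHS]e; ring.
have aa i j : i != j -> a i * a j = 0.
  move=> ij; have := h (delta_mx 0 (g i)) (delta_mx 0 (g i)) (delta_mx 0 (g j)) (delta_mx 0 (g j)).
  rewrite !P !eqxx [j == i]eq_sym (negPf ij) /= !mulr0n !mulr1n => /eqP; rewrite -subr_eq0 => /eqP e.
  via (a i * 1 * (a j * 1) + (a i * (k * S v) + a j * (k * S v)) ); first by rewrite !aS; ring.
  by rewrite -[RHS]e; ring.
have x0 i : a i = 0 -> v 0 (g i) = 0.
  by move/eqP; rewrite mulf_eq0 (negPf (c0 i)) => /eqP.
have [S0|S0] := eqVneq (S v) 0; last first.
  move=> i; apply: x0; apply: (mulIf (_ : k * S v != 0)); rewrite ?mulf_neq0 //.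
  by rewrite aS mul0r.
move=> i; apply/eqP; apply: contraT => vi.
have ai : a i != 0 by rewrite mulf_neq0.
move: S0; rewrite /S (bigD1 i) //= big1 ?addr0 => [/eqP|j ji]; first by rewrite (negPf vi).
by apply: x0; apply: (mulfI ai); rewrite aa ?mulr0 // eq_sym.
Qed.
End PlusCube.

Section SignedPoints.
Variables (C : numClosedFieldType) (n : nat) (bs : seq nat).
Hypotheses (sb : size bs = n.+1) (pb : all (leq 1) bs).

(** The sequence [t] marks the entries of [bs] that get a minus sign. *)
Definition signed (t : seq bool) (i : 'I_n.+1) : C := (-1) ^+ nth false t i * (nth 0%N bs i)%:R.

Lemma bs_neq0 (i : 'I_n.+1) : (nth 0%N bs i)%:R != 0 :> C.
Proof.
by rewrite pnatr_eq0 -lt0n; move/allP: pb; apply; apply: mem_nth; rewrite sb.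
Qed.

Lemma signed_sq t i : signed t i ^+ 2 = (nth 0%N bs i)%:R ^+ 2.
Proof. by rewrite /signed exprMn sqrr_sign mul1r. Qed.

Lemma signed_exists (y : 'I_n.+1 -> C) : (forall i, y i ^+ 2 = (nth 0%N bs i)%:R ^+ 2) ->
  exists2 t, size t = n.+1 & forall i, y i = signed t i.
Proof.
move=> h; exists (mkseq (fun i => y (inord i) == - (nth 0%N bs i)%:R) n.+1) => [|i].
  by rewrite size_mkseq.
rewrite /signed nth_mkseq // inord_val; have := h i.
move/eqP; rewrite eqf_sqr; case: (y i =P - (nth 0%N bs i)%:R) => [->|ne] /=.
  by rewrite mulN1r.
by rewrite orbF mul1r => /eqP.
Qed.

Lemma signed_inj t t' : size t = n.+1 -> size t' = n.+1 ->
  (forall i, signed t i = signed t' i) -> t = t'.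
Proof.
move=> st st' h; apply: (@eq_from_nth _ false) => [|i]; first by rewrite st.
rewrite st => hi; have := h (Ordinal hi); move/(mulIf (bs_neq0 _)) => /=.
case: (nth _ t i) (nth _ t' i) => [] [] //= /eqP; rewrite ?expr1 ?expr0 => /eqP.
  by move/eqP; rewrite -subr_eq0 -opprD oppr_eq0 (pnatr_eq0 _ 2).
by move/eqP; rewrite eq_sym -subr_eq0 -opprD oppr_eq0 (pnatr_eq0 _ 2).
Qed.

Lemma signed_total t : size t = n.+1 ->
  \sum_i signed t i = (sumn bs)%:R - 2 * (sumn (mask t bs))%:R.
Proof.
move=> st; rewrite -(@signed_sum C bs t) ?sb // addrK.
by rewrite /signed; move: sb => e; case: _ / e.
Qed.
End SignedPoints.

Section Examples.
Variable C : numClosedFieldType.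

(** Up to the passage between forms and polynomials: rank [r] and [k] singular points. *)
Definition realized r k := exists F : 'rV[C]_4 -> 'rV[C]_4 -> 'rV[C]_4 -> C,
  [/\ trilin F, cubes r (fun v => F v v v), ~ cubes r.-1 (fun v => F v v v)
    & exists p : 'I_k -> 'rV[C]_4, sing_reps F p].

Lemma plus_cube_not_cubes4 (g : 'I_4 -> 'I_4) c k : injective g -> (forall i, c i != 0) -> k != 0 ->
  ~ cubes 4 (fun v => @plus_cube C 1 4 g c k v v v).
Proof.
move=> ig c0 k0 /(cubes_trilin (plus_cube_trilin g c k)) [l [hl Fl]].
have [v v0 hv] := @common_zero C 4 3 (fun i => l (lift ord0 i)) (fun i => hl _) isT.
have dp : double_polar (plus_cube g c k) v.
  apply: (one_form_polar (j := ord0) Fl) => i.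
  by case: (unliftP ord0 i) => [j ->|->]; [rewrite hv|rewrite eqxx].
have x0 := plus_cube_double_polar ig c0 k0 dp.
move/eqP: v0; apply; apply/rowP => i; rewrite mxE.
have [h gh hg] : bijective g by exact: injF_bij.
by rewrite -(hg i) x0.
Qed.

(** At a singular point [x_i = +- b_i * s] with [s] the sum of the coordinates. It is not
zero, and for [s = 1] the signed sum of the [b_i] is one, so the marked entries sum to
[(sumn bs - 1) / 2]. *)
Lemma rank5_of_patterns bs pats : size bs = 4%N -> all (leq 1) bs -> uniq pats ->
  (forall t, t \in pats -> size t = 4%N) ->
  (forall t, size t = 4%N -> (t \in pats) = (sumn bs == 1 + 2 * sumn (mask t bs))%N) ->
  realized 5 (size pats).
Proof.
move=> sb pb up szp hp.
have b0 := bs_neq0 C sb pb.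
pose c (i : 'I_4) : C := ((nth 0%N bs i)%:R ^+ 2)^-1.
have c0 i : c i != 0 by rewrite invr_eq0 expf_neq0.
have k0 : (-1 : C) != 0 by rewrite oppr_eq0 oner_eq0.
exists (@plus_cube C 1 4 id c (-1)); split.
- exact: plus_cube_trilin.
- exact: plus_cube_cubes.
- exact: plus_cube_not_cubes4.
pose q t : 'rV[C]_4 := \row_i signed C bs t i.
pose S (v : 'rV[C]_4) := \sum_i v 0 i.
have hS : linf S by apply: linf_sum => i; exact: linf_coord.
have Sq t : S (q t) = \sum_(i < 4) signed C bs t i.
  by rewrite /S; apply: eq_bigr => i _; rewrite mxE.
exists (fun i => q (nth [::] pats i)); apply: (@sing_reps_of_chart C _ _ [::] pats q S) => //.
- move=> t t' /szp st /szp st' e; apply: (signed_inj sb pb st st' (C := C)) => i.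
  by have /rowP/(_ i) := e; rewrite !mxE.
- move=> t tp; have st := szp t tp; have S1 : S (q t) = 1.
    rewrite Sq (signed_total C sb st); move: tp; rewrite hp // => /eqP ->.
    by rewrite natrD natrM; ring.
  split=> //; apply/plus_cube_singP => // i.
  by rewrite -/(S _) S1 mxE signed_sq mulVf ?expf_neq0 //; ring.
move=> v v0 /plus_cube_singP h; have {}h i : c i * v 0 i ^+ 2 = S v ^+ 2.
  by have := h (fun _ _ => id) i; rewrite mulN1r => /eqP; rewrite subr_eq0 => /eqP.
have S0 : S v != 0.
  apply: contraNneq v0 => S0; apply/eqP/rowP => i; rewrite mxE; apply/eqP.
  by have /eqP := h i; rewrite S0 expr0n mulf_eq0 (negPf (c0 i)) sqrf_eq0.
have [i|t st ht] := @signed_exists C 3 bs (fun i => v 0 i / S v).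
  rewrite expr_div_n.
  have -> : v 0 i ^+ 2 = (nth 0%N bs i)%:R ^+ 2 * S v ^+ 2.
    by rewrite -(h i) /c mulrA divff ?mul1r ?expf_neq0.
  by rewrite mulfK ?expf_neq0.
have vq : v = S v *: q t.
  by apply/rowP => i; rewrite !mxE -ht mulrCA divff // mulr1.
exists t; last by exists (S v).
rewrite hp //; have /eqP : S v = S v * S (q t).
  by rewrite {1}vq linfZ.
rewrite -{1}[S v]mulr1 (inj_eq (mulfI S0)) Sq (signed_total C sb st).
by rewrite eq_sym subr_eq -natrM -(natrD _ 1) eqr_nat.
Qed.

Lemma rank5_realized k : (k <= 4)%N -> realized 5 k.
Proof.
have ex bs pats : size bs = 4%N -> all (leq 1) bs -> uniq pats -> all (fun t => size t == 4%N) pats ->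
    (forall a b c d, ([:: a; b; c; d] \in pats) = (sumn bs == 1 + 2 * sumn (mask [:: a; b; c; d] bs))%N) ->
    realized 5 (size pats).
  move=> sb pb up sp h; apply: (rank5_of_patterns sb pb up) => [t /(allP sp)/eqP|t] //.
  by case: t => [|a [|b [|c [|d [|]]]]].
case: k => [|[|[|[|[|]]]]] // _.
- by apply: (ex [:: 1; 1; 1; 1]%N [::]) => // [] [] [] [] [].
- by apply: (ex [:: 1; 2; 4; 8]%N [:: [:: true; true; true; false]]) => // [] [] [] [] [].
- by apply: (ex [:: 5; 5; 3; 2]%N [:: [:: true; false; false; true];
    [:: false; true; false; true]]) => // [] [] [] [] [].
- by apply: (ex [:: 3; 3; 3; 2]%N [:: [:: true; false; false; true];
    [:: false; true; false; true]; [:: false; false; true; true]]) => // [] [] [] [] [].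
by apply: (ex [:: 1; 1; 1; 2]%N [:: [:: false; false; false; true]; [:: true; true; false; false];
    [:: true; false; true; false]; [:: false; true; true; false]]) => // [] [] [] [] [].
Qed.

End Examples.

Section SmallExamples.
Variable C : numClosedFieldType.
Local Notation x i v := (v 0 (i : 'I_4)).

Lemma coord_delta (i j : 'I_4) : x i (delta_mx 0 j : 'rV[C]_4) = (i == j)%:R.
Proof. by rewrite mxE. Qed.

Lemma one_sing_rep (F : 'rV[C]_4 -> 'rV[C]_4 -> 'rV[C]_4 -> C) : sing F (delta_mx 0 ord_max) ->
  (forall v, sing F v -> forall i, i != ord_max -> v 0 i = 0) ->
  sing_reps F (fun _ : 'I_1 => delta_mx 0 ord_max).
Proof.
move=> h1 h2; split=> [_|_|i j|v _ /h2 h].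
- apply/eqP => /rowP /(_ ord_max); rewrite !mxE !eqxx => /eqP.
  by rewrite oner_eq0.
- exact: h1.
- by rewrite !ord1.
exists 0, (v 0 ord_max); apply/rowP => i; rewrite !mxE.
have [->|im] := eqVneq i ord_max; first by rewrite eqxx mulr1.
by rewrite (h i im) mulr0.
Qed.

Lemma rank3_one_singular : realized C 3 1.
Proof.
pose g : 'I_3 -> 'I_4 := lift ord_max.
pose F (u v w : 'rV[C]_4) := \sum_i 1 * u 0 (g i) * v 0 (g i) * w 0 (g i).
have hl (i : 'I_3) : linf (fun v : 'rV[C]_4 => v 0 (g i)) by exact: linf_coord.
have hF : trilin F by apply: (@trilin_diag C 4 3 (fun=> 1) (fun i v => v 0 (g i))).
have nF : sing_reps F (fun _ : 'I_1 => delta_mx 0 ord_max).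
  apply: one_sing_rep => [u|v h i].
    by rewrite /F big1 // => i _; rewrite coord_delta eq_sym (negPf (neq_lift _ _)) /= mulr0n; ring.
  case: (unliftP ord_max i) => [j -> _|->]; last by rewrite eqxx.
  have := h (delta_mx 0 (g j)); rewrite /F (bigD1 j) //= big1 => [|l lj].
    by rewrite coord_delta eqxx mulr1 mul1r addr0 => /eqP; rewrite mulf_eq0 orbb => /eqP.
  by rewrite coord_delta (inj_eq lift_inj) (negPf lj) mulr0.
exists F; split=> //.
- apply: (cubes_ext (cubes_sum (fun=> 1) hl)) => v; apply: eq_bigr => i _ /=; ring.
- exact: cubes2_infinite (sing_reps_finite nF).
by exists (fun=> delta_mx 0 ord_max).
Qed.

Lemma rank4_smooth : realized C 4 0.
Proof.
pose F (u v w : 'rV[C]_4) := \sum_i 1 * u 0 i * v 0 i * w 0 i.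
have hl (i : 'I_4) : linf (fun v : 'rV[C]_4 => v 0 i) by exact: linf_coord.
have hF : trilin F by apply: (@trilin_diag C 4 4 (fun=> 1) (fun i v => v 0 i)).
have nF v : sing F v -> v = 0.
  move=> h; apply/rowP => i; rewrite mxE; have := h (delta_mx 0 i).
  rewrite /F (bigD1 i) //= big1 => [|l lj].
    by rewrite coord_delta eqxx mulr1 mul1r addr0 => /eqP; rewrite mulf_eq0 orbb => /eqP.
  by rewrite coord_delta (negPf lj) mulr0.
exists F; split=> //.
- apply: (cubes_ext (cubes_sum (fun=> 1) hl)) => v; apply: eq_bigr => i _ /=; ring.
- by move=> h; have [v v0 /nF e] := cubes3_singular hF h; rewrite e eqxx in v0.
exists (fun=> 0); split=> [[]|[]|[]|v v0 /nF e] //.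
by rewrite e eqxx in v0.
Qed.

Lemma rank4_one_singular : realized C 4 1.
Proof.
pose g : 'I_3 -> 'I_4 := lift ord_max.
have ig : injective g by exact: lift_inj.
pose F := @plus_cube C 0 4 g (fun=> 1) 1.
have hF : trilin F by exact: plus_cube_trilin.
have c0 (i : 'I_3) : (1 : C) != 0 by exact: oner_neq0.
have nF : sing_reps F (fun _ : 'I_1 => delta_mx 0 ord_max).
  have gm i : x (g i) (delta_mx 0 ord_max : 'rV[C]_4) = 0.
    by rewrite coord_delta eq_sym (negPf (neq_lift _ _)).
  apply: one_sing_rep => [|v /(plus_cube_singP _ _ ig) h i].
    apply/(plus_cube_singP _ _ ig) => i; rewrite gm big1 => [|j _]; last exact: gm.
    by ring.
  case: (unliftP ord_max i) => [j -> _|->]; last by rewrite eqxx.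
  set S := \sum_i _ in h; have [S0|S0] := eqVneq S 0.
    by have /eqP := h j; rewrite S0 expr0n mulr0 addr0 mul1r sqrf_eq0 => /eqP.
  have I2 : ('i : C) ^+ 2 = -1 by exact: sqrCi.
  have I0 : ('i : C) != 0 by exact: neq0Ci.
  have [l|t st ht] := @signed_exists C 2 [:: 1; 1; 1]%N (fun l => v 0 (g l) / ('i * S)).
    have /eqP := h l; rewrite !mul1r addr_eq0 => /eqP e.
    rewrite expr_div_n e exprMn I2 mulN1r divff ?oppr_eq0 ?expf_neq0 //.
    by case: l {e} => [[|[|[|l]]]] //=; rewrite expr1n.
  have vE l : v 0 (g l) = 'i * S * signed C [:: 1; 1; 1]%N t l.
    by rewrite -ht mulrCA divff ?mulr1 ?mulf_neq0.
  have : S = 'i * S * \sum_(l < 3) signed C [:: 1; 1; 1]%N t l.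
    by rewrite {1}/S mulr_sumr; apply: eq_bigr => l _.
  rewrite (signed_total _ _ st) //; set z := _ - _ => e.
  (* the coordinates are [+- 'i * S], and [z] is the sum of three signs, hence real *)
  have iz : 'i * z = 1 by apply: (mulIf S0); rewrite mul1r {2}e mulrAC.
  have /eqP : 1 + z ^+ 2 = 0.
    have : ('i * z) ^+ 2 = 1 by rewrite iz expr1n.
    by rewrite exprMn I2 mulN1r => {1}<-; rewrite addNr.
  have ne (a : nat) : 1 + z ^+ 2 = a.+1%:R -> 1 + z ^+ 2 == 0 -> v 0 (g j) = 0.
    by move=> ->; rewrite pnatr_eq0.
  move: ne; rewrite /z; case: t st {ht vE e iz z} => [|[] [|[] [|[] [|]]]] //= _ ne;
    first [by apply: (ne 9%N); ring|by apply: (ne 1%N); ring].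
exists F; split=> //; [exact: plus_cube_cubes| |by exists (fun=> delta_mx 0 ord_max)].
move=> /(cubes_trilin hF) [l [hl Fl]].
pose L (i : 'I_3) (v : 'rV[C]_4) := if i == ord0 then v 0 ord_max else l i v.
have hL i : linf (L i).
  by rewrite /L; case: eqP => _ //; exact: linf_coord.
have [v v0 hv] := @common_zero C 4 3 L hL isT.
have dp : double_polar F v.
  by apply: (one_form_polar (j := ord0) Fl) => i i0; have := hv i; rewrite /L (negPf i0).
move/eqP: v0; apply; apply/rowP => i; rewrite mxE.
case: (unliftP ord_max i) => [j ->|->]; last exact: hv ord0.
by apply: (plus_cube_double_polar ig c0 (oner_neq0 C) dp).
Qed.
End SmallExamples.

Section FiveCubes.
Variables (C : numClosedFieldType) (F : 'rV[C]_4 -> 'rV[C]_4 -> 'rV[C]_4 -> C)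
  (T : 'rV[C]_4 -> C) (w : 'rV[C]_4).
Hypotheses (hF : trilin F) (hT : linf T) (Tw : T w != 0)
  (no_double : forall v, double_polar F v -> v = 0)
  (corank2 : forall v k1 k2, prop_free k1 k2 -> (forall u, F v k1 u = 0) ->
     (forall u, F v k2 u = 0) -> T v = 0 \/ exists a, v = a *: w).

(** Any four of five summands are coordinates, and the dual basis vectors have polars
of rank at most two. They do not all lie in the plane [T = 0], so [w] is one of them
up to a factor, and three of the four forms vanish at [w]. Leaving out one of these
three instead gives a fourth form vanishing at [w], whose polar is then a double
plane. *)
Lemma not_five_cubes : ~ cubes 5 (fun v => F v v v).
Proof.
move=> /(cubes_trilin hF) [l [hl Fl]].
have free4 m v : (forall i, l (lift m i) v = 0) -> v = 0.
  move=> h; apply: no_double; apply: (one_form_polar (j := m) Fl) => i.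
  by case: (unliftP m i) => [j ->|->]; [rewrite h|rewrite eqxx].
have w0 : w != 0 by apply: contraNneq Tw => ->; rewrite linf0.
have pair m : exists i, forall j, j != i -> l (lift m j) w = 0.
  have [A hA] := linf_mx (fun i => hl (lift m i)).
  have uA : A \in unitmx.
    apply: contraT => /singular_ker [v v0 e]; move/eqP: v0; case; apply: (free4 m) => i.
    by rewrite hA e mxE.
  pose v i : 'rV[C]_4 := delta_mx 0 i *m invmx A.
  have lv i j : l (lift m j) (v i) = (j == i)%:R by rewrite hA mulmxKV // !mxE.
  have [i Tv] : exists i, T (v i) != 0.
    apply/existsP; apply: contraT; rewrite negb_exists => /forallP Tv.
    move/eqP: Tw; case.
    have -> : w = \sum_i (w *m A) 0 i *: v i.
      rewrite -{1}[w](mulmxK uA) {1}[w *m A]row_sum_delta mulmx_suml.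
      by apply: eq_bigr => i _; rewrite -scalemxAl.
    elim/big_rec: _ => [|i x _ IH]; first exact: linf0.
    by rewrite linfD // linfZ // IH; have := Tv i; rewrite negbK => /eqP ->; rewrite mulr0 addr0.
  have [k1 [k2 [k12 [a1 b1] [a2 b2]]]] := common_zeros_pair (hl (lift m i)) (hl m) isT.
  have Fv k u : l (lift m i) k = 0 -> l m k = 0 -> F (v i) k u = 0.
    move=> e1 e2; rewrite Fl big1 // => j _.
    case: (unliftP m j) => [j' ->|->]; last by rewrite e2 mulr0 mul0r.
    rewrite lv; case: eqP => [->|_]; last by rewrite !mul0r.
    by rewrite e1 mulr0 mul0r.
  exists i => j ji.
  have [Tvi|[a e]] := corank2 k12 (fun u => Fv k1 u a1 b1) (fun u => Fv k2 u a2 b2).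
    by rewrite Tvi eqxx in Tv.
  have a0 : a != 0 by apply: contraNneq Tv => a0; rewrite e a0 scale0r linf0.
  apply: (mulfI a0); rewrite -linfZ // -e lv (negPf ji).
  by rewrite mulr0.
have [i hi] := pair ord0.
have [m mi] : exists m : 'I_4, m != i.
  by exists (lift i ord0); rewrite eq_sym neq_lift.
have [i' hi'] := pair (lift ord0 m).
move/eqP: w0; case; apply: (free4 (lift (lift ord0 m) i')) => j.
set J := lift _ j; case: (unliftP (lift ord0 m) J) => [j' eJ|->]; last exact: hi.
rewrite eJ; apply: hi'; apply/eqP => e; have := neq_lift (lift (lift ord0 m) i') j.
by rewrite -/J eJ e eqxx.
Qed.
End FiveCubes.

Section NodalFamily.
Variables (C : numClosedFieldType) (bs : seq nat) (d : nat).
Hypotheses (sb : size bs = 3%N) (pb : all (leq 1) bs).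

Let a (i : 'I_3) : C := (nth 0%N bs i)%:R.
Let x (i : 'I_3) (v : 'rV[C]_4) : C := v 0 (lift ord0 i).
Let w (v : 'rV[C]_4) : C := v 0 ord0.
Let L (v : 'rV[C]_4) := \sum_i a i ^+ 2 * x i v.
Let e i : 'rV[C]_4 := delta_mx 0 (lift ord0 i).
Let e0 : 'rV[C]_4 := delta_mx 0 ord0.

(** The polarization of [x^3 + y^3 + z^3 - 3 w^2 L + d w^3], with [L] the combination of [x],
[y], [z] with the squares of the entries of [bs] as coefficients; [w] is the coordinate
of index zero. *)
Definition nodal_cubic (u v z : 'rV[C]_4) : C := \sum_i 1 * x i u * x i v * x i z
  + ((-1) * (w u * w v * L z + w u * L v * w z + L u * w v * w z)
     + d%:R * (w u * w v * w z)).

Let hx i : linf (x i). Proof. exact: linf_coord. Qed.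
Let hw : linf w. Proof. exact: linf_coord. Qed.
Let hL : linf L. Proof. by apply: linf_sum => i; apply: linf_sc. Qed.

Lemma nodal_cubic_trilin : trilin nodal_cubic.
Proof.
apply: trilin_add; first exact: (@trilin_diag C 4 3 (fun=> 1) x hx).
apply: trilin_add; apply: trilin_scale; first exact: trilin_tangent.
by split=> [v z k u u'|u v z|u v z] /=; [rewrite hw| |]; ring.
Qed.

Let a0 i : a i != 0. Proof. exact: (bs_neq0 C sb pb). Qed.
Let xe i j : x i (e j) = (i == j)%:R.
Proof. by rewrite /x /e mxE (inj_eq lift_inj). Qed.
Let xe0 i : x i e0 = 0. Proof. by rewrite /x /e0 mxE. Qed.
Let we i : w (e i) = 0. Proof. by rewrite /w /e mxE. Qed.
Let we0 : w e0 = 1. Proof. by rewrite /w /e0 mxE. Qed.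
Let Le i : L (e i) = a i ^+ 2.
Proof.
rewrite /L (bigD1 i) //= big1 ?addr0 => [|j ji]; rewrite xe; first by rewrite eqxx mulr1.
by rewrite (negPf ji) mulr0.
Qed.
Let Le0 : L e0 = 0. Proof. by rewrite /L big1 // => i _; rewrite xe0 mulr0. Qed.

Let coords v : w v = 0 -> (forall i, x i v = 0) -> v = 0.
Proof.
move=> w0 x0; apply/rowP => i; rewrite mxE.
by case: (unliftP ord0 i) => [j ->|->]; [exact: x0|exact: w0].
Qed.

Let Fe v k i : nodal_cubic v k (e i) = x i v * x i k - a i ^+ 2 * w v * w k.
Proof.
rewrite /nodal_cubic we Le (bigD1 i) //= big1 => [|j ji].
  by rewrite xe eqxx mulr1n; ring.
by rewrite xe (negPf ji) mulr0.
Qed.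

Let Fe0 v k : nodal_cubic v k e0 = d%:R * w v * w k - w v * L k - L v * w k.
Proof.
rewrite /nodal_cubic we0 Le0 big1 => [|j _]; first by ring.
by rewrite xe0 mulr0.
Qed.

Lemma nodal_cubic_double v : double_polar nodal_cubic v -> v = 0.
Proof.
move=> h; have w0 : w v = 0.
  have := h (e ord0) (e (lift ord0 ord0)) e0 e0; rewrite !Fe !Fe0 !xe xe0 !we we0 !Le.
  move=> /eqP; rewrite -subr_eq0 => /eqP q.
  have /eqP : (a ord0 ^+ 2 * a (lift ord0 ord0) ^+ 2) * w v ^+ 2 = 0.
    rewrite -[RHS]oppr0 -q /= mulr0n; ring.
  have nz : a ord0 ^+ 2 * a (lift ord0 ord0) ^+ 2 != 0 by rewrite mulf_neq0 ?expf_neq0.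
  by rewrite mulf_eq0 (negPf nz) sqrf_eq0 => /eqP.
apply: coords => // i; have xx j : j != i -> x i v * x j v = 0.
  move=> ji; have := h (e i) (e i) (e j) (e j).
  rewrite !Fe !xe !we !eqxx [i == j]eq_sym (negPf ji) /= !mulr1n !mulr0n => q.
  move/eqP: q; rewrite -subr_eq0 => /eqP q; rewrite -[RHS]q; ring.
apply/eqP; apply: contraT => xi.
have LE : L v = a i ^+ 2 * x i v.
  rewrite /L (bigD1 i) //= big1 ?addr0 // => j ji.
  by have /eqP := xx j ji; rewrite mulf_eq0 (negPf xi) => /eqP ->; rewrite mulr0.
have := h (e i) (e i) e0 e0; rewrite !Fe !Fe0 !xe xe0 !we we0 !Le w0 LE eqxx mulr1n.
move/eqP; rewrite -subr_eq0 => /eqP q.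
have /eqP : a i ^+ 2 * x i v ^+ 2 = 0 by rewrite -[RHS]oppr0 -q; ring.
by rewrite mulf_eq0 (negPf (expf_neq0 2 (a0 _))) sqrf_eq0 (negPf xi).
Qed.

(** A kernel vector with zero [w]-coordinate satisfies [x i v * x i k = 0] for all [i] and
[L k = 0]. If [w v] and some [x i v] are nonzero, these vectors are at most one up to a
factor, and a kernel vector with nonzero [w]-coordinate forces all [x i v] to be
nonzero, which leaves no others. *)
Lemma nodal_cubic_corank2 v k1 k2 : prop_free k1 k2 -> (forall u, nodal_cubic v k1 u = 0) ->
  (forall u, nodal_cubic v k2 u = 0) -> w v = 0 \/ exists t, v = t *: e0.
Proof.
move=> free h1 h2; have [|wv] := eqVneq (w v) 0; [by left|right].
have ker s t u : nodal_cubic v (s *: k1 + t *: k2) u = 0.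
  by rewrite !(trilE nodal_cubic_trilin) h1 h2; ring.
have key k : (forall u, nodal_cubic v k u = 0) -> w k = 0 ->
    (forall i, x i v * x i k = 0) /\ L k = 0.
  move=> hk wk; split=> [i|].
    by have := hk (e i); rewrite Fe wk mulr0 subr0.
  have /eqP := hk e0; rewrite Fe0 wk !mulr0 sub0r subr0 oppr_eq0 mulf_eq0 (negPf wv).
  by move/eqP.
apply: boolp.contrapT => nv.
have [i xi] : exists i, x i v != 0.
  apply: boolp.contrapT => nx; apply: nv; exists (w v).
  apply/eqP; rewrite -subr_eq0; apply/eqP; apply: coords => [|i].
    by rewrite linfB // linfZ // we0; ring.
  rewrite linfB // linfZ // xe0 mulr0 subr0.
  by apply/eqP; apply: boolp.contrapT => /negP q; apply: nx; exists i.
have onedim s t : w (s *: k1 + t *: k2) = 0 -> (forall j, x j v != 0) -> s = 0 /\ t = 0.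
  move=> wk all0; apply: free; apply: coords => // j.
  have [/(_ j) /eqP + _] := key _ (ker s t) wk.
  by rewrite mulf_eq0 (negPf (all0 j)) => /eqP.
have all_nz k : (forall u, nodal_cubic v k u = 0) -> w k != 0 -> forall j, x j v != 0.
  move=> hk wk j; apply: contraNneq (_ : a j ^+ 2 * w v * w k != 0) => [z|].
    by have /eqP := hk (e j); rewrite Fe z mul0r sub0r oppr_eq0.
  by rewrite !mulf_neq0 // expf_neq0.
have wcomb : w (w k2 *: k1 + (- w k1) *: k2) = 0.
  by rewrite linfD // !linfZ //; ring.
have wk : w k1 = 0 /\ w k2 = 0.
  have [w1|w1] := eqVneq (w k1) 0; last first.
    have [_ /eqP] := onedim _ _ wcomb (all_nz _ h1 w1).
    by rewrite oppr_eq0 (negPf w1).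
  split=> //; have [//|w2] := eqVneq (w k2) 0.
  have [/eqP q _] := onedim _ _ wcomb (all_nz _ h2 w2).
  by rewrite (negPf w2) in q.
case: wk => w1 w2.
pose j := lift i ord0; pose l := lift i (lift ord0 ord0).
have xi0 k : (forall j, x j v * x j k = 0) -> x i k = 0.
  by move=> /(_ i) /eqP; rewrite mulf_eq0 (negPf xi) => /eqP.
have LE k : x i k = 0 -> L k = a j ^+ 2 * x j k + a l ^+ 2 * x l k.
  by move=> z; rewrite /L (bigD1_ord i) //= z mulr0 add0r !big_ord_recl big_ord0 addr0.
have split_ij b : [\/ b = i, b = j | b = l].
  case: (unliftP i b) => [b' ->|->]; last by apply: Or31.
  case: (unliftP ord0 b') => [b'' ->|->]; last by apply: Or32.
  by apply: Or33; rewrite (ord1 b'').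
have vanish s t : w (s *: k1 + t *: k2) = 0 -> x j (s *: k1 + t *: k2) = 0 -> s = 0 /\ t = 0.
  move=> wz xj; apply: free; have [q Lz] := key _ (ker s t) wz.
  have xl : x l (s *: k1 + t *: k2) = 0.
    move/eqP: Lz; rewrite LE; last exact: xi0.
    by rewrite xj mulr0 add0r mulf_eq0 (negPf (expf_neq0 2 (a0 _))) => /eqP.
  by apply: coords => // b; case: (split_ij b) => ->; rewrite ?xj ?xl // xi0.
have wz s t : w (s *: k1 + t *: k2) = 0 by rewrite linfD // !linfZ // w1 w2; ring.
have [||xj2 /eqP] := vanish (x j k2) (- x j k1); [exact: wz|by rewrite linfD // !linfZ //; ring|].
rewrite oppr_eq0 => /eqP xj1.
have [|/eqP] := vanish 1 0 (wz _ _); last by rewrite oner_eq0.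
by rewrite linfD // !linfZ // xj1 xj2; ring.
Qed.

Lemma nodal_cubic_singP v : sing nodal_cubic v <->
  (forall i, x i v ^+ 2 = a i ^+ 2 * w v ^+ 2) /\ d%:R * w v ^+ 2 = 2 * w v * L v.
Proof.
split=> [h|[h1 h2] u].
  split=> [i|]; [have := h (e i); rewrite Fe|have := h e0; rewrite Fe0];
    move/eqP; rewrite -subr_eq0 => /eqP q; apply/eqP; rewrite -subr_eq0 -q; apply/eqP; ring.
have -> : nodal_cubic v v u = \sum_i (x i v ^+ 2 - a i ^+ 2 * w v ^+ 2) * x i u
    + (d%:R * w v ^+ 2 - 2 * w v * L v) * w u.
  have -> : \sum_i (x i v ^+ 2 - a i ^+ 2 * w v ^+ 2) * x i u =
      \sum_i 1 * x i v * x i v * x i u - w v ^+ 2 * L u.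
    by rewrite /L mulr_sumr -sumrB; apply: eq_bigr => i _; ring.
  by rewrite /nodal_cubic; ring.
by rewrite h2 subrr mul0r addr0 big1 // => i _; rewrite h1 subrr mul0r.
Qed.

Let cs := [seq (b ^ 3)%N | b <- bs].

(** At a singular point [x_i = +- b_i * w] with [w] nonzero, and for [w = 1] the remaining
equation says that twice the signed sum of the cubes of the [b_i] is [d]. *)
Lemma rank6_of_patterns pats : uniq pats -> (forall t, t \in pats -> size t = 3%N) ->
  (forall t, size t = 3%N -> (t \in pats) =
    (2 * sumn cs == d + 4 * sumn (mask t cs))%N) ->
  realized C 6 (size pats).
Proof.
move=> up szp hp.
pose q t : 'rV[C]_4 := e0 + \sum_i signed C bs t i *: e i.
have wq t : w (q t) = 1.
  rewrite /q linfD // we0 big_ord_recl !big_ord_recl big_ord0 addr0 !linfD // !linfZ // !we.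
  by ring.
have xq t i : x i (q t) = signed C bs t i.
  rewrite /q linfD // xe0 add0r.
  have -> : x i (\sum_l signed C bs t l *: e l) = \sum_l signed C bs t l * x i (e l).
    by elim/big_rec2: _ => [|l y z _ <-]; rewrite ?linf0 // linfD ?linfZ.
  by rewrite (bigD1 i) //= big1 ?addr0 => [|l li]; rewrite xe ?eqxx ?mulr1 // eq_sym (negPf li) mulr0.
have Lq t : size t = 3%N -> L (q t) = (sumn cs)%:R
    - 2 * (sumn (mask t cs))%:R.
  move=> st; rewrite -(@signed_total C 2 cs _ t) ?size_map //.
  apply: eq_bigr => i _; rewrite xq /signed /cs (nth_map 0%N) ?sb // natrX /a; ring.
have nF : sing_reps nodal_cubic (fun i : 'I_(size pats) => q (nth [::] pats i)).
  apply: (@sing_reps_of_chart C _ _ [::] pats q w) => //.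
  - move=> t t' /szp st /szp st' eq; apply: (signed_inj sb pb st st' (C := C)) => i.
    by rewrite -!xq eq.
  - move=> t tp; split=> //; apply/nodal_cubic_singP; split=> [i|].
      by rewrite xq wq signed_sq; ring.
    have st := szp t tp; move: tp; rewrite hp // => /eqP /(congr1 (fun n => n%:R : C)).
    rewrite wq Lq // natrM natrD natrM => E.
    apply/eqP; rewrite -subr_eq0; apply/eqP.
    move/eqP: E; rewrite -subr_eq0 => /eqP E; rewrite -[RHS]oppr0 -E; ring.
  move=> v v0 /nodal_cubic_singP [h1 h2].
  have wv : w v != 0.
    apply: contraNneq v0 => w0; apply/eqP/coords => // i.
    by have /eqP := h1 i; rewrite w0 expr0n mulr0 sqrf_eq0 => /eqP.
  have [i|t st ht] := @signed_exists C 2 bs (fun i => x i v / w v).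
    by rewrite expr_div_n h1 mulfK ?expf_neq0.
  have vq : v = w v *: q t.
    apply/eqP; rewrite -subr_eq0; apply/eqP; apply: coords => [|i].
      by rewrite linfB // linfZ // wq; ring.
    by rewrite linfB // linfZ // xq -ht mulrCA divff //; ring.
  exists t; last by exists (w v).
  rewrite hp //; move: h2; rewrite {3}vq linfZ // Lq // => E.
  rewrite -(eqr_nat C) natrM natrD natrM -subr_eq0; apply/eqP.
  apply: (mulfI (expf_neq0 2 wv)); rewrite mulr0.
  move/eqP: E; rewrite -subr_eq0 => /eqP E; rewrite -[RHS]oppr0 -E; ring.
have hF := nodal_cubic_trilin; exists nodal_cubic; split=> //.
- exact: finite_sing_cubes6 (sing_reps_finite nF).
- apply: (@not_five_cubes C nodal_cubic w e0) => //; last exact: nodal_cubic_corank2.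
    by rewrite we0 oner_eq0.
  exact: nodal_cubic_double.
by exists (fun i => q (nth [::] pats i)).
Qed.
End NodalFamily.

Lemma rank6_realized (C : numClosedFieldType) k : (k <= 3)%N -> realized C 6 k.
Proof.
have ex bs d pats : size bs = 3%N -> all (leq 1) bs -> uniq pats -> all (fun t => size t == 3%N) pats ->
    (forall a b c, ([:: a; b; c] \in pats) = (2 * sumn [seq (x ^ 3)%N | x <- bs] ==
      d + 4 * sumn (mask [:: a; b; c] [seq (x ^ 3)%N | x <- bs]))%N) ->
    realized C 6 (size pats).
  move=> sb pb up sp h; apply: (@rank6_of_patterns C bs d sb pb pats up) => [t /(allP sp)/eqP|t] //.
  by case: t => [|a [|b [|c [|]]]].
case: k => [|[|[|[|]]]] // _.
- by apply: (ex [:: 1; 1; 1]%N 0%N [::]) => // [] [] [] [].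
- by apply: (ex [:: 1; 1; 1]%N 6%N [:: [:: false; false; false]]) => // [] [] [] [].
- by apply: (ex [:: 1; 1; 2]%N 16%N [:: [:: true; false; false]; [:: false; true; false]])
    => // [] [] [] [].
by apply: (ex [:: 1; 1; 1]%N 2%N [:: [:: true; false; false]; [:: false; true; false];
  [:: false; false; true]]) => // [] [] [] [].
Qed.

(** * Conclusion *)
Section Transfer.
Variable C : numClosedFieldType.
Local Open Scope ring_scope.

Lemma realized_surface r k : realized C r k -> exists f : {mpoly C[4]},
  [/\ cubic_surface f, has_rank f r & exactly_k_singular_points f k].
Proof.
move=> [F [hF Fr nFr [p np]]]; have [f hf pf] := cubic_of_cubes hF Fr.
have fE s : sum_of_cubes f s <-> cubes s (fun v => F v v v).
  by split=> [/(sum_of_cubesP _ hf)|h]; [|apply/(sum_of_cubesP _ hf)];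
    [move=> h|]; apply: (cubes_ext h) => v; rewrite pf.
exists f; split.
- rewrite /cubic_surface hf andbT; apply/eqP => f0; apply: nFr.
  apply: (@cubes_weak _ _ 0) => //; apply: (cubes_ext (cubes0 C 4)) => v.
  by rewrite -pf -polar_diag // f0 meval0.
- split=> [|s /fE h]; first exact/fE.
  rewrite leqNgt; apply/negP => sr; apply: nFr; apply: cubes_weak h.
  by rewrite -ltnS (ltn_predK sr).
apply/exactly_k_sing_reps => //; exists p.
by case: np => n1 n2 n3 n4; split=> // [i u|v v0 sv]; [rewrite pf; exact: n2|
  apply: n4 => // u; rewrite -pf; exact: sv].
Qed.

Lemma surface_rank r k (f : {mpoly C[4]}) : cubic_surface f -> has_rank f r ->
  exactly_k_singular_points f k -> (k <= 4)%N ->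
  [\/ r = 3 /\ k = 1, r = 4 /\ (k = 0 \/ k = 1), r = 5 /\ (k <= 4)%N | r = 6 /\ (k <= 3)%N]%N.
Proof.
move=> /andP[_ hf] [fr minr] /(exactly_k_sing_reps k hf) [p np] k4.
apply: (sing_reps_rank (polar_trilin f) np k4); first exact/sum_of_cubesP.
by move=> s /(sum_of_cubesP s hf) /minr.
Qed.
End Transfer.

Local Close Scope ring_scope.

Theorem theorem3p1 (R : realType) :
  (forall r k : nat, (1 <= r <= 7)%N -> (k <= 4)%N ->
     (exists f : {mpoly R[i][4]},
        [/\ cubic_surface f, has_rank f r & exactly_k_singular_points f k])
     <->
     [\/ r = 3 /\ k = 1,
         r = 4 /\ (k = 0 \/ k = 1),
         r = 5 /\ (k <= 4)%N
       | r = 6 /\ (k <= 3)%N])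
  /\
  (forall r k : nat, [\/ r = 1, r = 2 | r = 7] -> (k <= 4)%N ->
     ~ exists f : {mpoly R[i][4]},
         [/\ cubic_surface f, has_rank f r & exactly_k_singular_points f k]).
Proof.
have nec r k : (k <= 4)%N -> (exists f : {mpoly R[i][4]},
    [/\ cubic_surface f, has_rank f r & exactly_k_singular_points f k]) ->
    [\/ r = 3 /\ k = 1, r = 4 /\ (k = 0 \/ k = 1), r = 5 /\ (k <= 4)%N | r = 6 /\ (k <= 3)%N].
  by move=> k4 [f [cf rf kf]]; exact: surface_rank cf rf kf k4.
split=> [r k _ k4|r k hr k4 /(nec r k k4)]; last first.
  by case: hr => ->; case=> [] [].
split=> [|[[-> ->]|[-> [] ->]|[-> k5]|[-> k3]]]; first exact: nec.
- exact: realized_surface (rank3_one_singular _).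
- exact: realized_surface (rank4_smooth _).
- exact: realized_surface (rank4_one_singular _).
- exact: realized_surface (rank5_realized _ k5).
- exact: realized_surface (rank6_realized _ k3).
Qed.
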